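(* Let $\mu=\sum_{m=1}^k p_m\delta_{\alpha_m}$ be a finitely supported probability measure with distinct $\alpha_1,\ldots,\alpha_k\in(0,1)$, $p_m>0$ and $\sum_{m=1}^k p_m=1$, let $\nu_\mu=\sum_{m=1}^k p_m\,es_{\alpha_m}$ be the associated spectral risk measure of $F$, and let $$\bigl(\widehat q_{n,\alpha_1},\ldots,\widehat q_{n,\alpha_k},\widehat\nu_{\mu,n}\bigr)\in\operatorname*{arg\,min}_{(x_1,\ldots,x_{k+1})\in\mathbb{R}^{k+1}}\ \sum_{i=1}^n S_{sp}(x_1,\ldots,x_{k+1};X_i).$$ Then $$\widehat\nu_{\mu,n}=\sum_{m=1}^k p_m\,\widehat{es}_{n,\alpha_m}.$$ Consequently, suppose that Assumption [A$^k$] holds, i.e. for each $m\in\{1,\ldots,k\}$ there are a deterministic sequence $(a_{m,n})_n$ of positive numbers with $a_{m,n}\to\infty$ and a function $\psi_{\alpha_m}:\mathbb{R}\to\overline{\mathbb{R}}$ with $\lim_{t\to\infty}\psi_{\alpha_m}(t)=\infty$, $\lim_{t\to-\infty}\psi_{\alpha_m}(t)=-\infty$ such that $\lim_{n\to\infty}\sqrt n\,[F(q_{\alpha_m}+t/a_{m,n})-F(q_{\alpha_m})]=\psi_{\alpha_m}(t)$ for all $t\in\mathbb{R}$, and that Assumption [B] holds, i.e. $\mathbb{E}[1_{Y\le 0}Y^2]<\infty$. Then, as $n\to\infty$, $$\sqrt n\,\bigl(\widehat\nu_{\mu,n}-\nu_\mu\bigr)\Rightarrow\sum_{m=1}^k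 p_m\,W_{m,2}$$ in distribution, where $(W_{1,2},\ldots,W_{k,2})$ is centred jointly normal with, for $s,t\in\{1,\ldots,k\}$, $$\operatorname{Cov}(W_{s,2},W_{t,2})=\frac{\alpha_s\wedge\alpha_t}{\alpha_s\alpha_t}\bigl(q_{\alpha_s}q_{\alpha_t}-(q_{\alpha_s}+q_{\alpha_t})\,es_{\alpha_s\wedge\alpha_t}\bigr)+\frac{1}{\alpha_s\alpha_t}\mathbb{E}\bigl[1_{Y\le q_{\alpha_s\wedge\alpha_t}}Y^2\bigr]-(es_{\alpha_s}-q_{\alpha_s})(es_{\alpha_t}-q_{\alpha_t}).$$
   Context: $Y$ is a real random variable with distribution function $F$ and $\mathbb{E}|Y|<\infty$, and $X_1,X_2,\ldots$ are i.i.d. with distribution function $F$. Standing assumption: for each level $\alpha\in\{\alpha_1,\ldots,\alpha_k\}$, $F$ is continuous and strictly increasing at its $\alpha$-quantile $q_\alpha$ (so that $q_\alpha$ is unique). The lower tail expected shortfall at level $\alpha$ is $es_\alpha=\frac1\alpha\int_0^\alpha F^{-1}(u)\,du=\frac1\alpha\int_{-\infty}^{q_\alpha}y\,dF(y)$. $\overline{\mathbb{R}}=\mathbb{R}\cup\{-\infty,\infty\}$ and $a\wedge b=\min(a,b)$. Let $\mathcal{G}:\mathbb{R}\to\mathbb{R}$ be three times continuously differentiable with $\mathcal{G}'=G$, $G'>0$ and $\lim_{x\to-\infty}G(x)=0$. The scoring function for quantile and expected shortfall at level $\alpha$ is $$S(x_1,x_2;y)=(1_{y\le x_1}-\alpha)(x_1-y)+G(x_2)\bigl(x_2+\alpha^{-1}(1_{y\le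 x_1}-\alpha)(x_1-y)\bigr)-\mathcal{G}(x_2)-G(x_2)\,y ,$$ and for each level $\alpha=\alpha_m$, $\widehat{es}_{n,\alpha}$ is the second component of any minimizer over $(x_1,x_2)\in\mathbb{R}^2$ of $\sum_{i=1}^n S(x_1,x_2;X_i)$. The scoring function for the spectral risk measure is $$S_{sp}(x_1,\ldots,x_k,x_{k+1};z)=\sum_{m=1}^k\Bigl(\bigl(1+\tfrac{p_m}{\alpha_m}G(x_{k+1})\bigr)(1_{z\le x_m}-\alpha_m)(x_m-z)+p_m\bigl(G(x_{k+1})(x_{k+1}-z)-\mathcal{G}(x_{k+1})\bigr)\Bigr).$$ *)

(* Defs.v *)
From HB Require Import structures.
From mathcomp Require Import all_boot all_order all_algebra.
From mathcomp Require Import all_classical all_reals all_analysis.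

Set Implicit Arguments.
Unset Strict Implicit.
Unset Printing Implicit Defensive.

Import Order.TTheory GRing.Theory Num.Theory.
Import numFieldNormedType.Exports.

Local Open Scope ring_scope.
Local Open Scope classical_set_scope.

(* Generalized inverse F^{-1}(u) = inf {y | u <= F y}; [inf] takes a junk value
   on empty or unbounded sets, which cannot occur for 0 < u < 1 when F is a
   distribution function. *)
Definition quantile (R : realType) (F : R -> R) (u : R) : R :=
  inf [set y | u <= F y].

Definition strictly_increasing_at (R : realType) (F : R -> R) (q : R) : Prop :=
  (forall x, x < q -> F x < F q) /\ (forall x, q < x -> F q < F x).

Definition expected_shortfall (R : realType) (F : R -> R) (alpha : R) : R :=
  alpha^-1 *
    (\int[@lebesgue_measure R]_(u in `]0, alpha]) quantile F u)%R.

Definition spectral_risk (R : realType) (F : R -> R) (k : nat)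
    (alpha p : 'I_k -> R) : R :=
  \sum_(m < k) p m * expected_shortfall F (alpha m).

Definition continuously_differentiable3 (R : realType) (f : R -> R) : Prop :=
  (forall j x, (j < 3)%N -> derivable (f^`(j)) x 1) /\ continuous (f^`(3)).

(* The two scoring functions; [calG] is the primitive of the weight function
   G = calG^`(). *)
Definition score_es (R : realType) (calG : R -> R) (alpha x1 x2 y : R) : R :=
  let G : R -> R := calG^`() in
  ((y <= x1)%R%:R - alpha) * (x1 - y)
  + G x2 * (x2 + alpha^-1 * ((y <= x1)%R%:R - alpha) * (x1 - y))
  - calG x2 - G x2 * y.

(* [x] holds the first k coordinates of the argument, [v] the last one. *)
Definition score_sp (R : realType) (calG : R -> R) (k : nat)
    (alpha p : 'I_k -> R) (x : 'I_k -> R) (v z : R) : R :=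
  let G : R -> R := calG^`() in
  \sum_(m < k)
    ((1 + p m / alpha m * G v) * ((z <= x m)%R%:R - alpha m) * (x m - z)
     + p m * (G v * (v - z) - calG v)).

Definition argmin (R : realType) (T : Type) (f : T -> R) : set T :=
  [set x | forall y, f x <= f y].

Definition mutually_independent (R : realType) (d : measure_display)
    (T : measurableType d) (P : probability T R) (X : nat -> {RV P >-> R}) :
    Prop :=
  forall (s : seq nat) (B : nat -> set R), uniq s ->
    (forall i, measurable (B i)) ->
    P (\bigcap_(i in [set` s]) (X i @^-1` B i)) =
    (\prod_(i <- s) P (X i @^-1` B i))%E.

(* Convergence in distribution of real random variables, which may live on
   another probability space than their limit.  Measurability is part of the
   definition since the Z n are plain functions. *)
Definition cvg_in_distribution (R : realType)
    (d : measure_display) (T : measurableType d) (P : probability T R)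
    (Z : nat -> T -> R)
    (d' : measure_display) (T' : measurableType d') (P' : probability T' R)
    (W : T' -> R) : Prop :=
  [/\ forall n, measurable_fun setT (Z n),
      measurable_fun setT W &
      forall f : R -> R, continuous f -> bounded_fun f ->
        ('E_P[f \o Z n] @[n --> \oo] --> 'E_P'[f \o W])%E].

(* The normal law with mean m and *variance* v >= 0, degenerate for v = 0:
   the library's [normal_prob m s] takes the standard deviation and is the
   uniform law on [0, 1] for s = 0. *)
Definition normal_law (R : realType) (m v : R) (A : set R) : \bar R :=
  if v == 0 then (\d_ m A)%E else normal_prob m (Num.sqrt v) A.

(* Every linear combination is univariate normal, possibly degenerate. *)
Definition jointly_normal (R : realType) (d : measure_display)
    (T : measurableType d) (P : probability T R) (k : nat)
    (W : 'I_k -> {RV P >-> R}) : Prop :=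
  forall c : 'I_k -> R, exists m v : R, 0 <= v /\
    forall A : set R, measurable A ->
      P ((fun w => \sum_(i < k) c i * W i w) @^-1` A) = normal_law m v A.

(* The local behaviour of F at its alpha-quantile, for the single level alpha;
   [a] and [psi] may depend on alpha. *)
Definition assumption_A (R : realType) (F : R -> R) (alpha : R) : Prop :=
  let q := quantile F alpha in
  exists (a : nat -> R) (psi : R -> \bar R),
    [/\ forall n, 0 < a n,
        a n @[n --> \oo] --> +oo,
        psi t @[t --> +oo] --> +oo%E,
        psi t @[t --> -oo] --> -oo%E &
        forall t : R,
          (Num.sqrt n%:R * (F (q + t / a n) - F q))%:E @[n --> \oo] --> psi t].

(* E[1_{Y <= q} Y^2] *)
Definition lower_moment2 (R : realType) (d : measure_display)
    (T : measurableType d) (P : probability T R) (Y : {RV P >-> R}) (q : R) :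
    \bar R :=
  'E_P[fun w => ((Y w <= q)%R%:R * Y w ^+ 2)%R]%E.

Definition assumption_B (R : realType) (d : measure_display)
    (T : measurableType d) (P : probability T R) (Y : {RV P >-> R}) : Prop :=
  (lower_moment2 Y 0 < +oo)%E.

(* Asymptotic covariance of the empirical expected shortfalls at the levels
   a and b; the expectation is finite under [assumption_B]. *)
Definition es_cov (R : realType) (d : measure_display) (T : measurableType d)
    (P : probability T R) (Y : {RV P >-> R}) (F : R -> R) (a b : R) : R :=
  let q := quantile F in
  let es := expected_shortfall F in
  let ab := Num.min a b in
  ab / (a * b) * (q a * q b - (q a + q b) * es ab)
  + (a * b)^-1 * fine (lower_moment2 Y (q ab))
  - (es a - q a) * (es b - q b).

(* Main.v *)
Require Import Defs.
From HB Require Import structures.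
From mathcomp Require Import all_boot all_order all_algebra.
From mathcomp Require Import all_classical all_reals all_analysis.
From mathcomp Require Import measurable_realfun.
From mathcomp Require Import ring lra.
Import Order.TTheory GRing.Theory Num.Theory.
Import numFieldNormedType.Exports.
Local Open Scope ring_scope.
Local Open Scope classical_set_scope.

(** The first claim is an identity between optimal values. For data X_1, ..., X_n
    put O_m(x) = x - (alpha_m n)^-1 sum_i (x - X_i)^+, a concave function of x.
    Since (1_(y <= x) - alpha) (x - y) = (x - y)^+ - alpha (x - y), the
    empirical score is, up to a constant, -n times

      sum_m (alpha_m + p_m G(v)) O_m(x_m) - G(v) v + calG(v)

    ([sum_score_sp]). The weight G increases from 0 at -oo, so the factors
    alpha_m + p_m G(v) are positive and each x_m of a minimizer maximizes O_m;
    the derivative in v is G'(v) (sum_m p_m O_m(x_m) - v) with G' > 0, so v is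
    the weighted sum of the maxima of the O_m ([argmin_score_sp]). The score of a
    single level is the case k = 1, so the empirical expected shortfall is
    max O_m, whatever minimizer is chosen.

    For the limit, let q_m be the alpha_m-quantile. The average O_m(q_m) has
    mean es_m, by the quantile transform ([es_ramp]), and max O_m exceeds
    O_m(q_m) by o_P(n^(-1/2)) ([es_remainder]). Indeed, let F_n be the empirical
    distribution function and eta > 0. With probability tending to 1,
    F_n(q_m - eta) < alpha_m < F_n(q_m + eta), because F is strictly increasing
    at q_m; concavity then bounds the excess by eta |1 - F_n(q_m) / alpha_m|, where
    F_n(q_m) - alpha_m is of order n^(-1/2) and eta is arbitrarily small.
    What remains is the central limit theorem for the i.i.d. sum of
    sum_m p_m [es_influence F alpha_m], whose second moment is the quadratic form of
    the covariance matrix [es_cov] at p ([qform_es_cov]).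

    The central limit theorem is proved by Lindeberg replacement against bounded
    test functions with a second-order Taylor estimate ([clt_taylor]). Cubic
    spline steps are such test functions; a negligible perturbation does not
    change the limit ([slutsky_test]), and convergence for spline steps gives
    convergence in distribution ([cvg_law_of_steps]), since a continuous function
    is close to a finite combination of steps on a compact interval. The Gaussian
    vector is built from the covariance matrix by adding one independent normal
    variable per step of a Cholesky decomposition ([gaussian_family_exists]). *)

Set Implicit Arguments.
Unset Strict Implicit.

(** * Real expectations *)

Local Notation Ex P f := (Rintegral P setT f).
Local Notation L1 P f := (integrable P setT (EFin \o f)).

Lemma L1_dom d (T : measurableType d) (R : realType)
    (P : {measure set T -> \bar R}) (f g : T -> R) :
  measurable_fun setT f -> L1 P g -> (forall w, `|f w| <= g w) -> L1 P f.
Proof.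
move=> mf ig fg; apply: (le_integrable measurableT _ _ ig).
  exact/measurable_EFinP.
by move=> w _ /=; rewrite lee_fin (le_trans (fg w))// ler_norm.
Qed.

Lemma L1_cst d (T : measurableType d) (R : realType) (P : probability T R)
  (c : R) : L1 P (fun=> c).
Proof. exact: (finite_measure_integrable_cst P c). Qed.

Lemma L1_bounded d (T : measurableType d) (R : realType)
    (P : probability T R) (f : T -> R) (M : R) :
  measurable_fun setT f -> (forall w, `|f w| <= M) -> L1 P f.
Proof. by move=> mf fM; apply: (L1_dom mf (L1_cst P M)). Qed.

Lemma L1D d (T : measurableType d) (R : realType)
    (P : {measure set T -> \bar R}) (f g : T -> R) :
  L1 P f -> L1 P g -> L1 P (fun w => f w + g w).
Proof. by move=> fi gi; exact: (integrableD measurableT fi gi). Qed.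

Lemma L1B d (T : measurableType d) (R : realType)
    (P : {measure set T -> \bar R}) (f g : T -> R) :
  L1 P f -> L1 P g -> L1 P (fun w => f w - g w).
Proof. by move=> fi gi; exact: (integrableB measurableT fi gi). Qed.

Lemma L1Z d (T : measurableType d) (R : realType)
    (P : {measure set T -> \bar R}) (c : R) (f : T -> R) :
  L1 P f -> L1 P (fun w => c * f w).
Proof. by move=> fi; exact: (integrableZl measurableT c fi). Qed.

Lemma L1_sum d (T : measurableType d) (R : realType) (P : probability T R)
    (I : Type) (r : seq I) (f : I -> T -> R) :
  (forall i, L1 P (f i)) -> L1 P (fun w => \sum_(i <- r) f i w).
Proof.
move=> fi; elim: r => [|i r IH].
  by under [X in EFin \o X]funext do rewrite big_nil; exact: L1_cst.
by under [X in EFin \o X]funext do rewrite big_cons; exact: L1D.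
Qed.

Lemma L1_measurable d (T : measurableType d) (R : realType)
    (P : {measure set T -> \bar R}) (f : T -> R) :
  L1 P f -> measurable_fun setT f.
Proof. by move=> /integrableP[/measurable_EFinP]. Qed.

Lemma Ex_cst d (T : measurableType d) (R : realType) (P : probability T R)
  (c : R) : Ex P (fun=> c) = c.
Proof. by rewrite Rintegral_cst//= probability_setT mulr1. Qed.

Lemma Ex_sum d (T : measurableType d) (R : realType) (P : probability T R)
    (I : Type) (r : seq I) (f : I -> T -> R) :
  (forall i, L1 P (f i)) ->
  Ex P (fun w => \sum_(i <- r) f i w) = \sum_(i <- r) Ex P (f i).
Proof.
move=> fi; elim: r => [|i r IH].
  by rewrite big_nil -[RHS](Ex_cst P); apply: eq_Rintegral => w _; rewrite big_nil.
rewrite big_cons -IH -RintegralD//; last exact: L1_sum.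
by apply: eq_Rintegral => w _; rewrite big_cons.
Qed.

Lemma le_Ex d (T : measurableType d) (R : realType)
    (P : {measure set T -> \bar R}) (f g : T -> R) :
  L1 P f -> L1 P g -> (forall w, f w <= g w) -> Ex P f <= Ex P g.
Proof. by move=> fi gi fg; apply: le_Rintegral. Qed.

Lemma Ex_le_norm d (T : measurableType d) (R : realType)
    (P : {measure set T -> \bar R}) (f g : T -> R) :
  L1 P f -> L1 P g -> (forall w, `|f w| <= g w) -> `|Ex P f| <= Ex P g.
Proof.
move=> fi gi fg; rewrite ler_norml; apply/andP; split.
  rewrite -mulN1r -RintegralZl//; apply: le_Ex => // [|w]; first exact: L1Z.
  by rewrite mulN1r lerNl; apply: le_trans (fg w); rewrite -normrN ler_norm.
by apply: le_Ex => // w; apply: le_trans (fg w); rewrite ler_norm.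
Qed.

Lemma Ex_bounded d (T : measurableType d) (R : realType)
    (P : probability T R) (f : T -> R) (M : R) :
  measurable_fun setT f -> (forall w, `|f w| <= M) -> `|Ex P f| <= M.
Proof.
move=> mf fM; rewrite -[leRHS](Ex_cst P).
by apply: Ex_le_norm => //; [exact: L1_bounded fM|exact: L1_cst].
Qed.

Lemma EFin_Ex d (T : measurableType d) (R : realType)
    (P : {measure set T -> \bar R}) (f : T -> R) :
  L1 P f -> (Ex P f)%:E = (\int[P]_w (f w)%:E)%E.
Proof. by move=> fi; rewrite /Rintegral fineK// integrable_fin_num. Qed.

Lemma measurable_mfun_preimage d (T : measurableType d) (R : realType)
    (X : {mfun T >-> R}) (A : set R) : measurable A -> measurable (X @^-1` A).
Proof. by move=> mA; rewrite -[X in measurable X]setTI; exact: measurable_funP. Qed.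

Lemma Ex_pushforward d d' (T : measurableType d) (T' : measurableType d')
    (R : realType) (P : probability T R) (X : {mfun T >-> T'}) (h : T' -> R) :
  measurable_fun setT h -> L1 P (h \o X) ->
  Ex (distribution P X) h = Ex P (h \o X).
Proof.
move=> mh hi; congr fine.
by rewrite integral_distribution//; exact/measurable_EFinP.
Qed.

Lemma Ex_fubini d1 d2 (T1 : measurableType d1) (T2 : measurableType d2)
    (R : realType) (P1 : probability T1 R) (P2 : probability T2 R)
    (h : T1 * T2 -> R) (M : R) :
  measurable_fun setT h -> (forall z, `|h z| <= M) ->
  [/\ Ex (P1 \x P2)%E h = Ex P1 (fun x => Ex P2 (fun y => h (x, y))),
      Ex (P1 \x P2)%E h = Ex P2 (fun y => Ex P1 (fun x => h (x, y))),
      measurable_fun setT (fun x => Ex P2 (fun y => h (x, y))) &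
      measurable_fun setT (fun y => Ex P1 (fun x => h (x, y)))].
Proof.
move=> mh hM.
have hi : L1 (P1 \x P2)%E h.
  exact: (L1_bounded (P1 \x P2)%E mh hM).
have e1 x : (Ex P2 (fun y => h (x, y)))%:E = fubini_F P2 (EFin \o h) x.
  rewrite EFin_Ex//; apply: (@L1_bounded _ _ _ _ _ M) => //.
  exact: measurableT_comp mh (measurable_pair1 x).
have e2 y : (Ex P1 (fun x => h (x, y)))%:E = fubini_G P1 (EFin \o h) y.
  rewrite EFin_Ex//; apply: (@L1_bounded _ _ _ _ _ M) => //.
  exact: measurableT_comp mh (measurable_pair2 y).
split.
- rewrite /Rintegral -integral12_prod_meas1//; congr fine.
  by apply: eq_integral => x _; rewrite -e1.
- rewrite /Rintegral -integral21_prod_meas1//; congr fine.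
  by apply: eq_integral => x _; rewrite -e2.
- apply/measurable_EFinP; rewrite [X in measurable_fun _ X](_ : _ = fubini_F P2 (EFin \o h)).
    exact: (measurable_fubini_F hi).
  by apply/funext => z; exact: e1.
- apply/measurable_EFinP; rewrite [X in measurable_fun _ X](_ : _ = fubini_G P1 (EFin \o h)).
    exact: (measurable_fubini_G hi).
  by apply/funext => z; exact: e2.
Qed.

(** By independence the joint law of (U, V) is a product measure, for which this is
    Fubini's theorem. *)
Lemma Ex_indep d (T : measurableType d) (R : realType) (P : probability T R)
    (U V : {mfun T >-> R}) (h : R * R -> R) (M : R) :
  (forall A B, measurable A -> measurable B ->
    P (U @^-1` A `&` V @^-1` B) = (P (U @^-1` A) * P (V @^-1` B))%E) ->
  measurable_fun setT h -> (forall z, `|h z| <= M) ->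
  Ex P (fun w => h (U w, V w)) = Ex P (fun w => Ex P (fun w' => h (U w, V w'))).
Proof.
move=> UV mh hM.
have mUV : measurable_fun setT (fun w => (U w, V w))
  by apply: measurable_fun_pair => /=; exact: measurable_funP.
pose W : {mfun T >-> (R * R)%type} := mfun_Sub (mem_set mUV).
have LW A : measurable A ->
    (distribution P U \x distribution P V)%E A = distribution P W A.
  by apply: product_measure_unique => B C mB mC; rewrite -UV.
have iW : L1 P (h \o W) 
  by apply: (@L1_bounded _ _ _ _ _ M (measurableT_comp mh mUV)) => w; exact: hM.
rewrite -[LHS]/(Ex P (h \o W)) -Ex_pushforward//.
rewrite (_ : Ex (distribution P W) h =
    Ex (distribution P U \x distribution P V)%E h); last first.
  by congr fine; apply: eq_measure_integral => A mA _; apply/esym/LW.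
have [-> _ mF _] := Ex_fubini (distribution P U) (distribution P V) mh hM.
rewrite Ex_pushforward//; last first.
  apply: (@L1_bounded _ _ _ _ _ M).
    exact: measurableT_comp.
  move=> w; apply: Ex_bounded => // .
  exact: measurableT_comp mh (measurable_pair1 _).
apply: eq_Rintegral => w _ /=; rewrite Ex_pushforward//.
  exact: measurableT_comp mh (measurable_pair1 _).
apply: (@L1_bounded _ _ _ _ _ M) => [|w'] /=; last exact: hM.
apply: measurableT_comp => //.
exact: measurableT_comp mh (measurable_pair1 _).
Qed.

(** The closed left rays form a pi-system that generates the Borel sets. *)
Lemma prob_eq_cdf (R : realType) (m1 m2 : {measure set R -> \bar R}) :
  m1 setT = 1%E -> m2 setT = 1%E -> 
  (forall r, m1 `]-oo, r] = m2 `]-oo, r]) ->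
  forall A, measurable A -> m1 A = m2 A.
Proof.
move=> m1T m2T m12.
pose G := [set A : set R | A = setT \/ exists r, A = `]-oo, r]%classic].
apply: (@measure_unique _ _ _ G (fun=> setT)).
- apply/seteqP; split => A; last first.
    by apply: smallest_sub; [exact: sigma_algebra_measurable|move=> B [->|[r ->]]].
  rewrite [X in X A -> _]RGenOInfty.measurableE.
  apply: smallest_sub; first exact: smallest_sigma_algebra.
  move=> _ [x ->]; rewrite -setCitvl.
  apply: (@measurableC _ (g_sigma_algebraType G)).
  by apply: sub_sigma_algebra; right; exists x.
- move=> A B [->|[r ->]] [->|[s ->]]; rewrite ?setIT ?setTI; try by [left|right; eexists].
  right; exists (Num.min r s); apply/seteqP; split => x /=; rewrite !in_itv/= le_min.
    by case=> -> ->.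
  by move=> /andP.
- by left.
- by rewrite bigcup_const.
- by move=> A [->|[r ->]]; rewrite ?m1T ?m2T.
- by move=> _; rewrite m1T ltry.
Qed.

(** Both sides are integrals of h against the common image law. *)
Lemma same_distribution_Ex d1 d2 (T1 : measurableType d1) (T2 : measurableType d2)
    (R : realType) (P1 : probability T1 R) (P2 : probability T2 R)
    (X1 : {mfun T1 >-> R}) (X2 : {mfun T2 >-> R}) (h : R -> R) :
  (forall A, measurable A -> P1 (X1 @^-1` A) = P2 (X2 @^-1` A)) ->
  measurable_fun setT h -> L1 P2 (fun w => h (X2 w)) ->
  L1 P1 (fun w => h (X1 w)) /\ Ex P1 (fun w => h (X1 w)) = Ex P2 (fun w => h (X2 w)).
Proof.
move=> DE mh ih.
have mEh : measurable_fun setT (fun x => `|(h x)%:E|%E).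
  by apply: measurableT_comp => //; exact/measurable_EFinP.
have i1 : L1 P1 (h \o X1).
  apply/integrableP; split; first exact/measurable_EFinP/measurableT_comp.
  have := ge0_integral_distribution (P := P1) X1 mEh (fun=> abse_ge0 _).
  rewrite /= => <-.
  have := ge0_integral_distribution (P := P2) X2 mEh (fun=> abse_ge0 _).
  rewrite -(eq_measure_integral (distribution P2 X2) (m1 := distribution P1 X1)).
    by move=> ->; have /integrableP[] := ih.
  by move=> A mA _; exact: DE.
split; first exact: i1.
rewrite -[LHS](Ex_pushforward (P := P1) (X := X1) mh i1).
rewrite -[RHS](Ex_pushforward (P := P2) (X := X2) mh ih).
by congr fine; apply: eq_measure_integral => A mA _; exact: DE.
Qed.

Lemma same_cdf_Ex d1 d2 (T1 : measurableType d1) (T2 : measurableType d2)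
    (R : realType) (P1 : probability T1 R) (P2 : probability T2 R)
    (X1 : {RV P1 >-> R}) (X2 : {RV P2 >-> R}) (h : R -> R) :
  (forall r, cdf X1 r = cdf X2 r) -> measurable_fun setT h ->
  L1 P2 (fun w => h (X2 w)) ->
  L1 P1 (fun w => h (X1 w)) /\ Ex P1 (fun w => h (X1 w)) = Ex P2 (fun w => h (X2 w)).
Proof.
move=> X12; apply: same_distribution_Ex.
by apply: (@prob_eq_cdf R (distribution P1 X1) (distribution P2 X2)) => //;
  exact: probability_setT.
Qed.

(** * Sums of independent variables *)

Definition psum d (T : measurableType d) (R : realType) (X : nat -> {mfun T >-> R})
  (phi : R -> R) (n : nat) (w : T) : R := \sum_(i < n) phi (X i w).

Lemma measurable_psum d (T : measurableType d) (R : realType)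
    (X : nat -> {mfun T >-> R}) (phi : R -> R) n :
  measurable_fun setT phi -> measurable_fun setT (psum X phi n).
Proof. by move=> mphi; apply: measurable_sum => i; exact: measurableT_comp. Qed.

Lemma bigcap_mem1 (T : Type) (n : nat) (D : nat -> set T) :
  \bigcap_(i in [set` [:: n]]) D i = D n.
Proof.
rewrite [X in bigcap X](_ : _ = [set n]) ?bigcap_set1//.
by apply/seteqP; split => i /=; rewrite inE => /eqP.
Qed.

(** If P C > 0, the law of (U, V) conditional on C has the same marginals and the
    same product rule as the unconditional law, so the two agree by uniqueness of
    the product measure. If P C = 0 both sides vanish. *)
Lemma indep_of_rect d (T : measurableType d) (R : realType) (P : probability T R)
    (U V : {mfun T >-> R}) (C : set T) :
  measurable C ->
  (forall A B, measurable A -> measurable B ->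
     P (U @^-1` A `&` V @^-1` B) = (P (U @^-1` A) * P (V @^-1` B))%E) ->
  (forall A B, measurable A -> measurable B ->
     P (U @^-1` A `&` V @^-1` B `&` C) =
     (P (U @^-1` A) * P (V @^-1` B) * P C)%E) ->
  forall E : set (R * R), measurable E ->
    P ((fun w => (U w, V w)) @^-1` E `&` C) =
    (P ((fun w => (U w, V w)) @^-1` E) * P C)%E.
Proof.
move=> mC UV UVC E mE.
have mUV : measurable_fun setT (fun w => (U w, V w)).
  by apply: measurable_fun_pair => /=; exact: measurable_funP.
have mWE : measurable ((fun w => (U w, V w)) @^-1` E).
  by rewrite -[X in measurable X]setTI; exact: mUV.
pose W : {mfun T >-> (R * R)%type} := mfun_Sub (mem_set mUV).
have LW A : measurable A ->
    (distribution P U \x distribution P V)%E A = distribution P W A.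
  by apply: product_measure_unique => B D mB mD; rewrite -UV.
have [C0|C0] := eqVneq (P C) 0%E.
  rewrite C0 mule0; apply/eqP; rewrite eq_le measure_ge0 andbT -C0.
  by apply: le_measure; rewrite ?inE//; exact: measurableI.
have [c c0 cE] : exists2 c : R, 0 < c & P C = c%:E.
  exists (fine (P C)); last by rewrite fineK// fin_num_measure.
  by rewrite fine_gt0// lt0e C0 measure_ge0/= -ge0_fin_numE// fin_num_measure.
have c1 : 0 <= c^-1 by rewrite invr_ge0 ltW.
pose m0 : {measure set (R * R)%type -> \bar R} :=
  measure_function_pushforward__canonical__measure_function_Measure
    (mrestr P mC) (measurable_funP W).
pose m' : {measure set (R * R)%type -> \bar R} := mscale (NngNum c1) m0.
have m'E A : m' A = (c^-1%:E * P ((fun w => (U w, V w)) @^-1` A `&` C))%E by [].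
have LC A : measurable A ->
    (distribution P U \x distribution P V)%E A = m' A.
  apply: product_measure_unique => B D mB mD; rewrite m'E.
  rewrite [X in P X](_ : _ = U @^-1` B `&` V @^-1` D `&` C)//.
  by rewrite UVC// cE muleC -muleA -EFinM divff ?gt_eqF// mule1.
have := LC _ mE; rewrite LW// => WE.
rewrite -[P ((fun w => _) @^-1` E)]/(distribution P W E) WE m'E cE.
by rewrite muleC muleA -EFinM divff ?gt_eqF// mul1e.
Qed.

(** [mutually_independent] only speaks of events that involve one variable each.
    The sum of the first n variables is handled by induction, keeping an arbitrary
    event of the later ones: (S_n, X_n) is independent of that event by [indep_of_rect], and
    S_(n+1) is a function of this pair. *)
Lemma psum_indep d (T : measurableType d) (R : realType) (P : probability T R)
    (X : nat -> {RV P >-> R}) (phi : R -> R) (n : nat) :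
  mutually_independent X -> measurable_fun setT phi ->
  forall (A : set R) (s : seq nat) (B : nat -> set R), measurable A ->
    (forall i, measurable (B i)) -> uniq s -> all (leq n) s ->
  P (psum X phi n @^-1` A `&` \bigcap_(i in [set` s]) (X i @^-1` B i)) =
  (P (psum X phi n @^-1` A) * P (\bigcap_(i in [set` s]) (X i @^-1` B i)))%E.
Proof.
move=> indX mphi; elim: n => [|n IH] A s B mA mB us ns.
  have -> : psum X phi 0 = cst 0 by apply/funext => w; rewrite /psum big_ord0.
  have [A0|A0] := pselect (A 0).
    by rewrite preimage_cst mem_set//= setTI probability_setT mul1e.
  by rewrite preimage_cst memNset//= set0I measure0 mul0e.
set C := \bigcap_(i in _) _.
have mC : measurable C.
  by apply: fin_bigcap_measurable => // i _; exact: measurable_mfun_preimage.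
pose S : {mfun T >-> R} := mfun_Sub (mem_set (measurable_psum X n mphi)).
have nns : n \notin s by apply/negP => /(allP ns); rewrite ltnn.
have sn i : i \in s -> (i == n) = false.
  by move=> si; apply: contraNF nns => /eqP <-.
have B2 (D1 : set R) : \bigcap_(i in [set` n :: s])
    (X i @^-1` (if i == n then D1 else B i)) = X n @^-1` D1 `&` C.
  apply/seteqP; split => w /=.
    move=> h; split; first by have := h n; rewrite /= inE !eqxx; exact.
    by move=> i /= si; have := h i; rewrite /= inE si orbT sn//; exact.
  move=> [wn wC] i /=; rewrite inE; case: eqVneq => [-> //|_ /= si].
  exact: wC.
have mBD (D1 : set R) : measurable D1 -> forall i, measurable (if i == n then D1 else B i).
  by move=> mD i; case: ifP.
have sub_ns : all (leq n) s by apply: sub_all ns => i; exact: ltnW.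
have UV (A1 D1 : set R) : measurable A1 -> measurable D1 ->
    P (S @^-1` A1 `&` X n @^-1` D1) = (P (S @^-1` A1) * P (X n @^-1` D1))%E.
  move=> mA1 mD1; have := IH A1 [:: n] (fun=> D1) mA1 (fun=> mD1) erefl.
  by rewrite /= leqnn !bigcap_mem1; exact.
have XC (D1 : set R) : measurable D1 ->
    P (X n @^-1` D1 `&` C) = (P (X n @^-1` D1) * P C)%E.
  move=> mD1; have := indX (n :: s) _ _ (mBD D1 mD1).
  rewrite B2 big_cons eqxx => ->; last by rewrite /= nns.
  congr (_ * _)%E; rewrite /C indX//; apply: eq_big_seq => i si.
  by rewrite sn.
have UVC (A1 D1 : set R) : measurable A1 -> measurable D1 ->
    P (S @^-1` A1 `&` X n @^-1` D1 `&` C) =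
    (P (S @^-1` A1) * P (X n @^-1` D1) * P C)%E.
  move=> mA1 mD1; rewrite -setIA -B2.
  rewrite [LHS](IH A1 (n :: s) _ mA1 (mBD D1 mD1)) /= ?nns ?leqnn//.
  by rewrite B2 XC// muleA.
have mE : measurable ((fun z : R * R => z.1 + phi z.2) @^-1` A).
  rewrite -[X in measurable X]setTI.
  suff : measurable_fun setT (fun z : R * R => z.1 + phi z.2) by exact.
  by apply: measurable_funD => //; exact: measurableT_comp.
have := indep_of_rect mC UV UVC mE.
rewrite (_ : (fun w => (S w, X n w)) @^-1` _ = psum X phi n.+1 @^-1` A)//.
by apply/seteqP; split => w; rewrite /= /psum big_ord_recr.
Qed.

(** The form in which independence enters the limit theorems: the last summand may
    be averaged separately. The factor c is the normalization of the sum. *)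
Lemma Ex_psumS d (T : measurableType d) (R : realType) (P : probability T R)
    (X : nat -> {RV P >-> R}) (phi h : R -> R) (n : nat) (M c : R) :
  mutually_independent X -> measurable_fun setT phi ->
  measurable_fun setT h -> (forall x, `|h x| <= M) ->
  Ex P (fun w => h (c * psum X phi n.+1 w)) =
  Ex P (fun w => Ex P (fun w' => h (c * psum X phi n w + c * phi (X n w')))).
Proof.
move=> indX mphi mh hM.
pose S : {mfun T >-> R} := mfun_Sub (mem_set (measurable_psum X n mphi)).
have UV (A1 D1 : set R) : measurable A1 -> measurable D1 ->
    P (S @^-1` A1 `&` X n @^-1` D1) = (P (S @^-1` A1) * P (X n @^-1` D1))%E.
  move=> mA1 mD1.
  have := psum_indep (n := n) indX mphi (s := [:: n]) mA1 (fun=> mD1) erefl.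
  by rewrite /= leqnn !bigcap_mem1; exact.
have mg : measurable_fun setT (fun z : R * R => h (c * z.1 + c * phi z.2)).
  apply: measurableT_comp => //; apply: measurable_funD; apply: measurable_funM => //.
  exact: measurableT_comp.
have := Ex_indep UV mg (fun z => hM _).
rewrite /= => <-; apply: eq_Rintegral => w _; rewrite /S/= /psum.
by rewrite big_ord_recr/= mulrDr.
Qed.

(** * Gaussian densities and convolution *)

(** The left-hand side is a measure of A that gives half-open intervals their length,
    which characterizes Lebesgue measure. *)
Lemma lebesgue_affine (R : realType) (b t : R) (t0 : 0 < t) (A : set R) :
  measurable A ->
  (t%:E * lebesgue_measure ((fun x : R => b + t * x)%R @^-1` A))%E =
  lebesgue_measure A.
Proof.
move=> mA.
have t1 : 0 <= t by exact: ltW.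
have ma : measurable_fun setT ((fun x : measurableTypeR R => b + t * x) : _ -> measurableTypeR R).
  by apply: measurable_funD => //; apply: measurable_funM.
pose m0 : {measure set (measurableTypeR R) -> \bar R} :=
  measure_function_pushforward__canonical__measure_function_Measure
    (@lebesgue_measure R) ma.
pose m' : {measure set (measurableTypeR R) -> \bar R} := mscale (NngNum t1) m0.
have m'E B : m' B = (t%:E * lebesgue_measure ((fun x : R => b + t * x)%R @^-1` B))%E by [].
rewrite -m'E; apply/esym; apply: lebesgue_measure_unique => // _ [[x y] _ <-].
rewrite m'E /=.
rewrite [X in (_ * lebesgue_measure X)%E](_ : _ = `](x - b) / t, (y - b) / t]%classic); last first.
  apply/seteqP; split => z /=; rewrite !in_itv/= ltr_pdivrMr// ler_pdivlMr//;
  by rewrite ltrBlDl lerBrDl mulrC.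
rewrite !lebesgue_measure_itv/= !lte_fin ltr_pM2r ?invr_gt0// ltrD2r.
case: ifPn => _; last by rewrite mule0.
by rewrite -!EFinD -EFinM; congr EFin; field; rewrite gt_eqF.
Qed.

Lemma ge0_integral_affine (R : realType) (b t : R) (t0 : 0 < t) (f : R -> \bar R) :
  measurable_fun setT f -> (forall x, 0 <= f x)%E ->
  (t%:E * \int[lebesgue_measure]_x f (b + t * x)%R)%E =
  (\int[lebesgue_measure]_x f x)%E.
Proof.
move=> mf f0.
have t1 : 0 <= t by exact: ltW.
have ma : measurable_fun setT ((fun x : measurableTypeR R => b + t * x) : _ -> measurableTypeR R).
  by apply: measurable_funD => //; apply: measurable_funM.
pose m0 : {measure set (measurableTypeR R) -> \bar R} :=
  measure_function_pushforward__canonical__measure_function_Measure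
    (@lebesgue_measure R) ma.
pose m' : {measure set (measurableTypeR R) -> \bar R} := mscale (NngNum t1) m0.
transitivity (\int[m']_x f x)%E; last first.
  by apply: eq_measure_integral => A mA _; exact: lebesgue_affine.
rewrite /m' ge0_integral_mscale//=; congr (_ * _)%E.
by rewrite ge0_integral_pushforward//.
Qed.

Section density.
Import HBNNSimple.

(** True for indicators by hypothesis, hence for simple functions by linearity and
    for nonnegative measurable functions by monotone convergence. *)
Lemma ge0_integral_density d (T : measurableType d) (R : realType)
   (mu nu : {measure set T -> \bar R}) (g : T -> R) (f : T -> \bar R) :
  measurable_fun setT g -> (forall x, 0 <= g x) ->
  (forall A, measurable A -> nu A = (\int[mu]_(x in A) (g x)%:E)%E) ->
  measurable_fun setT f -> (forall x, 0 <= f x)%E ->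
  (\int[nu]_x f x)%E = (\int[mu]_x (f x * (g x)%:E))%E.
Proof.
move=> mg g0 nuE mf f0.
pose f_ := nnsfun_approx measurableT mf.
have mEg : measurable_fun setT (EFin \o g) by exact/measurable_EFinP.
have mfg n : measurable_fun setT (fun x => (f_ n x)%:E * (g x)%:E)%E.
  by apply: emeasurable_funM => //; exact/measurable_EFinP.
transitivity (lim (\int[nu]_x (f_ n x)%:E @[n --> \oo])%E).
  rewrite -monotone_convergence//=.
  - apply: eq_integral => ? /[!inE] xD; apply/esym/cvg_lim => //=.
    exact: cvg_nnsfun_approx.
  - by move=> n; exact/measurable_EFinP/measurable_funTS.
  - by move=> n ? _; rewrite lee_fin.
  - by move=> ? _ ? ? mn; rewrite lee_fin; exact/lefP/nd_nnsfun_approx.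
rewrite [RHS](_ : _ = lim
    (\int[mu]_x ((f_ n x)%:E * (g x)%:E) @[n --> \oo])%E); last first.
  rewrite -monotone_convergence//=.
  - apply: eq_integral => x _; apply/esym/cvg_lim => //.
    by apply: cvgeZr => //; exact: cvg_nnsfun_approx.
  - by move=> n x _; rewrite mule_ge0 ?lee_fin.
  - move=> x _ m n mn; apply: lee_wpmul2r; rewrite ?lee_fin//.
    exact/lefP/nd_nnsfun_approx.
apply: congr_lim; apply/funext => n /=.
under [LHS]eq_integral do rewrite fimfunE -fsumEFin//.
rewrite [LHS]ge0_integral_fsum//; last 2 first.
  - by move=> r; exact/measurable_EFinP/measurableT_comp.
  - by move=> r x _; rewrite EFinM nnfun_muleindic_ge0.
under [RHS]eq_integral.
  move=> x xD; rewrite fimfunE -fsumEFin// ge0_mule_fsuml; last first.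
    by move=> r; rewrite EFinM nnfun_muleindic_ge0.
  over.
rewrite [RHS]ge0_integral_fsum//; last 2 first.
  - move=> r; apply: emeasurable_funM => //.
    by apply/measurable_EFinP; apply/measurableT_comp.
  - by move=> r x _; rewrite EFinM mule_ge0 ?nnfun_muleindic_ge0 ?lee_fin.
apply: eq_fsbigr => r _.
rewrite integralZl_indic_nnsfun//= integral_indic//= setIT nuE//.
have [r0|r0] := ltP r 0.
  rewrite preimage_nnfun0// integral_set0 mule0 integral0_eq// => x _.
  by rewrite indicE memNset ?mulr0 ?mul0e//.
rewrite -ge0_integralZl//; last 2 first.
  - exact: measurable_funTS.
  - by move=> x _; rewrite lee_fin.
rewrite [LHS]integral_mkcond/=; apply: eq_integral => x _.
by rewrite patchE indicE; case: ifPn => _; rewrite ?mulr1// mulr0 mul0e.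
Qed.

End density.

Local Notation N01 := (normal_prob 0 1).

Lemma normal_peakE (R : realType) (t : R) : 0 < t ->
  normal_peak t = t^-1 * normal_peak 1.
Proof.
move=> t0; rewrite /normal_peak -invfM; congr (_^-1).
by rewrite expr1n mul1r -mulrnAr sqrtrM ?sqr_ge0// sqrtr_sqr gtr0_norm.
Qed.

Lemma normal_pdf_rescale (R : realType) (m t x : R) : 0 < t ->
  t * normal_pdf m t (m + t * x) = normal_pdf 0 1 x.
Proof.
move=> t0; rewrite !normal_pdfE ?gt_eqF//= normal_peakE// !mulrA divff ?gt_eqF// mul1r.
rewrite /normal_fun; congr (_ * expR _).
rewrite expr1n subr0 [m + _ - m](_ : _ = t * x); last by ring.
rewrite exprMn -(mulr_natr 1) -(mulr_natr (t ^+ 2)).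
by field; rewrite (gt_eqF t0).
Qed.

(** Completing the square in x. *)
Lemma gauss_exponent_conv (R : realType) (s t v x z : R) :
  v = s ^+ 2 + t ^+ 2 -> v != 0 -> t != 0 ->
  - x ^+ 2 / (1 * 2) + - (z - s * x) ^+ 2 / (t ^+ 2 * 2) =
  - z ^+ 2 / (v * 2) + - (x - s * z / v) ^+ 2 / (t ^+ 2 / v * 2).
Proof.
move=> vE v0 t0.
have -> : - (x - s * z / v) ^+ 2 / (t ^+ 2 / v * 2) =
  - (v * x ^+ 2 - 2 * s * z * x + s ^+ 2 * z ^+ 2 / v) / (t ^+ 2 * 2).
  by field; rewrite ?t0 ?v0.
have -> : s ^+ 2 = v - t ^+ 2 by rewrite vE addrK.
have -> : (z - s * x) ^+ 2 = z ^+ 2 - 2 * s * z * x + (v - t ^+ 2) * x ^+ 2.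
  by rewrite vE; ring.
by field; rewrite t0 v0.
Qed.

(** For independent standard normal X and Z, the joint density of X and s X + t Z
    factors in two ways: law of X times law of s X + t Z given X, or law of s X + t Z
    times law of X given s X + t Z. *)
Lemma normal_pdf_conv (R : realType) (s t x z v : R) : 0 < t ->
  v = s ^+ 2 + t ^+ 2 ->
  normal_pdf 0 1 x * normal_pdf (s * x) t z =
  normal_pdf 0 (Num.sqrt v) z * normal_pdf (s * z / v) (t / Num.sqrt v) x.
Proof.
move=> t0 vE.
have v0 : 0 < v by rewrite vE ltr_wpDl ?sqr_ge0// exprn_gt0.
have sv0 : 0 < Num.sqrt v by rewrite sqrtr_gt0.
have tv0 : 0 < t / Num.sqrt v by rewrite divr_gt0.
rewrite !normal_pdfE ?gt_eqF//=.
rewrite (normal_peakE t0) (normal_peakE sv0) (normal_peakE tv0).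
rewrite mulrACA [RHS]mulrACA; congr (_ * _).
  rewrite invfM invrK; set c := normal_peak 1; set q := Num.sqrt v in sv0 *.
  rewrite [RHS](_ : _ = q^-1 * q * (c * (t^-1 * c))); last by ring.
  by rewrite mulVf ?mul1r// gt_eqF.
rewrite /normal_fun -!expRD; congr expR.
rewrite !subr0 expr1n (expr_div_n t) sqr_sqrtr ?ltW//.
rewrite -(mulr_natr 1) -(mulr_natr (t ^+ 2)) -(mulr_natr v) -(mulr_natr (_ / v)).
by apply: gauss_exponent_conv; rewrite // gt_eqF.
Qed.

Lemma normal_probE (R : realType) (m t : R) (A : set R) : 0 < t -> measurable A ->
  normal_prob m t A = N01 ((fun z : R => m + t * z)%R @^-1` A).
Proof.
move=> t0 mA; rewrite /normal_prob integral_mkcond [RHS]integral_mkcond.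
rewrite -(ge0_integral_affine m t0); last 2 first.
- apply/(measurable_restrictT _ mA)/measurable_EFinP/measurable_funTS.
  exact: measurable_normal_pdf.
- by move=> x; rewrite patchE; case: ifP => // _; rewrite lee_fin normal_pdf_ge0.
rewrite -ge0_integralZl//; first last.
- by rewrite lee_fin ltW.
- by move=> x _; rewrite patchE; case: ifP => // _; rewrite lee_fin normal_pdf_ge0.
- apply: measurableT_comp; last by apply: measurable_funD => //; apply: measurable_funM.
  apply/(measurable_restrictT _ mA)/measurable_EFinP/measurable_funTS.
  exact: measurable_normal_pdf.
apply: eq_integral => x _; rewrite !patchE.
rewrite [x \in _](_ : _ = (m + t * x \in A)); last by apply/idP/idP; rewrite !inE.
by case: ifP => _; rewrite ?mule0// -EFinM normal_pdf_rescale.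
Qed.

Lemma ge0_integral_N01 (R : realType) (f : R -> \bar R) :
  measurable_fun setT f -> (forall x, 0 <= f x)%E ->
  (\int[normal_prob 0 1]_x f x)%E =
  (\int[lebesgue_measure]_x (f x * (normal_pdf 0 1 x)%:E))%E.
Proof.
move=> mf f0.
apply: (ge0_integral_density (nu := normal_prob 0 1) (mu := @lebesgue_measure R)) => //.
- exact: measurable_normal_pdf.
- exact: normal_pdf_ge0.
Qed.

Lemma N01_opp (R : realType) (A : set R) : measurable A ->
  N01 ((fun z : R => - z) @^-1` A) = N01 A.
Proof.
move=> mA; rewrite /normal_prob integral_mkcond [RHS]integral_mkcond.
have mg : measurable_fun setT ((EFin \o normal_pdf 0 1) \_ A).
  apply/(measurable_restrictT _ mA)/measurable_EFinP/measurable_funTS.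
  exact: measurable_normal_pdf.
have g0 x : (0 <= ((EFin \o normal_pdf 0 1) \_ A) x)%E.
  by rewrite patchE; case: ifP => // _; rewrite lee_fin normal_pdf_ge0.
transitivity (\int[lebesgue_measure]_x ((EFin \o normal_pdf 0 1) \_ A) (- (x : R))%R)%E.
  apply: eq_integral => x _; rewrite !patchE.
  rewrite [x \in _](_ : _ = (- x \in A)); last by apply/idP/idP; rewrite !inE.
  case: ifP => // _ /=; rewrite !normal_pdfE ?oner_eq0//=.
  by rewrite /normal_fun !subr0 sqrrN.
have mN : measurable_fun setT (fun x : measurableTypeR R => - x : measurableTypeR R).
  exact: measurable_funN.
pose m0 : {measure set (measurableTypeR R) -> \bar R} :=
  measure_function_pushforward__canonical__measure_function_Measure
    (@lebesgue_measure R) mN.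
transitivity (\int[m0]_x ((EFin \o normal_pdf 0 1) \_ A) x)%E.
  by rewrite ge0_integral_pushforward.
by apply: eq_measure_integral => B mB _; exact: lebesgue_measureN.
Qed.

Lemma integral_normal_indic (R : realType) (m t : R) (A : set R) : measurable A ->
  normal_prob m t A =
  (\int[lebesgue_measure]_z (normal_pdf m t z * \1_A z)%:E)%E.
Proof.
move=> mA; rewrite /normal_prob integral_mkcond; apply: eq_integral => z _.
by rewrite patchE indicE; case: ifPn => _; rewrite ?mulr1 ?mulr0.
Qed.

(** After exchanging the integrals, [normal_pdf_conv] turns the inner one into
    a density at z times the integral of a conditional density, which is 1. *)
Lemma N01_conv_pos (R : realType) (s t : R) (A : set R) : 0 < t -> measurable A ->
  (\int[N01]_x N01 ((fun z : R => s * x + t * z)%R @^-1` A))%E =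
  N01 ((fun z : R => Num.sqrt (s ^+ 2 + t ^+ 2) * z)%R @^-1` A).
Proof.
move=> t0 mA; set v := s ^+ 2 + t ^+ 2.
have v0 : 0 < v by rewrite ltr_wpDl ?sqr_ge0// exprn_gt0.
have sv0 : 0 < Num.sqrt v by rewrite sqrtr_gt0.
have tv0 : 0 < t / Num.sqrt v by rewrite divr_gt0.
rewrite [X in _ = normal_prob _ _ X](_ : _ = (fun z : R => 0 + Num.sqrt v * z) @^-1` A); last first.
  by apply/seteqP; split => z /=; rewrite add0r.
rewrite -normal_probE// integral_normal_indic//.
under eq_integral do rewrite -normal_probE// integral_normal_indic//.
pose K (q : R * R) := (normal_pdf (s * q.1) t q.2 * \1_A q.2)%R.
have K0 q : 0 <= K q by rewrite mulr_ge0// normal_pdf_ge0.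
have mK : measurable_fun setT K.
  apply: measurable_funM.
    rewrite [X in measurable_fun _ X](_ : _ = fun q : R * R =>
        normal_pdf 0 t (q.2 - s * q.1)); last first.
      apply/funext => q; rewrite !normal_pdfE ?gt_eqF//= /normal_fun.
      by rewrite subr0.
    apply: measurableT_comp; first exact: measurable_normal_pdf.
    by apply: measurable_funB => //; exact: measurable_funM.
  by apply: measurableT_comp.
pose K1 (q : measurableTypeR R * measurableTypeR R) : \bar R :=
  (K q * normal_pdf 0 1 q.1)%:E.
have mK1 : measurable_fun setT K1.
  apply/measurable_EFinP; apply: measurable_funM => //.
  by apply: measurableT_comp => //; exact: measurable_normal_pdf.
have K10 q : (0 <= K1 q)%E.
  by rewrite lee_fin mulr_ge0// normal_pdf_ge0.
have mKE : measurable_fun setT (fun q : measurableTypeR R * measurableTypeR R => (K q)%:E).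
  exact/measurable_EFinP.
rewrite ge0_integral_N01; last 2 first.
- exact: (measurable_fun_fubini_tonelli_F (m2 := @lebesgue_measure R) _ mKE).
- by move=> x; apply: integral_ge0 => z _; rewrite lee_fin (K0 (x, z)).
transitivity (\int[lebesgue_measure]_x \int[lebesgue_measure]_z K1 (x, z))%E.
  apply: eq_integral => x _; rewrite -ge0_integralZr//; last 3 first.
  - apply/measurable_EFinP; apply: measurable_funM => //.
    exact: measurable_normal_pdf.
  - by move=> z _; rewrite lee_fin (K0 (x, z)).
  - by rewrite lee_fin normal_pdf_ge0.
rewrite (fubini_tonelli (m1 := @lebesgue_measure R) (m2 := @lebesgue_measure R) K1)//.
apply: eq_integral => z _.
rewrite -[RHS]mule1 -(integral_normal_pdf (s * z / v) (t / Num.sqrt v)).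
rewrite -ge0_integralZl//; last 3 first.
- by apply/measurable_EFinP; exact: measurable_normal_pdf.
- by move=> x _; rewrite lee_fin normal_pdf_ge0.
- by rewrite lee_fin mulr_ge0// normal_pdf_ge0.
apply: eq_integral => x _; rewrite /K1 /K/= -EFinM; congr EFin.
rewrite mulrC mulrA (normal_pdf_conv x z t0 (erefl v)).
by rewrite -/v -!mulrA; congr (_ * _); rewrite mulrC.
Qed.

(** The case t < 0 reduces to t > 0 by symmetry of Z; for t = 0 there is no
    density. *)
Lemma N01_conv (R : realType) (s t : R) (A : set R) : 0 <= s -> measurable A ->
  (\int[N01]_x N01 ((fun z : R => s * x + t * z)%R @^-1` A))%E =
  N01 ((fun z : R => Num.sqrt (s ^+ 2 + t ^+ 2) * z)%R @^-1` A).
Proof.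
move=> s0 mA; have [t0|t0|->] := ltgtP t 0; last 2 first.
- exact: N01_conv_pos.
- rewrite expr0n addr0 sqrtr_sqr ger0_norm//.
  have mB : measurable ((fun z : R => s * z) @^-1` A).
    rewrite -[X in measurable X]setTI.
    suff : measurable_fun setT (fun z : R => s * z) by exact.
    exact: measurable_funM.
  transitivity (\int[N01]_x (\1_((fun z : R => s * z)%R @^-1` A) x)%:E)%E.
    apply: eq_integral => x _; rewrite indicE.
    have [h|h] := pselect (A (s * x)).
      rewrite (_ : _ @^-1` A = setT) ?probability_setT ?mem_set//.
      by apply/seteqP; split => z //= _; rewrite mul0r addr0.
    rewrite (_ : _ @^-1` A = set0) ?measure0 ?memNset//.
    by apply/seteqP; split => z //=; rewrite mul0r addr0.
  by rewrite integral_indic// setIT.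
rewrite -[t]opprK sqrrN -N01_conv_pos ?oppr_gt0//.
apply: eq_integral => x _.
have mB : measurable ((fun z : R => s * x + (- t) * z) @^-1` A).
  rewrite -[X in measurable X]setTI.
  suff : measurable_fun setT (fun z : R => s * x + (- t) * z) by exact.
  by apply: measurable_funD => //; exact: measurable_funM.
rewrite -(N01_opp mB); congr (normal_prob _ _ _).
by apply/seteqP; split => z /=; rewrite !mulrN !mulNr !opprK.
Qed.

(** Representing every centred normal law, the Dirac mass included, as a scaled
    standard normal law removes the case distinction in the sequel. *)
Lemma normal_lawE (R : realType) (v : R) (A : set R) : 0 <= v -> measurable A ->
  normal_law 0 v A = N01 ((fun z : R => Num.sqrt v * z)%R @^-1` A).
Proof.
move=> v0 mA; rewrite /normal_law; case: eqVneq => [->|vn0].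
  rewrite sqrtr0 /dirac indicE.
  have [h|h] := pselect (A 0).
    rewrite (_ : _ @^-1` A = setT) ?probability_setT ?mem_set//.
    by apply/seteqP; split => z //= _; rewrite mul0r.
  rewrite (_ : _ @^-1` A = set0) ?measure0 ?memNset//.
  by apply/seteqP; split => z //=; rewrite mul0r.
have sv : 0 < Num.sqrt v by rewrite sqrtr_gt0 lt0r vn0.
rewrite normal_probE//; congr (normal_prob _ _ _).
by apply/seteqP; split => z /=; rewrite add0r.
Qed.

(** * Moments of the standard normal law *)

Definition gauss_bell (R : realType) (x : R) : R := expR (- x ^+ 2 / 2).

Lemma is_derive_gauss_bell (R : realType) (x : R) :
  is_derive x 1 (@gauss_bell R) (- x * gauss_bell x).
Proof.
have h1 : is_derive x 1 (fun x : R => - x ^+ 2 / 2) (- x).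
  by apply: is_derive_eq; rewrite /GRing.scale/=; field.
have := @is_derive1_comp R expR (fun x : R => - x ^+ 2 / 2) x _ _ (is_derive_expR _) h1.
by rewrite mulrC.
Qed.

Lemma continuous_gauss_bell (R : realType) : continuous (@gauss_bell R).
Proof.
move=> x; apply: differentiable_continuous; apply/derivable1_diffP.
by have [] := is_derive_gauss_bell x.
Qed.

Lemma is_derive_xgauss (R : realType) (c x : R) :
  is_derive x 1 (fun x : R => c * (x * gauss_bell x)) (c * ((1 - x ^+ 2) * gauss_bell x)).
Proof.
have h := is_derive_gauss_bell x.
by apply: is_derive_eq; rewrite /GRing.scale/=; ring.
Qed.

Lemma continuous_poly_gauss (R : realType) (a b : R) :
  continuous (fun x : R => (a + b * x ^+ 2) * gauss_bell x).
Proof.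
move=> x; apply: (@continuousM _ R^o (fun x => a + b * x ^+ 2) (@gauss_bell R)).
  apply: (@continuousD _ R^o R^o (cst a) (fun x => b * x ^+ 2)); first exact: cvg_cst.
  apply: (@continuousM _ R^o (cst b) (fun x => x ^+ 2)); first exact: cvg_cst.
  exact: exprn_continuous.
exact: continuous_gauss_bell.
Qed.

Lemma continuous_xgauss (R : realType) (c : R) :
  continuous (fun x : R => c * (x * gauss_bell x)).
Proof.
move=> x; apply: differentiable_continuous; apply/derivable1_diffP.
by have [] := is_derive_xgauss c x.
Qed.

Lemma cvg_xgauss (R : realType) : -1 * (x * gauss_bell x) @[x --> +oo] --> (0 : R).
Proof.
have h : (2 / x) @[x --> +oo] --> (0 : R).
  rewrite -[X in _ --> X](mulr0 2); apply: cvgM; first exact: cvg_cst.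
  apply/gtr0_cvgV0; last exact: cvg_id.
  by near=> x; near: x; exact: nbhs_pinfty_gt.
apply: (@squeeze_cvgr _ _ _ _ (fun x => - (2 / x)) (fun x => 2 / x)) => //; last first.
  by rewrite -oppr0; apply: cvgN.
near=> x.
have x0 : 0 < x by near: x; exact: nbhs_pinfty_gt.
have e0 := expR_gt0 (- x ^+ 2 / 2).
have key : x * gauss_bell x <= 2 / x.
  rewrite ler_pdivlMr// /gauss_bell mulNr expRN.
  have e1 := expR_ge1Dx (x ^+ 2 / 2).
  have e2 := expR_gt0 (x ^+ 2 / 2).
  by rewrite mulrAC -expr2 ler_pdivrMr//; lra.
have key0 : 0 <= x * gauss_bell x by rewrite mulr_ge0 ?ltW.
by apply/andP; split; lra.
Unshelve. all: by end_near. Qed.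

(** The function (1 - x^2) exp (- x^2 / 2) is the derivative of x exp (- x^2 / 2) and
    changes sign at 1. Integrating it on [0, 1] and its opposite on [1, +oo[ gives
    the same boundary value, so the two parts of the claim compensate. *)
Lemma gauss_second_moment_half (R : realType) :
  (\int[lebesgue_measure]_(x in `[0%R, +oo[) (x ^+ 2 * gauss_bell x)%:E =
   \int[lebesgue_measure]_(x in `[0%R, +oo[) (gauss_bell x : R)%:E)%E.
Proof.
have g0 x : 0 <= gauss_bell x :> R by exact: expR_ge0.
have mg : measurable_fun setT (@gauss_bell R).
  by apply: continuous_measurable_fun; exact: continuous_gauss_bell.
have mp a b : measurable_fun setT (fun x : R => (a + b * x ^+ 2) * gauss_bell x).
  by apply: continuous_measurable_fun; exact: continuous_poly_gauss.
have A01 : (\int[lebesgue_measure]_(x in `[0%R, 1%R]) ((1 + (-1) * x ^+ 2) * gauss_bell x : R)%:E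
    = (gauss_bell 1)%:E)%E.
  rewrite (@continuous_FTC2 R _ (fun x => 1 * (x * gauss_bell x)))//.
  - by rewrite !mul1r mul0r sube0.
  - exact/continuous_subspaceT/continuous_poly_gauss.
  - split.
    + by move=> x _; have [] := is_derive_xgauss 1 x.
    + exact/cvg_at_right_filter/(@continuous_xgauss R 1).
    + exact/cvg_at_left_filter/(@continuous_xgauss R 1).
  - move=> x _; rewrite derive1E (@derive_val _ _ _ _ _ _ _ (is_derive_xgauss 1 x)).
    by rewrite mul1r mulN1r.
have A1y : (\int[lebesgue_measure]_(x in `[1%R, +oo[) (((-1) + 1 * x ^+ 2) * gauss_bell x : R)%:E
    = (gauss_bell 1)%:E)%E.
  rewrite (@ge0_continuous_FTC2y R _ (fun x => -1 * (x * gauss_bell x)) 1 0)//.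
  - by rewrite mul1r mulN1r sub0e EFinN oppeK.
  - move=> x x1; apply: mulr_ge0 => //; rewrite mul1r addrC subr_ge0.
    by rewrite expr_ge1//; lra.
  - exact/continuous_subspaceT/continuous_poly_gauss.
  - exact: cvg_xgauss.
  - exact/cvg_at_right_filter/(@continuous_xgauss R (-1)).
  - move=> x _; rewrite derive1E (@derive_val _ _ _ _ _ _ _ (is_derive_xgauss (-1) x)).
    by ring.
have split01 (f : R -> R) : measurable_fun setT f -> (forall x, 0 <= f x) ->
    (\int[lebesgue_measure]_(x in `[0%R, +oo[) (f x)%:E =
     \int[lebesgue_measure]_(x in `[0%R, 1%R]) (f x)%:E +
     \int[lebesgue_measure]_(x in `[1%R, +oo[) (f x)%:E)%E.
  move=> mf f0.
  rewrite -[X in (_ + X)%E]integral_itv_obnd_cbnd; last first.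
    by apply/measurable_EFinP/measurable_funTS.
  rewrite -ge0_integral_setU//=.
  - by rewrite -itv_bndbnd_setU// bnd_simp.
  - by apply/measurable_EFinP/measurable_funTS.
  - by move=> x _; rewrite lee_fin.
  - apply/disj_setPS => y [/=]; rewrite 2!in_itv/= => /andP[_ yx].
    by rewrite andbT ltNge yx.
have m2 : measurable_fun setT (fun x : R => x ^+ 2 * gauss_bell x).
  by apply: measurable_funM => //; exact: measurable_funX.
rewrite !split01//; last by move=> x; rewrite mulr_ge0// sqr_ge0.
have E1 : (\int[lebesgue_measure]_(x in `[0%R, 1%R]) (gauss_bell x : R)%:E =
  (gauss_bell 1)%:E + \int[lebesgue_measure]_(x in `[0%R, 1%R]) (x ^+ 2 * gauss_bell x : R)%:E)%E.
  rewrite -A01 -ge0_integralD//.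
  - by apply: eq_integral => x _; rewrite -EFinD; congr EFin; ring.
  - move=> x; rewrite /= in_itv/= => /andP[x0 x1]; rewrite lee_fin mulr_ge0//.
    by rewrite mulN1r subr_ge0 expr_le1.
  - by apply/measurable_EFinP/measurable_funTS; exact: mp.
  - by move=> x _; rewrite lee_fin mulr_ge0// sqr_ge0.
  - by apply/measurable_EFinP/measurable_funTS.
have E2 : (\int[lebesgue_measure]_(x in `[1%R, +oo[) (x ^+ 2 * gauss_bell x : R)%:E =
  (gauss_bell 1)%:E + \int[lebesgue_measure]_(x in `[1%R, +oo[) (gauss_bell x : R)%:E)%E.
  rewrite -A1y -ge0_integralD//.
  - by apply: eq_integral => x _; rewrite -EFinD; congr EFin; ring.
  - move=> x; rewrite /= in_itv/= andbT => x1; rewrite lee_fin mulr_ge0//.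
    by rewrite mul1r addrC subr_ge0 expr_ge1//; lra.
  - by apply/measurable_EFinP/measurable_funTS; exact: mp.
  - by move=> x _; rewrite lee_fin.
  - by apply/measurable_EFinP/measurable_funTS.
by rewrite E1 E2 addeCA addeA.
Qed.

Lemma N01_second_moment (R : realType) :
  (\int[N01]_x (x ^+ 2 : R)%:E)%E = 1%E.
Proof.
have p0 := @normal_peak_ge0 R 1.
have pdfE (x : R) : normal_pdf 0 1 x = normal_peak 1 * gauss_bell x.
  by rewrite normal_pdfE ?oner_eq0//= /normal_fun subr0 expr1n.
have g0 x : 0 <= gauss_bell x :> R by exact: expR_ge0.
have mg : measurable_fun setT (@gauss_bell R).
  by apply: continuous_measurable_fun; exact: continuous_gauss_bell.
have m2 : measurable_fun setT (fun x : R => x ^+ 2 * gauss_bell x).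
  by apply: measurable_funM => //; exact: measurable_funX.
have gN (x : R) : gauss_bell (- x) = gauss_bell x by rewrite /gauss_bell sqrrN.
rewrite ge0_integral_N01//; last 2 first.
- by apply/measurable_EFinP; exact: measurable_funX.
- by move=> x; rewrite lee_fin sqr_ge0.
transitivity ((normal_peak 1)%:E * \int[@lebesgue_measure R]_x (x ^+ 2 * gauss_bell x)%:E)%E.
  rewrite -ge0_integralZl//; last 2 first.
  - exact/measurable_EFinP.
  - by move=> x _; rewrite lee_fin mulr_ge0 ?sqr_ge0.
  by apply: eq_integral => x _; rewrite -!EFinM pdfE mulrCA.
rewrite ge0_symfun_integralT; last 3 first.
- by move=> x; rewrite mulr_ge0 ?sqr_ge0.
- have := @continuous_poly_gauss R 0 1.
  by under eq_fun do rewrite add0r mul1r.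
- by move=> x /=; rewrite gN sqrrN.
rewrite -set_itvcy gauss_second_moment_half set_itvcy -ge0_symfun_integralT//; last 2 first.
- exact: continuous_gauss_bell.
- by move=> x /=; rewrite gN.
rewrite -ge0_integralZl//; last 2 first.
- exact/measurable_EFinP.
- by move=> x _; rewrite lee_fin.
rewrite -[RHS](integral_normal_pdf 0 1).
by apply: eq_integral => x _; rewrite -EFinM -pdfE.
Qed.

Lemma L1_N01_sqr (R : realType) : L1 (@normal_prob R 0 1) (fun x : R => x ^+ 2).
Proof.
apply/integrableP; split; first by apply/measurable_EFinP; exact: measurable_funX.
under eq_integral do rewrite /= ger0_norm ?sqr_ge0//.
by rewrite N01_second_moment ltry.
Qed.

Lemma Ex_N01_sqr (R : realType) : Ex (@normal_prob R 0 1) (fun x : R => x ^+ 2) = 1.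
Proof. by rewrite /Rintegral N01_second_moment. Qed.

Lemma L1_N01_id (R : realType) : L1 (@normal_prob R 0 1) (fun x : R => x).
Proof.
apply: (@L1_dom _ (measurableTypeR R) R (normal_prob 0 1) (fun x => x)
  (fun x : R => 1 + x ^+ 2)) => //.
  by apply: L1D; [exact: L1_cst|exact: L1_N01_sqr].
move=> x; have := sqr_ge0 (`|x| - 1); have := sqr_ge0 x.
by rewrite sqrrB real_normK ?num_real// expr1n mulr1; lra.
Qed.

Lemma Ex_N01_id (R : realType) : Ex (@normal_prob R 0 1) (fun x : R => x) = 0.
Proof.
have mN : @measurable_fun _ _ (measurableTypeR R) (measurableTypeR R) setT (fun x => - x).
  exact: measurable_funN.
pose N : {mfun measurableTypeR R >-> measurableTypeR R} :=
  @mfun_Sub _ _ (measurableTypeR R) (measurableTypeR R) _ (mem_set mN).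
have iN : L1 (@normal_prob R 0 1) ((fun x : R => x) \o N).
  have := L1Z (-1) (@L1_N01_id R); apply: eq_integrable => // x _ /=.
  by rewrite mulN1r.
have mid : measurable_fun setT (fun x : measurableTypeR R => x : R) by exact: measurable_id.
have := Ex_pushforward (P := normal_prob 0 1) (X := N) mid iN.
have -> : Ex (distribution (normal_prob 0 1) N) (fun x : measurableTypeR R => x : R) =
    Ex (@normal_prob R 0 1) (fun x : R => x).
  by congr fine; apply: eq_measure_integral => A mA _; exact: N01_opp.
rewrite [X in _ = X -> _](_ : _ = - Ex (@normal_prob R 0 1) (fun x : R => x)); first lra.
rewrite -mulN1r -RintegralZl//; last exact: L1_N01_id.
by apply: eq_Rintegral => x _; rewrite mulN1r.
Qed.

Definition centred_normal d (T : measurableType d) (R : realType) (P : probability T R)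
    (U : T -> R) (v : R) :=
  forall A : set R, measurable A ->
    P (U @^-1` A) = N01 ((fun z : R => Num.sqrt v * z)%R @^-1` A).

Lemma centred_normal_Ex d (T : measurableType d) (R : realType) (P : probability T R)
    (U : {RV P >-> R}) (v : R) (h : R -> R) :
  centred_normal P U v -> measurable_fun setT h ->
  L1 (@normal_prob R 0 1) (fun z : R => h (Num.sqrt v * z)) ->
  L1 P (fun w => h (U w)) /\
  Ex P (fun w => h (U w)) = Ex (@normal_prob R 0 1) (fun z : R => h (Num.sqrt v * z)).
Proof.
move=> nU mh ih.
have mN : measurable_fun setT ((fun x => Num.sqrt v * x) : measurableTypeR R -> R).
  exact: measurable_funM.
pose N : {mfun measurableTypeR R >-> R} := mfun_Sub (mem_set mN).
exact: (same_distribution_Ex (P2 := normal_prob 0 1) (X2 := N) nU mh ih).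
Qed.

(** * Gaussian vectors with a given covariance matrix *)

Definition qform (R : realType) k (S : 'I_k -> 'I_k -> R) (c : 'I_k -> R) : R :=
  \sum_s \sum_t c s * c t * S s t.

Definition psd (R : realType) k (S : 'I_k -> 'I_k -> R) : Prop :=
  (forall s t, S s t = S t s) /\ (forall c, 0 <= qform S c).

Lemma sum_delta (R : realType) k (i : 'I_k) (f : 'I_k -> R) :
  \sum_t (t == i)%:R * f t = f i.
Proof.
rewrite (bigD1 i)//= eqxx mul1r big1 ?addr0// => j /negbTE ->.
by rewrite mul0r.
Qed.

Lemma qform_delta (R : realType) k (S : 'I_k -> 'I_k -> R) (i : 'I_k) :
  qform S (fun t => (t == i)%:R) = S i i.
Proof.
rewrite /qform -(sum_delta i (fun s => S s i)); apply: eq_bigr => s _.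
rewrite -(sum_delta i (fun t => S s t)) mulr_sumr; apply: eq_bigr => t _.
by rewrite mulrA.
Qed.

Lemma qform_shift (R : realType) k (S : 'I_k -> 'I_k -> R) (c : 'I_k -> R) (l : R) i :
  (forall s t, S s t = S t s) ->
  qform S (fun t => c t + l * (t == i)%:R) =
  qform S c + 2 * l * (\sum_s c s * S s i) + l ^+ 2 * S i i.
Proof.
move=> symS; rewrite -(qform_delta S i) /qform.
have A1 : \sum_s \sum_t l * (c s * ((t == i)%:R * S s t)) = l * \sum_s c s * S s i.
  rewrite mulr_sumr; apply: eq_bigr => s _.
  by rewrite -!mulr_sumr sum_delta.
have A2 : \sum_s \sum_t l * (c t * ((s == i)%:R * S s t)) = l * \sum_s c s * S s i.
  rewrite exchange_big/= mulr_sumr; apply: eq_bigr => t _.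
  by rewrite -!mulr_sumr (sum_delta i (S^~ t)) symS.
have -> : 2 * l * (\sum_s c s * S s i) =
   \sum_s \sum_t (l * (c s * ((t == i)%:R * S s t)) + l * (c t * ((s == i)%:R * S s t))).
  under [RHS]eq_bigr do rewrite big_split/=.
  by rewrite big_split/= A1 A2; ring.
rewrite mulr_sumr -!big_split/=; apply: eq_bigr => s _.
rewrite mulr_sumr -!big_split/=; apply: eq_bigr => t _.
ring.
Qed.

Lemma qformB_sqr (R : realType) k (S : 'I_k -> 'I_k -> R) (a c : 'I_k -> R) :
  qform (fun s t => S s t - a s * a t) c = qform S c - (\sum_s c s * a s) ^+ 2.
Proof.
rewrite expr2 mulr_suml /qform -sumrB; apply: eq_bigr => s _.
rewrite mulr_sumr -sumrB; apply: eq_bigr => t _; ring.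
Qed.

(** Otherwise the form at e_s + l e_t would be linear in l with nonzero slope, and
    take negative values. *)
Lemma psd_diag0 (R : realType) k (S : 'I_k -> 'I_k -> R) :
  psd S -> (forall i, S i i = 0) -> forall s t, S s t = 0.
Proof.
move=> [symS posS] S0 s t.
have h l : 0 <= 2 * l * S s t.
  have := posS (fun j => (j == s)%:R + l * (j == t)%:R).
  by rewrite qform_shift// qform_delta !S0 mulr0 addr0 add0r (sum_delta s (S^~ t)).
by have := h 1; have := h (- 1); lra.
Qed.

(** A step of the Cholesky decomposition: a is the i-th column divided by the square
    root of its diagonal entry. The new form at c is the old form minimized over the
    line through c in the direction e_i, hence nonnegative. The number of nonzero
    diagonal entries decreases, which is the measure of the induction in
    [gaussian_family_exists]. *)
Lemma psd_schur (R : realType) k (S : 'I_k -> 'I_k -> R) (i : 'I_k) :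
  psd S -> S i i != 0 ->
  exists a : 'I_k -> R,
  [/\ psd (fun s t => S s t - a s * a t), S i i - a i * a i = 0 &
      forall j, S j j = 0 -> S j j - a j * a j = 0].
Proof.
move=> [symS posS] Sn0.
pose a s := S s i / Num.sqrt (S i i); pose S' s t := S s t - a s * a t.
exists a.
have S0 : 0 < S i i by rewrite lt0r Sn0 -qform_delta posS.
have sq0 : Num.sqrt (S i i) != 0 by rewrite sqrtr_eq0 -ltNge.
have aa s t : a s * a t = S s i * S t i / S i i.
  rewrite /a mulrACA -invfM -expr2 sqr_sqrtr// ltW//.
have S'pos c : 0 <= qform S' c.
  rewrite qformB_sqr; set L := \sum_s c s * S s i.
  have -> : \sum_s c s * a s = L / Num.sqrt (S i i).
    by rewrite mulr_suml; apply: eq_bigr => s _; rewrite /a mulrA.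
  have := posS (fun t => c t + (- L / S i i) * (t == i)%:R).
  rewrite qform_shift// -/L (expr_div_n L) (sqr_sqrtr (ltW S0)).
  by move/le_trans; apply; rewrite le_eqVlt; apply/orP; left; apply/eqP; field.
have pS' : psd S'.
  by split => // s t; rewrite /S' symS [a s * _]mulrC.
split => //.
  by rewrite aa mulfK// subrr.
move=> j Sj; apply/eqP; rewrite eq_le; apply/andP; split.
  by rewrite Sj sub0r oppr_le0 -expr2 sqr_ge0.
by rewrite -[_ - _]/(S' j j) -(qform_delta S' j).
Qed.

(** Centred joint normality with covariance matrix S, in terms of linear
    combinations: this form is stable under adding an independent normal variable. *)
Definition gaussian_family d (T : measurableType d) (R : realType) (P : probability T R)
    k (W : 'I_k -> {RV P >-> R}) (S : 'I_k -> 'I_k -> R) :=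
  forall c, centred_normal P (fun w => \sum_i c i * W i w) (qform S c).

Lemma gaussian_family0 (R : realType) k (S : 'I_k -> 'I_k -> R) :
  (forall s t, S s t = 0) ->
  exists (d : measure_display) (T : measurableType d) (P : probability T R)
     (W : 'I_k -> {RV P >-> R}), gaussian_family W S.
Proof.
move=> S0; exists _, (measurableTypeR R), (@normal_prob R 0 1).
have m0 : measurable_fun setT ((fun=> 0) : measurableTypeR R -> R) by exact: measurable_cst.
exists (fun=> mfun_Sub (mem_set m0)) => c A mA.
have -> : qform S c = 0.
  by rewrite /qform big1// => s _; rewrite big1// => t _; rewrite S0 mulr0.
congr (normal_prob _ _ _); apply/seteqP; split => z /=;
  by rewrite sqrtr0 mul0r big1// => i _; rewrite mulr0.
Qed.

(** If Z is standard normal and independent of W, then W + a Z has covariance matrix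
    S' + a a^T. The new variables live on the product with the standard normal law. *)
Lemma gaussian_family_add d (T : measurableType d) (R : realType) (P : probability T R)
    k (W : 'I_k -> {RV P >-> R}) (S S' : 'I_k -> 'I_k -> R) (a : 'I_k -> R) :
  gaussian_family W S' -> (forall c, 0 <= qform S' c) ->
  (forall s t, S' s t = S s t - a s * a t) ->
  exists (d : measure_display) (T : measurableType d) (P : probability T R)
     (W : 'I_k -> {RV P >-> R}), gaussian_family W S.
Proof.
move=> GW pS' S'E.
exists _, (T * measurableTypeR R)%type, (P \x @normal_prob R 0 1)%E.
have mW m : measurable_fun setT
    (fun q : T * measurableTypeR R => W m q.1 + a m * (q.2 : R)).
  apply: measurable_funD; first exact: measurableT_comp.
  by apply: measurable_funM.
exists (fun m => mfun_Sub (mem_set (mW m))) => c A mA.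
have mU : measurable_fun setT (fun w => \sum_i c i * W i w).
  by apply: measurable_sum => i; exact: measurable_funM.
pose U : {RV P >-> R} := mfun_Sub (mem_set mU).
set t := \sum_i c i * a i.
have vE : qform S c = qform S' c + t ^+ 2.
  rewrite (_ : qform S' c = qform (fun s t => S s t - a s * a t) c).
    by rewrite qformB_sqr subrK.
  by apply: eq_bigr => s _; apply: eq_bigr => u _; rewrite S'E.
have UE w (z : R) : \sum_i c i * (W i w + a i * z) = U w + t * z.
  rewrite /U/= /t mulr_suml -big_split/=.
  by apply: eq_bigr => i _; rewrite mulrDr mulrA.
transitivity (\int[P]_w N01 ((fun z : R => U w + t * z)%R @^-1` A))%E.
  apply: eq_integral => w _; congr (normal_prob _ _ _).
  by apply/seteqP; split => z; rewrite /xsection/= inE/= UE.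
have mAt : measurable
    ((fun q : measurableTypeR R * measurableTypeR R => (q.1 + t * q.2 : R)) @^-1` A).
  rewrite -[X in measurable X]setTI.
  suff : measurable_fun setT
      (fun q : measurableTypeR R * measurableTypeR R => (q.1 + t * q.2 : R)) by exact.
  by apply: measurable_funD => //; exact: measurable_funM.
have mg : measurable_fun setT (fun x : R => N01 ((fun z : R => x + t * z)%R @^-1` A)).
  have := measurable_fun_xsection (@normal_prob R 0 1) mAt.
  apply: eq_measurable_fun => x _ /=; congr (normal_prob _ _ _).
  by apply/seteqP; split => z; rewrite /xsection/= inE.
have := ge0_integral_distribution (P := P) U mg (fun=> measure_ge0 _ _).
rewrite /= => <-.
have mN : measurable_fun setT ((fun x => Num.sqrt (qform S' c) * x) : measurableTypeR R -> R).
  exact: measurable_funM.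
pose N : {mfun measurableTypeR R >-> R} := mfun_Sub (mem_set mN).
rewrite (eq_measure_integral (distribution (normal_prob 0 1) N)); last first.
  by move=> B mB _; exact: GW.
have := ge0_integral_distribution (P := normal_prob 0 1) N mg (fun=> measure_ge0 _ _).
rewrite /= => ->.
by rewrite N01_conv ?sqrtr_ge0// sqr_sqrtr// -vE.
Qed.

Lemma gaussian_family_exists (R : realType) k (S : 'I_k -> 'I_k -> R) :
  psd S ->
  exists (d : measure_display) (T : measurableType d) (P : probability T R)
     (W : 'I_k -> {RV P >-> R}), gaussian_family W S.
Proof.
have [n] := ubnP #|[pred i | S i i != 0]|.
elim: n S => // n IH S; rewrite ltnS => Sn pS.
have [i iS|S0] := pickP (fun i => S i i != 0); last first.
  apply: gaussian_family0; apply: psd_diag0 => // i.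
  by have := S0 i; move/negbFE/eqP.
have [a [pS' S'i S'0]] := psd_schur pS iS.
have [|d [T [P [W GW]]]] := IH _ _ pS'.
  apply: leq_trans Sn; apply: proper_card; apply/properP; split.
    apply/fintype.subsetP => j; rewrite !inE; apply: contraNN => /eqP/S'0 ->.
    by rewrite eqxx.
  by exists i; rewrite !inE// S'i eqxx.
exact: (gaussian_family_add GW (proj2 pS') (fun s t => erefl)).
Qed.

Lemma gaussian_family_Ex d (T : measurableType d) (R : realType) (P : probability T R)
    k (W : 'I_k -> {RV P >-> R}) (S : 'I_k -> 'I_k -> R) (c : 'I_k -> R) :
  psd S -> gaussian_family W S ->
  [/\ L1 P (fun w => \sum_i c i * W i w), Ex P (fun w => \sum_i c i * W i w) = 0,
      L1 P (fun w => (\sum_i c i * W i w) ^+ 2) &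
      Ex P (fun w => (\sum_i c i * W i w) ^+ 2) = qform S c].
Proof.
move=> [_ pS] GW.
have mU : measurable_fun setT (fun w => \sum_i c i * W i w).
  by apply: measurable_sum => i; exact: measurable_funM.
pose U : {RV P >-> R} := mfun_Sub (mem_set mU).
have nU : centred_normal P U (qform S c) by exact: GW.
have m2 : measurable_fun setT (fun x : R => x ^+ 2) by exact: measurable_funX.
have [i1 e1] := centred_normal_Ex nU (@measurable_id _ _ _) (L1Z _ (@L1_N01_id R)).
have i2' : L1 (@normal_prob R 0 1) (fun z : R => (Num.sqrt (qform S c) * z) ^+ 2).
  have := L1Z (qform S c) (@L1_N01_sqr R); apply: eq_integrable => // x _ /=.
  by rewrite exprMn sqr_sqrtr.
have [i2 e2] := centred_normal_Ex nU m2 i2'.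
split; [exact: i1| |exact: i2|].
  rewrite [LHS]e1 RintegralZl ?Ex_N01_id ?mulr0//; exact: L1_N01_id.
transitivity (qform S c * Ex (@normal_prob R 0 1) (fun x : R => x ^+ 2)).
  rewrite [LHS]e2 -RintegralZl//; last exact: L1_N01_sqr.
  by apply: eq_Rintegral => x _; rewrite exprMn sqr_sqrtr.
by rewrite Ex_N01_sqr mulr1.
Qed.

(** The covariances follow from the variances by polarization. *)
Lemma gaussian_family_cov d (T : measurableType d) (R : realType) (P : probability T R)
    k (W : 'I_k -> {RV P >-> R}) (S : 'I_k -> 'I_k -> R) :
  psd S -> gaussian_family W S ->
  [/\ jointly_normal W, forall m, ('E_P[W m] = 0)%E &
      forall s t, covariance P (W s) (W t) = (S s t)%:E].
Proof.
move=> pS GW.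
have WE m : (W m : T -> R) = (fun w => \sum_i (i == m)%:R * W i w).
  by apply/funext => w; rewrite (sum_delta m (fun i => W i w)).
have EW m : ('E_P[W m] = 0)%E.
  have [i1 e1 _ _] := gaussian_family_Ex (fun i => (i == m)%:R) pS GW.
  by rewrite unlock WE -EFin_Ex// e1.
split => //.
  move=> c; exists 0, (qform S c); split; first by case: pS.
  by move=> A mA; rewrite normal_lawE//; [exact: GW|case: pS].
move=> s t.
have sq m : L1 P (fun w => W m w ^+ 2) /\ Ex P (fun w => W m w ^+ 2) = S m m.
  have [_ _ i2 e2] := gaussian_family_Ex (fun i => (i == m)%:R) pS GW.
  rewrite qform_delta in e2.
  rewrite (_ : (fun w => W m w ^+ 2) = fun w => (\sum_i (i == m)%:R * W i w) ^+ 2)//.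
  by apply/funext => w; rewrite (sum_delta m (fun i => W i w)).
have sqD : L1 P (fun w => (W s w + W t w) ^+ 2) /\
    Ex P (fun w => (W s w + W t w) ^+ 2) = S s s + 2 * S s t + S t t.
  have [_ _ i2 e2] := gaussian_family_Ex (fun i => (i == s)%:R + 1 * (i == t)%:R) pS GW.
  rewrite qform_shift ?qform_delta in e2; last by case: pS.
  rewrite (sum_delta s (S^~ t)) in e2.
  rewrite (_ : (fun w => (W s w + W t w) ^+ 2) =
      fun w => (\sum_i ((i == s)%:R + 1 * (i == t)%:R) * W i w) ^+ 2).
    by split => //; rewrite e2; ring.
  apply/funext => w; congr (_ ^+ 2).
  under [RHS]eq_bigr do rewrite mul1r mulrDl.
  by rewrite big_split/= (sum_delta s (fun i => W i w)) (sum_delta t (fun i => W i w)).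
have [is1 es] := sq s; have [it1 et] := sq t; have [ist est] := sqD.
rewrite unlock !EW/=; rewrite unlock.
have iB := L1B (L1B ist is1) it1.
transitivity (Ex P (fun w => 2^-1 * ((W s w + W t w) ^+ 2 - W s w ^+ 2 - W t w ^+ 2)))%:E.
  rewrite EFin_Ex//; last exact: L1Z.
  apply: eq_integral => w _; congr EFin.
  rewrite -[LHS]/((W s w - 0) * (W t w - 0)).
  by field.
congr EFin; rewrite RintegralZl// RintegralB//; last exact: L1B.
by rewrite RintegralB// es et est; field.
Qed.

(** * Spline test functions *)

Definition ramp (R : realType) (x : R) : R := Num.max x 0.

(** A third difference annihilates polynomials of degree at most 2. *)
Definition third_diff (R : realType) (f : R -> R) (x : R) : R :=
  f x - 3 * f (x - 1) + 3 * f (x - 2) - f (x - 3).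

(** The distribution function of the sum of three independent uniform variables on
    [0, 1], written as a spline: it rises from 0 at 0 to 1 at 3 and has a Lipschitz
    second derivative. *)
Definition smooth_step (R : realType) (x : R) : R :=
  6^-1 * third_diff (fun u => ramp u ^+ 3) x.

Lemma rampP (R : realType) (x : R) : (x <= 0 /\ ramp x = 0) \/ (0 <= x /\ ramp x = x).
Proof.
rewrite /ramp; have [x0|x0] := leP x 0; [left|right]; split => //.
- by rewrite ltW.
Qed.

Lemma ramp_subgradient (R : realType) (x z y : R) :
  (y <= z)%R%:R * (x - z) <= ramp (x - y) - ramp (z - y).
Proof.
have [[h1 ->]|[h1 ->]] := rampP (x - y); have [[h2 ->]|[h2 ->]] := rampP (z - y);
  by case: (leP y z) => yz; rewrite ?mul1r ?mul0r; lra.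
Qed.

Lemma ramp_lip (R : realType) (u v : R) : `|ramp u - ramp v| <= `|u - v|.
Proof.
have [[h1 ->]|[h1 ->]] := rampP u; have [[h2 ->]|[h2 ->]] := rampP v => //.
- by rewrite subrr normr0.
- by rewrite sub0r normrN (ger0_norm h2) ler0_norm; lra.
- by rewrite subr0 (ger0_norm h1) ger0_norm; lra.
Qed.

Lemma ramp_ge0 (R : realType) (u : R) : 0 <= ramp u.
Proof. by have [[? ->]|[? ->]] := rampP u. Qed.

Lemma measurable_ramp (R : realType) : measurable_fun setT (@ramp R).
Proof. by apply: measurable_maxr. Qed.

(** The second derivative 6 x^+ of (x^+)^3 has Lipschitz constant 6. *)
Lemma ramp_taylor (R : realType) (x y : R) :
  `|ramp (x + y) ^+ 3 - ramp x ^+ 3 - 3 * ramp x ^+ 2 * y - 3 * ramp x * y ^+ 2|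
  <= `|y| ^+ 3.
Proof.
have [[x0 ->]|[x0 ->]] := rampP x; have [[xy0 ->]|[xy0 ->]] := rampP (x + y).
- rewrite !expr0n !mulr0 !mul0r !subr0 normr0; exact: exprn_ge0.
- rewrite !expr0n !mulr0 !mul0r !subr0 ger0_norm ?exprn_ge0//.
  by rewrite ger0_norm ?lerXn2r// ?nnegrE; lra.
- have y0 : y <= 0 by lra.
  rewrite (_ : _ - _ = y ^+ 3 - (x + y) ^+ 3); last by ring.
  have cN u : (- u) ^+ 3 = - (u ^+ 3) :> R by ring.
  have h1 : 0 <= (- (x + y)) ^+ 3 by rewrite exprn_ge0//; lra.
  have h2 : (- (x + y)) ^+ 3 <= (- y) ^+ 3 by rewrite lerXn2r ?nnegrE; lra.
  rewrite !cN in h1 h2; rewrite (ler0_norm y0) cN ler_norml.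
  by apply/andP; split; lra.
- rewrite (_ : _ - _ = y ^+ 3); last by ring.
  by rewrite normrX.
Qed.

Lemma smooth_step_le0 (R : realType) (x : R) : x <= 0 -> smooth_step x = 0.
Proof.
move=> x0; rewrite /smooth_step /third_diff.
have r u : u <= 0 -> @ramp R u = 0 by move=> u0; rewrite /ramp; case: ltP => //; lra.
by rewrite !r; [ring|lra..].
Qed.

Lemma smooth_step_ge3 (R : realType) (x : R) : 3 <= x -> smooth_step x = 1.
Proof.
move=> x0; rewrite /smooth_step /third_diff.
have r u : 0 <= u -> @ramp R u = u by move=> u0; rewrite /ramp; case: ltP => //; lra.
by rewrite !r; [field|lra..].
Qed.

(** For n = 1, 2 the third difference vanishes outside [0, 3], and on [0, 3] its four
    terms are at most 3^n, 3 * 3^n, 3 * 3^n and 3^n. *)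
Lemma third_diff_ramp_bound (R : realType) (n : nat) (M x : R) :
  (n = 1%N /\ M = 24) \/ (n = 2%N /\ M = 72) ->
  `|third_diff (fun u => ramp u ^+ n) x| <= M.
Proof.
move=> nM; rewrite /third_diff.
have [x0|x0] := leP x 0.
  have r u : u <= 0 -> @ramp R u = 0 by move=> u0; rewrite /ramp; case: ltP => //; lra.
  rewrite !r; [|lra..]; case: nM => -[-> ->]; rewrite expr0n/= !mulr0 !subr0 addr0 normr0; lra.
have [x3|x3] := leP 3 x.
  have r u : 0 <= u -> @ramp R u = u by move=> u0; rewrite /ramp; case: ltP => //; lra.
  rewrite !r; [|lra..]; case: nM => -[-> ->].
    by rewrite (_ : _ - _ = 0) ?normr0; [lra|ring].
  by rewrite (_ : _ - _ = 0) ?normr0; [lra|ring].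
have rb u : u <= 3 -> 0 <= @ramp R u <= 3.
  by move=> u3; case: (rampP u) => -[? ->]; apply/andP; split; lra.
have /andP[a0 a3] := rb x (ltW x3).
have /andP[b0 b3] : 0 <= @ramp R (x - 1) <= 3 by apply: rb; lra.
have /andP[c0 c3] : 0 <= @ramp R (x - 2) <= 3 by apply: rb; lra.
have /andP[d0 d3] : 0 <= @ramp R (x - 3) <= 3 by apply: rb; lra.
have h (u : R) : 0 <= u -> u <= 3 -> 0 <= u ^+ 2 /\ u ^+ 2 <= 9.
  by move=> u0 u3; rewrite sqr_ge0; split => //; nra.
have [a20 a29] := h _ a0 a3; have [b20 b29] := h _ b0 b3.
have [c20 c29] := h _ c0 c3; have [d20 d29] := h _ d0 d3.
by case: nM => -[-> ->]; rewrite ler_norml; apply/andP; split; rewrite ?expr1; lra.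
Qed.

Lemma smooth_step_itv (R : realType) (x : R) : 0 <= smooth_step x <= 1.
Proof.
have [x0|x0] := leP x 0; first by rewrite smooth_step_le0// lexx ler01.
have [x3|x3] := leP 3 x; first by rewrite smooth_step_ge3// lexx ler01.
have r u : u <= 0 -> @ramp R u = 0 by move=> u0; rewrite /ramp; case: ltP => //; lra.
have r' u : 0 <= u -> @ramp R u = u by move=> u0; rewrite /ramp; case: ltP => //; lra.
rewrite /smooth_step /third_diff (r (x - 3)); last lra.
rewrite (r' x); last lra.
have [x1|x1] := leP x 1.
  rewrite (r (x - 1)) ?(r (x - 2)); [|lra..].
  have h1 : 0 <= x ^+ 3 by exact/exprn_ge0/ltW.
  have h2 : x ^+ 3 <= 1 by apply: exprn_ile1 => //; exact: ltW.
  by rewrite expr0n/=; apply/andP; split; lra.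
have [x2|x2] := leP x 2.
  rewrite (r (x - 2)) ?(r' (x - 1)); [|lra..].
  have [t [t0 t1 ->]] : exists t, [/\ 0 <= t, t <= 1 & x = 1 + t].
    by exists (x - 1); split; lra.
  rewrite [1 + t - 1](_ : _ = t); last by ring.
  rewrite expr0n/=.
  have h2 : 0 <= t ^+ 2 <= 1 by apply/andP; split; [exact: sqr_ge0|exact: exprn_ile1].
  have h3 : 0 <= t ^+ 3 <= t ^+ 2.
    apply/andP; split; first exact: exprn_ge0.
    by rewrite exprS ler_piMl//; case/andP: h2.
  have h4 : 0 <= (1 - t) ^+ 2 * (1 + 2 * t) by rewrite mulr_ge0 ?sqr_ge0//; lra.
  rewrite (_ : _ ^+ 2 * _ = 1 - 3 * t ^+ 2 + 2 * t ^+ 3) in h4; last by ring.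
  rewrite (_ : (1 + t) ^+ 3 = 1 + 3 * t + 3 * t ^+ 2 + t ^+ 3); last by ring.
  by case/andP: h2 => ? ?; case/andP: h3 => ? ?; apply/andP; split; lra.
rewrite ?(r' (x - 2)) ?(r' (x - 1)); [|lra..].
have [t [t0 t1 ->]] : exists t, [/\ 0 <= t, t <= 1 & x = 3 - t].
  by exists (3 - x); split; lra.
rewrite expr0n/=.
have h3 : 0 <= t ^+ 3 <= 1 by apply/andP; split; [exact: exprn_ge0|exact: exprn_ile1].
rewrite (_ : 6^-1 * _ = 1 - 6^-1 * t ^+ 3); last by field.
by case/andP: h3 => ? ?; apply/andP; split; lra.
Qed.

Lemma measurable_third_diff_ramp (R : realType) n :
  measurable_fun setT (third_diff (fun u : R => ramp u ^+ n)).
Proof.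
have m u : measurable_fun setT (fun x : R => ramp (x - u) ^+ n).
  apply: measurable_funX; apply: measurableT_comp; first exact: measurable_ramp.
  by apply: measurable_funB.
rewrite /third_diff; apply: measurable_funB => //; apply: measurable_funD.
  apply: measurable_funB; last by apply: measurable_funM.
  by apply: measurable_funX; exact: measurable_ramp.
by apply: measurable_funM.
Qed.

(** Here h1 and h2 stand for h' and h''/2. The cubic bound makes the remainder
    negligible for small increments, the quadratic one keeps it integrable when only
    second moments are finite. *)
Definition taylor_test (R : realType) (h : R -> R) : Prop :=
  [/\ measurable_fun setT h, exists M, forall x, `|h x| <= M &
   exists h1 h2 C, 0 <= C /\ forall x y,
     `|h (x + y) - h x - h1 x * y - h2 x * y ^+ 2| <= C * Num.min (`|y| ^+ 3) (y ^+ 2)].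

(** For small increments this is the sum of four instances of [ramp_taylor]; for
    large ones each term of the expansion is bounded by a multiple of y^2. *)
Lemma smooth_step_taylor (R : realType) : taylor_test (@smooth_step R).
Proof.
split.
- by apply: measurable_funM => //; exact: measurable_third_diff_ramp.
- exists 1 => x; have /andP[h0 h1] := smooth_step_itv x.
  by rewrite ger0_norm.
pose H1 := fun x : R => 2^-1 * third_diff (fun u => ramp u ^+ 2) x.
pose H2 := fun x : R => 2^-1 * third_diff (fun u => ramp u ^+ 1) x.
exists H1, H2, 50; split; first lra.
move=> x y; rewrite minEle; case: ifPn => [yy|].
  have [a [a0 aE]] : exists a, 0 <= a /\ `|y| ^+ 3 = a.
    by exists (`|y| ^+ 3); split => //; exact: exprn_ge0.
  have := ramp_taylor x y; have := ramp_taylor (x - 1) y.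
  have := ramp_taylor (x - 2) y; have := ramp_taylor (x - 3) y.
  rewrite aE; rewrite /smooth_step /H1 /H2 /third_diff !expr1.
  rewrite -!(addrAC x y).
  set r0 := ramp (x + y); set r1 := ramp (x + y - 1); set r2 := ramp (x + y - 2).
  set r3 := ramp (x + y - 3).
  set s0 := ramp x; set s1 := ramp (x - 1); set s2 := ramp (x - 2); set s3 := ramp (x - 3).
  rewrite !ler_norml => /andP[? ?] /andP[? ?] /andP[? ?] /andP[? ?].
  by apply/andP; split; lra.
(* for 1 <= |y| the difference and the two Taylor terms are at most 1, 36 y^2
   and 12 y^2, which gives the constant 50 *)
move=> yy; have y1 : 1 <= `|y|.
  rewrite leNgt; apply: contraNN yy => y1.
  by rewrite -(real_normK (num_real y)) exprS ler_piMl ?sqr_ge0// ltW.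
have /andP[h0 h1] := smooth_step_itv x.
have /andP[k0 k1] := smooth_step_itv (x + y).
have B1 : `|H1 x * y| <= 36 * y ^+ 2.
  rewrite normrM -(real_normK (num_real y)) ler_pM//.
    have := @third_diff_ramp_bound R 2 72 x (or_intror (conj erefl erefl)).
    by rewrite /H1 normrM ger0_norm; lra.
  by rewrite expr2 ler_peMl.
have B2 : `|H2 x * y ^+ 2| <= 12 * y ^+ 2.
  rewrite normrM (ger0_norm (sqr_ge0 y)) ler_wpM2r ?sqr_ge0//.
  have := @third_diff_ramp_bound R 1 24 x (or_introl (conj erefl erefl)).
  by rewrite /H2 normrM ger0_norm; lra.
have B3 : 1 <= y ^+ 2 by rewrite -(real_normK (num_real y)) exprn_ege1.
move: B1 B2; rewrite !ler_norml => /andP[? ?] /andP[? ?].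
by apply/andP; split; lra.
Qed.

Lemma taylor_test_affine (R : realType) (h : R -> R) (a c : R) :
  taylor_test h -> taylor_test (fun x => h (c * x + a)).
Proof.
move=> [mh [M hM] [h1 [h2 [C [C0 hC]]]]]; split.
- by apply: measurableT_comp => //; apply: measurable_funD.
- by exists M.
exists (fun x => c * h1 (c * x + a)), (fun x => c ^+ 2 * h2 (c * x + a)).
exists (C * (`|c| ^+ 3 + c ^+ 2)); split.
  by apply: mulr_ge0 => //; apply: addr_ge0; [exact: exprn_ge0|exact: sqr_ge0].
move=> x y; have := hC (c * x + a) (c * y).
rewrite (_ : c * (x + y) + a = c * x + a + c * y); last by ring.
rewrite (_ : h1 (c * x + a) * (c * y) = c * h1 (c * x + a) * y); last by ring.
rewrite (_ : h2 (c * x + a) * (c * y) ^+ 2 = c ^+ 2 * h2 (c * x + a) * y ^+ 2); last by ring.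
move=> /le_trans; apply; rewrite -mulrA ler_wpM2l//.
have c3 : 0 <= `|c| ^+ 3 by exact: exprn_ge0.
have c2 : 0 <= c ^+ 2 by exact: sqr_ge0.
have y3 : 0 <= `|y| ^+ 3 by exact: exprn_ge0.
have y2 : 0 <= y ^+ 2 by exact: sqr_ge0.
rewrite normrM !exprMn.
have [yy|yy] := leP (`|y| ^+ 3) (y ^+ 2).
  by rewrite ge_min; apply/orP; left; rewrite ler_wpM2r// lerDl.
by rewrite ge_min; apply/orP; right; rewrite ler_wpM2r// lerDr.
Qed.

(** * Central limit theorem against smooth test functions *)

Lemma Ex_N01_conv (R : realType) (s t : R) (h : R -> R) (M : R) : 0 <= s ->
  measurable_fun setT h -> (forall x, `|h x| <= M) ->
  Ex (@normal_prob R 0 1) (fun x : R => Ex (@normal_prob R 0 1) (fun z : R => h (s * x + t * z))) =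
  Ex (@normal_prob R 0 1) (fun z : R => h (Num.sqrt (s ^+ 2 + t ^+ 2) * z)).
Proof.
move=> s0 mh hM.
have mW : measurable_fun setT
    (fun q : measurableTypeR R * measurableTypeR R => (s * q.1 + t * q.2 : R)).
  by apply: measurable_funD; exact: measurable_funM.
pose W : {mfun (measurableTypeR R * measurableTypeR R)%type >-> R} := mfun_Sub (mem_set mW).
have mN : measurable_fun setT ((fun x => Num.sqrt (s ^+ 2 + t ^+ 2) * x) : measurableTypeR R -> R).
  exact: measurable_funM.
pose N : {mfun measurableTypeR R >-> R} := mfun_Sub (mem_set mN).
have mhW : measurable_fun setT (h \o W) by exact: measurableT_comp.
have [e1 _ _ _] := Ex_fubini (normal_prob 0 1) (normal_prob 0 1) mhW (fun z => hM (W z)).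
rewrite -[LHS]e1.
rewrite -(Ex_pushforward (P := (normal_prob 0 1 \x normal_prob 0 1)%E) (X := W))//; last first.
  by apply: (@L1_bounded _ _ _ _ _ M) => // z; exact: hM.
have ihN : L1 (@normal_prob R 0 1) (h \o N).
  by apply: (@L1_bounded _ _ _ _ _ M) => [|z]; [exact: measurableT_comp|exact: hM].
rewrite -[RHS](Ex_pushforward (P := normal_prob 0 1) (X := N) mh ihN).
congr fine; apply: eq_measure_integral => A mA _.
rewrite -[RHS](N01_conv t s0 mA).
apply: eq_integral => x _; congr (normal_prob _ _ _).
by apply/seteqP; split => z; rewrite /xsection/= inE.
Qed.

(** The size of the Taylor remainder in [taylor_test]. *)
Definition min23 (R : realType) (u : R) : R := Num.min (`|u| ^+ 3) (u ^+ 2).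

Lemma min23_ge0 (R : realType) (u : R) : 0 <= min23 u.
Proof. by rewrite le_min sqr_ge0 exprn_ge0. Qed.

Lemma L1_min23 d (T : measurableType d) (R : realType) (P : probability T R)
    (U : T -> R) (c : R) :
  measurable_fun setT U -> L1 P (fun w => U w ^+ 2) -> L1 P (fun w => min23 (c * U w)).
Proof.
move=> mU iU.
apply: (@L1_dom _ _ _ _ _ (fun w => c ^+ 2 * U w ^+ 2)); last first.
- by move=> w; rewrite ger0_norm ?min23_ge0// /min23 ge_min exprMn lexx orbT.
- exact: L1Z.
have mcU : measurable_fun setT (fun w => c * U w) by exact: measurable_funM.
apply: measurable_minr; last exact: measurable_funX.
by apply: measurable_funX; exact: measurableT_comp.
Qed.

Lemma L1_of_sqr d (T : measurableType d) (R : realType) (P : probability T R)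
    (U : T -> R) : measurable_fun setT U -> L1 P (fun w => U w ^+ 2) -> L1 P U.
Proof.
move=> mU iU; apply: (@L1_dom _ _ _ _ _ (fun w => 1 + U w ^+ 2)) => //.
  by apply: L1D => //; exact: L1_cst.
move=> w; have := sqr_ge0 (`|U w| - 1); have := sqr_ge0 (U w).
by rewrite sqrrB real_normK ?num_real// expr1n mulr1; lra.
Qed.

(** The linear term has expectation 0, so up to the remainder the expectation depends
    on U only through its variance. *)
Lemma taylor_Ex d (T : measurableType d) (R : realType) (P : probability T R)
    (U : T -> R) (h h1 h2 : R -> R) (C M x c : R) :
  measurable_fun setT U -> L1 P (fun w => U w ^+ 2) -> Ex P U = 0 ->
  measurable_fun setT h -> (forall x, `|h x| <= M) ->
  (forall x y, `|h (x + y) - h x - h1 x * y - h2 x * y ^+ 2| <= C * min23 y) ->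
  `|Ex P (fun w => h (x + c * U w)) - (h x + h2 x * c ^+ 2 * Ex P (fun w => U w ^+ 2))|
  <= C * Ex P (fun w => min23 (c * U w)).
Proof.
move=> mU iU2 eU mh hM hC; have iU := L1_of_sqr mU iU2.
have mcU : measurable_fun setT (fun w => x + c * U w).
  by apply: measurable_funD => //; exact: measurable_funM.
have ih : L1 P (fun w => h (x + c * U w)).
  by apply: (@L1_bounded _ _ _ _ _ M) => //; exact: measurableT_comp.
have i1 : L1 P (fun w => h1 x * c * U w) by exact: L1Z.
have i2 : L1 P (fun w => h2 x * c ^+ 2 * U w ^+ 2) by exact: L1Z.
have E : Ex P (fun w => h x + h1 x * c * U w + h2 x * c ^+ 2 * U w ^+ 2) =
    h x + h2 x * c ^+ 2 * Ex P (fun w => U w ^+ 2).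
  rewrite RintegralD//; last by apply: L1D => //; exact: L1_cst.
  rewrite RintegralD//; last exact: L1_cst.
  by rewrite Ex_cst !RintegralZl// eU mulr0 addr0.
have i3 : L1 P (fun w => h x + h1 x * c * U w + h2 x * c ^+ 2 * U w ^+ 2).
  by apply: L1D => //; apply: L1D => //; exact: L1_cst.
rewrite -E -RintegralB// -RintegralZl//; last exact: L1_min23.
apply: Ex_le_norm; [exact: L1B|by apply: L1Z; exact: L1_min23|].
move=> w; apply: le_trans (hC x (c * U w)); rewrite le_eqVlt; apply/orP; left.
by apply/eqP; congr (`| _ |); ring.
Qed.

Lemma cvg_inv_sqrt (R : realType) : (Num.sqrt n%:R)^-1 @[n --> \oo] --> (0 : R).
Proof.
apply/gtr0_cvgV0.
  by near=> n; rewrite sqrtr_gt0 ltr0n; near: n; exact: nbhs_infty_gt.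
apply/cvgryPge => A; near=> n.
apply: (le_trans (ler_norm A)); rewrite -sqrtr_sqr ler_wsqrtr//.
by near: n; exact: nbhs_infty_ger.
Unshelve. all: by end_near. Qed.

Lemma cvg_Ex_dominated d (T : measurableType d) (R : realType) (P : probability T R)
    (g : nat -> T -> R) (G : T -> R) :
  (forall n, measurable_fun setT (g n)) -> L1 P G ->
  (forall n w, `|g n w| <= G w) -> (forall w, g n w @[n --> \oo] --> (0 : R)) ->
  Ex P (g n) @[n --> \oo] --> (0 : R).
Proof.
move=> mg iG gG g0; apply: fine_cvg; rewrite /=.
rewrite (_ : 0%:E = \int[P]_w (cst 0 w : R)%:E)%E; last by rewrite integral0.
apply: (@dominated_cvg _ _ _ P setT measurableT (fun n w => (g n w)%:E)
   (fun w => (cst 0 w)%:E) (EFin \o G)) => //.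
- by move=> n; exact/measurable_EFinP.
- by move=> w _; apply: cvg_EFin; [near=> n|exact: g0].
- by move=> n w _ /=; rewrite lee_fin.
Unshelve. all: by end_near. Qed.

(** This is Lindeberg's condition for identically distributed summands: n times the
    integrand is at most U^2 and at most |U|^3 / sqrt n, hence tends to 0 under the
    domination U^2. *)
Lemma cvg_min23 d (T : measurableType d) (R : realType) (P : probability T R)
    (U : T -> R) :
  measurable_fun setT U -> L1 P (fun w => U w ^+ 2) ->
  n%:R * Ex P (fun w => min23 ((Num.sqrt n%:R)^-1 * U w)) @[n --> \oo] --> (0 : R).
Proof.
move=> mU iU2.
pose g (n : nat) w := n%:R * min23 ((Num.sqrt n%:R)^-1 * U w).
have ig n : L1 P (g n) by apply: L1Z; exact: L1_min23.
have g0 n w : 0 <= g n w by rewrite mulr_ge0// min23_ge0.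
have g2 n w : g n w <= U w ^+ 2.
  rewrite /g; case: n => [|n]; first by rewrite mul0r sqr_ge0.
  have n0 : (0 : R) < n.+1%:R by rewrite ltr0n.
  rewrite -ler_pdivlMl// /min23 ge_min exprMn exprVn sqr_sqrtr ?(ltW n0)//.
  by rewrite lexx orbT.
have g3 n w : g n w <= `|U w| ^+ 3 * (Num.sqrt n%:R)^-1.
  rewrite /g; case: n => [|n]; first by rewrite mul0r sqrtr0 invr0 mulr0.
  have n0 : (0 : R) < n.+1%:R by rewrite ltr0n.
  have s0 : 0 < Num.sqrt (n.+1%:R : R) by rewrite sqrtr_gt0.
  rewrite -ler_pdivlMl// /min23 ge_min; apply/orP; left.
  rewrite normrM exprMn ger0_norm ?invr_ge0 ?(ltW s0)//.
  have := sqr_sqrtr (ltW n0); move: s0; move: (Num.sqrt _) => s s0 <-.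
  rewrite le_eqVlt; apply/orP; left; apply/eqP.
  by field; rewrite gt_eqF.
under eq_fun do rewrite -RintegralZl ?L1_min23//.
apply: (cvg_Ex_dominated (G := fun w => U w ^+ 2)) => //.
- by move=> n; exact: L1_measurable (ig n).
- by move=> n w; rewrite ger0_norm; [exact: g2|exact: g0].
move=> w; apply: (@squeeze_cvgr _ _ _ _ (fun=> 0) (fun n => `|U w| ^+ 3 * (Num.sqrt n%:R)^-1)).
- by near=> n; apply/andP; split; [exact: g0|exact: g3].
- exact: cvg_cst.
- rewrite -[X in _ --> X](mulr0 (`|U w| ^+ 3)); apply: cvgM; first exact: cvg_cst.
  exact: cvg_inv_sqrt.
Unshelve. all: by end_near. Qed.

(** The summands are replaced one at a time by independent copies of s Z, with Z
    standard normal, each at a cost of at most dl; the copies add up by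
    [Ex_N01_conv]. The shift x is arbitrary because a replaced summand becomes part
    of it in the induction. *)
Lemma lindeberg_step d dY (T : measurableType d) (TY : measurableType dY) (R : realType)
    (P : probability T R) (PY : probability TY R)
    (X : nat -> {RV P >-> R}) (Y : {RV PY >-> R}) (phi h : R -> R)
    (c s M dl : R) (j : nat) (x : R) :
  (forall i r, cdf (X i) r = cdf Y r) -> mutually_independent X ->
  measurable_fun setT phi -> measurable_fun setT h -> (forall x, `|h x| <= M) ->
  (forall x, `|Ex PY (fun w => h (x + c * phi (Y w))) -
      Ex (@normal_prob R 0 1) (fun z : R => h (x + s * z))| <= dl) ->
  `|Ex P (fun w => h (x + c * psum X phi j w)) -
    Ex (@normal_prob R 0 1) (fun z : R => h (x + Num.sqrt (j%:R * s ^+ 2) * z))| <= j%:R * dl.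
Proof.
move=> XY indX mphi mh hM step; elim: j x => [|j IH] x.
  rewrite mul0r mul0r sqrtr0.
  rewrite (_ : Ex P _ = h x); last first.
    rewrite -[RHS](Ex_cst P); apply: eq_Rintegral => w _.
    by rewrite /psum big_ord0 mulr0 addr0.
  rewrite (_ : Ex (normal_prob 0 1) _ = h x) ?subrr ?normr0//.
  rewrite -[RHS](Ex_cst (normal_prob 0 1)); apply: eq_Rintegral => w _.
  by rewrite mul0r addr0.
have mhx (u : R) : measurable_fun setT (fun v => h (u + v)).
  by apply: measurableT_comp => //; exact: measurable_funD.
pose S w := psum X phi j w.
have mS : measurable_fun setT S by exact: (measurable_psum X j mphi).
pose V (u : R) := Ex (@normal_prob R 0 1) (fun z : R => h (u + s * z)).
pose U (u : R) := Ex PY (fun w => h (u + c * phi (Y w))).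
have E1 : Ex P (fun w => h (x + c * psum X phi j.+1 w)) = Ex P (fun w => U (x + c * S w)).
  have /= -> := @Ex_psumS _ _ _ P X phi (fun v => h (x + v)) j M c
    indX mphi (mhx x) (fun u => hM _).
  apply: eq_Rintegral => w _; rewrite /U.
  have mg : measurable_fun setT (fun u => h (x + c * S w + c * phi u)).
    apply: measurableT_comp => //; apply: measurable_funD => //.
    exact: measurable_funM.
  have [|_ <-] := same_cdf_Ex (XY j) mg.
    apply: (@L1_bounded _ _ _ _ _ M) => [|u]; last exact: hM.
    exact: (measurableT_comp mg).
  by apply: eq_Rintegral => w' _; rewrite addrA.
have mK1 : measurable_fun setT (fun q : T * TY => h (x + c * S q.1 + c * phi (Y q.2))).
  apply: measurableT_comp => //; apply: measurable_funD.
    apply: measurable_funD => //; apply: measurable_funM => //.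
    exact: measurableT_comp.
  apply: measurable_funM => //; apply: measurableT_comp => //.
  exact: measurableT_comp.
have [_ _ mU _] := Ex_fubini P PY mK1 (fun=> hM _).
have mK2 : measurable_fun setT (fun q : T * measurableTypeR R => h (x + c * S q.1 + s * q.2)).
  apply: measurableT_comp => //; apply: measurable_funD.
    apply: measurable_funD => //; apply: measurable_funM => //.
    exact: measurableT_comp.
  exact: measurable_funM.
have [e1 e2 mV mV'] := Ex_fubini P (@normal_prob R 0 1) mK2 (fun=> hM _).
have bU u : `|U u| <= M.
  apply: Ex_bounded => // ; apply: measurableT_comp => //.
  apply: measurable_funD => //; apply: measurable_funM => //.
  exact: measurableT_comp.
have bV u : `|V u| <= M.
  apply: Ex_bounded => // ; apply: measurableT_comp => //.
  by apply: measurable_funD => //; exact: measurable_funM.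
have iU : L1 P (fun w => U (x + c * S w)) by apply: (@L1_bounded _ _ _ _ _ M).
have iV : L1 P (fun w => V (x + c * S w)) by apply: (@L1_bounded _ _ _ _ _ M).
(* replace the last summand, then the first j by induction with shift x + s y *)
have D1 : `|Ex P (fun w => U (x + c * S w)) - Ex P (fun w => V (x + c * S w))| <= dl.
  rewrite -RintegralB// -[leRHS](Ex_cst P); apply: Ex_le_norm => //.
  - exact: L1B.
  - exact: L1_cst.
  - by move=> w; exact: step.
pose Z (y : R) := Ex P (fun w => h (x + c * S w + s * y)).
have E2 : Ex P (fun w => V (x + c * S w)) = Ex (@normal_prob R 0 1) Z by rewrite -[LHS]e1 e2.
pose G (y : R) := Ex (@normal_prob R 0 1)
  (fun z : R => h (x + (s * y + Num.sqrt (j%:R * s ^+ 2) * z))).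
have E3 : Ex (@normal_prob R 0 1) G =
    Ex (@normal_prob R 0 1) (fun z : R => h (x + Num.sqrt (j.+1%:R * s ^+ 2) * z)).
  have s0 : 0 <= Num.sqrt (j%:R * s ^+ 2) by exact: sqrtr_ge0.
  have mq : measurable_fun setT (fun q : measurableTypeR R * measurableTypeR R =>
      h (x + (Num.sqrt (j%:R * s ^+ 2) * q.1 + s * q.2))).
    apply: measurableT_comp => //; apply: measurable_funD => //.
    by apply: measurable_funD; exact: measurable_funM.
  have [e3 e4 _ _] := Ex_fubini (@normal_prob R 0 1) (@normal_prob R 0 1) mq (fun=> hM _).
  have := Ex_N01_conv s s0 (mhx x) (fun=> hM _).
  rewrite (_ : Num.sqrt _ ^+ 2 + s ^+ 2 = j.+1%:R * s ^+ 2); last first.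
    have j0 : 0 <= j%:R * s ^+ 2 by apply: mulr_ge0 => //; exact: sqr_ge0.
    by rewrite (sqr_sqrtr j0) -[in RHS]natr1 mulrDl mul1r.
  move=> <-; rewrite -[RHS]e3 e4; apply: eq_Rintegral => y _; rewrite /G.
  by apply: eq_Rintegral => z _; rewrite addrC [s * y + _]addrC addrC.
have mG : measurable_fun setT G.
  have mq : measurable_fun setT (fun q : measurableTypeR R * measurableTypeR R =>
      h (x + (s * q.1 + Num.sqrt (j%:R * s ^+ 2) * q.2))).
    apply: measurableT_comp => //; apply: measurable_funD => //.
    by apply: measurable_funD; exact: measurable_funM.
  by have [] := Ex_fubini (@normal_prob R 0 1) (@normal_prob R 0 1) mq (fun=> hM _).
have bG y : `|G y| <= M.
  apply: Ex_bounded => // ; apply: measurableT_comp => //.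
  by apply: measurable_funD => //; apply: measurable_funD.
have bZ y : `|Z y| <= M.
  apply: Ex_bounded => //; apply: measurableT_comp => //.
  apply: measurable_funD => //; apply: measurable_funD => //.
  by apply: measurable_funM.
have iG : L1 (@normal_prob R 0 1) G by exact: (@L1_bounded _ _ _ _ _ M).
have iZ : L1 (@normal_prob R 0 1) Z by exact: (@L1_bounded _ _ _ _ _ M).
have D2 : `|Ex (@normal_prob R 0 1) Z - Ex (@normal_prob R 0 1) G| <= j%:R * dl.
  rewrite -RintegralB// -[leRHS](Ex_cst (@normal_prob R 0 1)); apply: Ex_le_norm => //.
  - exact: L1B.
  - exact: L1_cst.
  move=> y; have := IH (x + s * y); rewrite /Z /G.
  rewrite (_ : Ex P (fun w => h (x + s * y + c * psum X phi j w)) =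
    Ex P (fun w => h (x + c * S w + s * y))); last first.
    by apply: eq_Rintegral => w _; rewrite addrAC.
  by under [X in _ -> `|_ - X| <= _]eq_Rintegral do rewrite addrA.
rewrite E1 -E3 -natr1 mulrDl mul1r [leRHS]addrC.
apply: le_trans (lerD D1 D2); rewrite E2.
by apply: le_trans (ler_normD _ _); rewrite addrA subrK.
Qed.

(** The summands phi (X i) / sqrt n and their normal replacements agree in the first
    two moments, so a replacement costs at most C times the sum of their expected
    Taylor remainders ([taylor_Ex]); n such costs still tend to 0 by [cvg_min23]. *)
Lemma clt_taylor d dY (T : measurableType d) (TY : measurableType dY) (R : realType)
    (P : probability T R) (PY : probability TY R)
    (X : nat -> {RV P >-> R}) (Y : {RV PY >-> R}) (phi h : R -> R) :
  (forall i r, cdf (X i) r = cdf Y r) -> mutually_independent X ->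
  measurable_fun setT phi -> L1 PY (fun w => phi (Y w) ^+ 2) ->
  Ex PY (fun w => phi (Y w)) = 0 -> taylor_test h ->
  Ex P (fun w => h ((Num.sqrt n%:R)^-1 * psum X phi n w)) @[n --> \oo] -->
  Ex (@normal_prob R 0 1)
    (fun z : R => h (Num.sqrt (Ex PY (fun w => phi (Y w) ^+ 2)) * z)).
Proof.
move=> XY indX mphi iphi2 phi0 [mh [M hM] [h1 [h2 [C [C0 hC]]]]].
set v := Ex PY _.
have v0 : 0 <= v by apply: Rintegral_ge0 => w _; exact: sqr_ge0.
have mU : measurable_fun setT (fun w => phi (Y w)) by exact: measurableT_comp.
pose N (z : R) := Num.sqrt v * z.
have mN : measurable_fun setT (N : measurableTypeR R -> R) by exact: measurable_funM.
have iN : L1 (@normal_prob R 0 1) (fun z : R => N z ^+ 2).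
  have := L1Z v (@L1_N01_sqr R); apply: eq_integrable => // x _ /=.
  by rewrite /N exprMn sqr_sqrtr.
have EN : Ex (@normal_prob R 0 1) N = 0.
  by rewrite RintegralZl ?Ex_N01_id ?mulr0//; exact: L1_N01_id.
have EN2 : Ex (@normal_prob R 0 1) (fun z : R => N z ^+ 2) = v.
  transitivity (v * Ex (@normal_prob R 0 1) (fun x : R => x ^+ 2)).
    rewrite -RintegralZl//; last exact: L1_N01_sqr.
    by apply: eq_Rintegral => x _; rewrite /N exprMn sqr_sqrtr.
  by rewrite Ex_N01_sqr mulr1.
pose a n := n%:R * Ex PY (fun w => min23 ((Num.sqrt n%:R)^-1 * phi (Y w))).
pose b n := n%:R * Ex (@normal_prob R 0 1) (fun z : R => min23 ((Num.sqrt n%:R)^-1 * N z)).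
have ca : a n @[n --> \oo] --> (0 : R) by exact: cvg_min23.
have cb : b n @[n --> \oo] --> (0 : R) by exact: cvg_min23.
have cab : C * (a n + b n) @[n --> \oo] --> (0 : R).
  rewrite -[X in _ --> X](mulr0 C); apply: cvgM; first exact: cvg_cst.
  by rewrite -[X in _ --> X](addr0 0); apply: cvgD.
apply/cvgrPdist_le => e e0.
have /cvgrPdist_le /(_ e e0) cabe := cab.
near=> n.
have n0 : (0 < n)%N by near: n; exact: nbhs_infty_gt.
have nR : (0 : R) < n%:R by rewrite ltr0n.
have sn : 0 < Num.sqrt (n%:R : R) by rewrite sqrtr_gt0.
have : `|0 - C * (a n + b n)| <= e by near: n.
rewrite sub0r normrN; apply: le_trans.
apply: le_trans (ler_norm _).
set c := (Num.sqrt n%:R)^-1.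
have cv : Num.sqrt (n%:R * (c * Num.sqrt v) ^+ 2) = Num.sqrt v.
  rewrite exprMn /c exprVn !sqr_sqrtr ?(ltW nR)//.
  by rewrite mulrA divff ?mul1r// gt_eqF.
have step x : `|Ex PY (fun w => h (x + c * phi (Y w))) -
    Ex (@normal_prob R 0 1) (fun z : R => h (x + c * Num.sqrt v * z))| <=
  C * (Ex PY (fun w => min23 (c * phi (Y w))) +
    Ex (@normal_prob R 0 1) (fun z : R => min23 (c * N z))).
  have t1 := taylor_Ex x c mU iphi2 phi0 mh hM hC.
  have t2 := taylor_Ex x c mN iN EN mh hM hC.
  rewrite EN2 in t2; rewrite -/v in t1; rewrite mulrDr.
  under [X in `|_ - X|]eq_Rintegral do rewrite -mulrA.
  by move: t1 t2; rewrite !ler_norml => /andP[? ?] /andP[? ?]; apply/andP; split; lra.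
have := lindeberg_step n 0 XY indX mphi mh hM step.
rewrite cv distrC.
rewrite (_ : C * (a n + b n) =
    n%:R * (C * (Ex PY (fun w => min23 (c * phi (Y w))) +
      Ex (@normal_prob R 0 1) (fun z : R => min23 (c * N z))))); last first.
  by rewrite /a /b; ring.
under [X in `|X - _| <= _ -> _]eq_Rintegral do rewrite add0r.
by under [X in `|_ - X| <= _ -> _]eq_Rintegral do rewrite add0r.
Unshelve. all: by end_near. Qed.

(** * Convergence in distribution from spline steps *)

(** The approximation g is constant beyond b so that it can be continued to the
    right. Q is the property of g to be propagated, in the application convergence
    of expectations. *)
Definition staircase_upto (R : realType) (f : R -> R) (M eps : R)
    (Q : (R -> R) -> Prop) (a b : R) := exists g : R -> R,
  [/\ Q g, forall x, b <= x -> g x = f b, forall x, `|g x| <= M &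
      forall x, a <= x <= b -> `|f x - g x| <= eps].

Lemma convex_norm_le (R : realType) (t u v M : R) :
  0 <= t <= 1 -> `|u| <= M -> `|v| <= M -> `|u + (v - u) * t| <= M.
Proof.
move=> /andP[t0 t1]; rewrite !ler_norml => /andP[? ?] /andP[? ?].
by apply/andP; split; nra.
Qed.

(** Adds one step of height f b' - f b that rises within [b, b']: there g runs between
    f b and f b', both within eps of the values of f. *)
Lemma staircase_extend (R : realType) (f : R -> R) (M eps : R)
    (Q : (R -> R) -> Prop) (a b b' : R) :
  (forall g be c d, 0 < c -> Q g -> Q (fun x => g x + be * smooth_step (c * x + d))) ->
  (forall x, `|f x| <= M) -> b < b' ->
  (forall x, b <= x <= b' -> `|f x - f b| <= eps /\ `|f x - f b'| <= eps) ->
  staircase_upto f M eps Q a b -> staircase_upto f M eps Q a b'.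
Proof.
move=> Qadd fM bb' fe [g [Qg gb gM ge]].
(* [smooth_step] rises over an interval of length 3 *)
pose c := 3 / (b' - b).
have c0 : 0 < c by rewrite divr_gt0// subr_gt0.
have cE x : c * x + - c * b = 3 * ((x - b) / (b' - b)).
  by rewrite /c; field; rewrite subr_eq0 gt_eqF.
have Hl x : x <= b -> smooth_step (c * x + - c * b) = 0.
  move=> xb; apply: smooth_step_le0; rewrite cE pmulr_rle0// pmulr_lle0 ?invr_gt0 ?subr_gt0//.
  by rewrite subr_le0.
have Hr x : b' <= x -> smooth_step (c * x + - c * b) = 1.
  move=> xb; apply: smooth_step_ge3; rewrite cE ler_peMr// ler_pdivlMr ?subr_gt0//.
  by rewrite mul1r lerD2r.
exists (fun x => g x + (f b' - f b) * smooth_step (c * x + - c * b)); split.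
- exact: Qadd.
- by move=> x bx; rewrite Hr// gb ?mulr1 ?(addrC (f b)) ?subrK// (le_trans (ltW bb')).
- move=> x; have [xb|xb] := leP x b; first by rewrite Hl// mulr0 addr0.
  rewrite (gb _ (ltW xb)); apply: convex_norm_le => //; exact: smooth_step_itv.
- move=> x /andP[ax xb']; have [xb|xb] := leP x b.
    by rewrite Hl// mulr0 addr0 ge// ax.
  rewrite (gb _ (ltW xb)).
  have [|e1 e2] := fe x; first by rewrite (ltW xb).
  rewrite (_ : _ - _ = (f x - f b) + ((f x - f b') - (f x - f b)) *
    smooth_step (c * x + - c * b)); last by ring.
  by apply: convex_norm_le => //; exact: smooth_step_itv.
Qed.

(** The supremum of the points b in [a, L] that can be reached is passed by one more
    step, by continuity of f there; so L itself is passed. *)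
Lemma staircase_exists (R : realType) (f : R -> R) (M eps a L : R)
    (Q : (R -> R) -> Prop) :
  (forall b, Q (fun=> b)) ->
  (forall g be c d, 0 < c -> Q g -> Q (fun x => g x + be * smooth_step (c * x + d))) ->
  continuous f -> (forall x, `|f x| <= M) -> 0 < eps -> a <= L ->
  exists2 b, L <= b & staircase_upto f M eps Q a b.
Proof.
move=> Qcst Qadd cf fM eps0 aL.
pose S := [set b | a <= b <= L /\ staircase_upto f M eps Q a b].
have Sa : S a.
  split; first by rewrite lexx.
  exists (fun=> f a); split => // x /andP[x1 x2].
  by rewrite (@le_anti _ _ x a) ?x1 ?x2// subrr normr0 ltW.
have hS : has_sup S by split; [exists a|exists L => b [/andP[]]].
have e2 : 0 < eps / 2 by rewrite divr_gt0.
have /cvgrPdist_lt/(_ _ e2) := cf (sup S).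
move=> /nbhs_ballP[eta /= eta0 feta].
have fs x : `|x - sup S| < eta -> `|f (sup S) - f x| < eps / 2.
  by move=> xs; apply: feta; rewrite /ball/= distrC.
have [b Sb bs] := sup_adherent eta0 hS.
have bS : b <= sup S by apply: ub_le_sup => //; case: hS.
pose b' := sup S + eta / 2.
have eta2 : 0 < eta / 2 by rewrite divr_gt0.
have sb' : sup S < b' by rewrite ltrDl.
(* a reachable point b close to the supremum is extended beyond it *)
have Rb' : staircase_upto f M eps Q a b'.
  apply: (@staircase_extend _ _ _ _ _ _ b) => //.
  - exact: le_lt_trans sb'.
  - have fb : `|f (sup S) - f b| < eps / 2.
      by apply: fs; rewrite ltr_norml; apply/andP; split; lra.
    have fb' : `|f (sup S) - f b'| < eps / 2.
      by apply: fs; rewrite /b' ltr_norml; apply/andP; split; lra.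
    move=> x /andP[x1 x2]; have fx : `|f (sup S) - f x| < eps / 2.
      by apply: fs; rewrite /b' in x2; rewrite ltr_norml; apply/andP; split; lra.
    move: fb fb' fx; rewrite !ltr_norml !ler_norml.
    move=> /andP[? ?] /andP[? ?] /andP[? ?].
    by split; apply/andP; split; lra.
  - by case: Sb.
exists b' => //; rewrite leNgt; apply/negP => b'L.
have Sb' : S b'.
  split => //; rewrite (ltW b'L) andbT (le_trans _ (ltW sb'))// ub_le_sup//.
  by case: hS.
have : b' <= sup S by apply: ub_le_sup => //; case: hS.
by rewrite leNgt sb'.
Qed.

(** A combination of steps that vanishes on [-K, K] and, for K >= 0, is at least 1
    beyond K + 3 in absolute value. *)
Definition escape (R : realType) (K x : R) : R :=
  1 - smooth_step (1 * x + (K + 3)) + smooth_step (1 * x - K).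

Lemma escape_ge0 (R : realType) (K x : R) : 0 <= escape K x <= 2.
Proof.
have /andP[h0 h1] := smooth_step_itv (1 * x + (K + 3)).
have /andP[k0 k1] := smooth_step_itv (1 * x - K).
by rewrite /escape; apply/andP; split; lra.
Qed.

Lemma escape0 (R : realType) (K x : R) : `|x| <= K -> escape K x = 0.
Proof.
rewrite ler_norml => /andP[x1 x2].
by rewrite /escape smooth_step_ge3 ?smooth_step_le0; [lra|lra..].
Qed.

Lemma escape1 (R : realType) (K x : R) : 0 <= K -> K + 3 < `|x| -> 1 <= escape K x.
Proof.
move=> K0; rewrite /escape; have [x0|x0] := leP 0 x.
  rewrite (ger0_norm x0) => xK; rewrite (smooth_step_ge3 (x := 1 * x - K)); last lra.
  by have /andP[h0 h1] := smooth_step_itv (1 * x + (K + 3)); lra.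
rewrite (ltr0_norm x0) => xK; rewrite (smooth_step_le0 (x := 1 * x + (K + 3))); last lra.
by have /andP[h0 h1] := smooth_step_itv (1 * x - K); lra.
Qed.

Lemma measurable_smooth_step (R : realType) (c a : R) :
  measurable_fun setT (fun x : R => smooth_step (c * x + a)).
Proof. by have [m _ _] := taylor_test_affine a c (@smooth_step_taylor R). Qed.

Lemma measurable_escape (R : realType) (K : R) : measurable_fun setT (@escape R K).
Proof.
apply: measurable_funD; last exact: measurable_smooth_step.
by apply: measurable_funB => //; exact: measurable_smooth_step.
Qed.

Lemma cvg_escape d (T : measurableType d) (R : realType) (P : probability T R)
    (W : T -> R) : measurable_fun setT W ->
  Ex P (fun w => escape n%:R (W w)) @[n --> \oo] --> (0 : R).
Proof.
move=> mW; apply: (cvg_Ex_dominated (G := fun=> 2)).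
- by move=> n; apply: measurableT_comp => //; exact: measurable_escape.
- exact: L1_cst.
- by move=> n w; have /andP[h0 h1] := escape_ge0 n%:R (W w); rewrite ger0_norm.
move=> w; apply/cvgrPdist_le => e e0; near=> n.
rewrite escape0 ?subrr ?normr0 ?(ltW e0)//.
by near: n; exact: nbhs_infty_ger.
Unshelve. all: by end_near. Qed.

(** Steps control tightness: the expectation of [escape K] under Z n converges to that
    under W, which is small for large K. On the remaining compact interval f is
    uniformly close to a staircase of steps, whose expectations converge. *)
Lemma cvg_law_of_steps d d' (T : measurableType d) (T' : measurableType d')
    (R : realType) (P : probability T R) (P' : probability T' R)
    (Z : nat -> T -> R) (W : T' -> R) :
  (forall n, measurable_fun setT (Z n)) -> measurable_fun setT W ->
  (forall c a, 0 < c ->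
    Ex P (fun w => smooth_step (c * Z n w + a)) @[n --> \oo] -->
    Ex P' (fun w => smooth_step (c * W w + a))) ->
  cvg_in_distribution P Z P' W.
Proof.
move=> mZ mW cstep; split => // f cf [M0 [_ fM0]].
have [M M0' fM] : exists2 M, 0 <= M & forall x, `|f x| <= M.
  exists (`|M0| + 1) => [|x]; first by rewrite addr_ge0.
  by apply: (fM0 (`|M0| + 1)) => //; rewrite (le_lt_trans (ler_norm _))// ltrDl.
have mf : measurable_fun setT f by exact: continuous_measurable_fun.
have mfZ n : measurable_fun setT (f \o Z n) by exact: measurableT_comp.
have mfW : measurable_fun setT (f \o W) by exact: measurableT_comp.
have ifZ n : L1 P (f \o Z n) by apply: (@L1_bounded _ _ _ _ _ M) => // w; exact: fM.
have ifW : L1 P' (f \o W) by apply: (@L1_bounded _ _ _ _ _ M) => // w; exact: fM.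
suff : Ex P (f \o Z n) @[n --> \oo] --> Ex P' (f \o W).
  move=> h; rewrite unlock -(EFin_Ex ifW).
  under eq_fun do rewrite -(EFin_Ex (ifZ _)).
  by apply: cvg_EFin => //; near=> n.
pose Q (g : R -> R) := [/\ measurable_fun setT g, exists B, forall x, `|g x| <= B &
   Ex P (fun w => g (Z n w)) @[n --> \oo] --> Ex P' (fun w => g (W w))].
have Qcst b : Q (fun=> b).
  split; [exact: measurable_cst|by exists (`|b|)|].
  by under eq_fun do rewrite Ex_cst; rewrite Ex_cst; exact: cvg_cst.
have Qadd g be c a : 0 < c -> Q g -> Q (fun x => g x + be * smooth_step (c * x + a)).
  move=> c0 [mg [B gB] cg].
  have ms : measurable_fun setT (fun x => be * smooth_step (c * x + a)).
    by apply: measurable_funM => //; exact: measurable_smooth_step.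
  have b1 x : `|smooth_step (c * x + a)| <= 1.
    by have /andP[h0 h1] := smooth_step_itv (c * x + a); rewrite ger0_norm.
  split; first exact: measurable_funD.
    exists (B + `|be| * 1) => x; apply: le_trans (ler_normD _ _) _.
    by apply: lerD => //; rewrite normrM ler_wpM2l.
  have split_ dd (TT : measurableType dd) (PP : probability TT R) (V : TT -> R) :
      measurable_fun setT V ->
      Ex PP (fun w => g (V w) + be * smooth_step (c * V w + a)) =
      Ex PP (fun w => g (V w)) + be * Ex PP (fun w => smooth_step (c * V w + a)).
    move=> mV.
    have i1 : L1 PP (fun w => smooth_step (c * V w + a)).
      apply: (@L1_bounded _ _ _ _ _ 1) => //.
      exact: (measurableT_comp (measurable_smooth_step c a)).
    have i2 : L1 PP (fun w => g (V w)).
      by apply: (@L1_bounded _ _ _ _ _ B) => //; exact: measurableT_comp.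
    by rewrite (RintegralD measurableT i2 (L1Z be i1)) (RintegralZl _ measurableT i1).
  rewrite split_//; under eq_fun do rewrite split_//.
  by apply: cvgD => //; apply: cvgM; [exact: cvg_cst|exact: cstep].
apply/cvgrPdist_le => e e0.
(* the final estimate is a sum of 3 + 6 M errors of size e1 *)
pose e1 := e / (3 + 6 * M).
have M6 : 0 < 3 + 6 * M by lra.
have e10 : 0 < e1 by rewrite divr_gt0.
have [K escW] : exists K : nat, Ex P' (fun w => escape K%:R (W w)) <= e1.
  have /cvgrPdist_le/(_ _ e10) [K _ hK] := cvg_escape P' mW.
  exists K; have := hK K (leqnn K); rewrite /= sub0r normrN.
  by apply: le_trans; exact: ler_norm.
have [_ _ cesc] : Q (escape K%:R).
  have := Qadd _ 1 1 (- K%:R) ltr01 (Qadd _ (-1) 1 (K%:R + 3) ltr01 (Qcst 1)).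
  rewrite (_ : (fun x => _) = escape K%:R)//; apply/funext => x.
  by rewrite /escape mulN1r (mul1r (smooth_step _)).
have K3 : - (K%:R + 3) <= K%:R + 3 :> R by have : 0 <= K%:R :> R by []; lra.
have [L LK [g [[mg _ cg] _ gM ge]]] := staircase_exists Qcst Qadd cf fM e10 K3.
have key x : `|f x - g x| <= e1 + 2 * M * escape K%:R x.
  have /andP[esc0 _] := escape_ge0 K%:R x.
  have [xK|xK] := leP `|x| (K%:R + 3).
    apply: le_trans (ge x _) _.
      by move: xK; rewrite ler_norml => /andP[-> /le_trans]; exact.
    by rewrite lerDl mulr_ge0// mulr_ge0.
  have esc1 := escape1 (ler0n R K) xK.
  have : `|f x - g x| <= 2 * M.
    by rewrite (le_trans (ler_normB _ _))//; have := fM x; have := gM x; lra.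
  by move=> /le_trans; apply; nra.
have diff dd (TT : measurableType dd) (PP : probability TT R) (V : TT -> R) :
    measurable_fun setT V ->
    `|Ex PP (f \o V) - Ex PP (fun w => g (V w))| <=
     e1 + 2 * M * Ex PP (fun w => escape K%:R (V w)).
  move=> mV.
  have i1 : L1 PP (fun w => escape K%:R (V w)).
    apply: (@L1_bounded _ _ _ _ _ 2).
      exact: (measurableT_comp (measurable_escape K%:R)).
    by move=> w; have /andP[h0 h1] := escape_ge0 K%:R (V w); rewrite ger0_norm.
  have i2 : L1 PP (f \o V).
    by apply: (@L1_bounded _ _ _ _ _ M) => [|w]; [exact: measurableT_comp|exact: fM].
  have i3 : L1 PP (fun w => g (V w)).
    by apply: (@L1_bounded _ _ _ _ _ M) => [|w]; [exact: measurableT_comp|exact: gM].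
  rewrite -RintegralB// -[e1 in leRHS](Ex_cst PP) -RintegralZl// -RintegralD//.
  - apply: Ex_le_norm => //; first exact: L1B.
    by apply: L1D; [exact: L1_cst|exact: L1Z].
  - exact: L1_cst.
  - exact: L1Z.
have /cvgrPdist_le/(_ _ e10) cg1 := cg.
have /cvgrPdist_le/(_ _ e10) cesc1 := cesc.
near=> n.
have A1 := diff _ _ P (Z n) (mZ n).
have A2 := diff _ _ P' W mW.
have A3 : `|Ex P' (fun w => g (W w)) - Ex P (fun w => g (Z n w))| <= e1 by near: n.
have A4 : `|Ex P' (fun w => escape K%:R (W w)) - Ex P (fun w => escape K%:R (Z n w))| <= e1.
  by near: n.
have eE : e = 3 * e1 + 6 * M * e1 by rewrite /e1; field; rewrite gt_eqF.
have A5 : Ex P (fun w => escape K%:R (Z n w)) <= 2 * e1.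
  by move: A4; rewrite ler_norml => /andP[? ?]; lra.
have A6 : 2 * M * Ex P (fun w => escape K%:R (Z n w)) <= 2 * M * (2 * e1).
  by rewrite ler_wpM2l//; lra.
have A7 : 2 * M * Ex P' (fun w => escape K%:R (W w)) <= 2 * M * e1.
  by rewrite ler_wpM2l//; lra.
move: A1 A2 A3; rewrite !ler_norml => /andP[? ?] /andP[? ?] /andP[? ?].
by apply/andP; split; lra.
Unshelve. all: by end_near. Qed.

(** * Convergence in probability *)

(** Expanding with increments 1 and -1 bounds h1 and h2. Small increments are then
    controlled by the expansion, large ones by the bound on h. *)
Lemma taylor_test_lipschitz (R : realType) (h : R -> R) : taylor_test h ->
  exists2 L, 0 <= L & forall x y, `|h (x + y) - h x| <= L * `|y|.
Proof.
move=> [_ [M hM] [h1 [h2 [C [C0 hC]]]]].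
have M0 : 0 <= M by exact: le_trans (hM 0).
have b12 x : `|h1 x| <= C + 2 * M /\ `|h2 x| <= C + 2 * M.
  have := hC x 1; have := hC x (- 1).
  rewrite sqrrN !expr1n normrN normr1 !expr1n minxx !mulr1 mulrN1.
  have := hM x; have := hM (x + 1); have := hM (x - 1).
  rewrite !ler_norml => /andP[? ?] /andP[? ?] /andP[? ?] /andP[? ?] /andP[? ?].
  by split; apply/andP; split; lra.
exists (2 * (C + 2 * M) + C + 2 * M); first lra.
move=> x y; have [y1|y1] := leP `|y| 1; last first.
  apply: le_trans (ler_normB _ _) _; have := hM x; have := hM (x + y).
  have : 2 * M <= 2 * M * `|y| by rewrite ler_peMr//; lra.
  have : 0 <= (2 * (C + 2 * M) + C) * `|y| by rewrite mulr_ge0//; lra.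
  by lra.
have [b1 b2] := b12 x.
have ny := normr_ge0 y.
have c1 : `|h1 x * y| <= (C + 2 * M) * `|y| by rewrite normrM ler_wpM2r.
have c2 : `|h2 x * y ^+ 2| <= (C + 2 * M) * `|y|.
  rewrite normrM normrX ler_pM// ?exprn_ge0//.
  by rewrite expr2 ler_piMr.
have c3 : C * Num.min (`|y| ^+ 3) (y ^+ 2) <= C * `|y|.
  rewrite ler_wpM2l// ge_min; apply/orP; left.
  by rewrite exprS ler_piMr// exprn_ile1.
have c4 : 0 <= 2 * M * `|y| by rewrite mulr_ge0//; lra.
move: (le_trans (hC x y) c3) c1 c2.
rewrite !ler_norml => /andP[? ?] /andP[? ?] /andP[? ?].
by apply/andP; split; lra.
Qed.

Lemma measurable_ge_indicator d (T : measurableType d) (R : realType) (f : T -> R) (a : R) :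
  measurable_fun setT f -> measurable_fun setT (fun w => (a <= f w)%R%:R : R).
Proof.
move=> mf; rewrite (_ : (fun w => _) = \1_(f @^-1` `[a, +oo[%classic)).
  apply: measurable_indic; rewrite -[X in measurable X]setTI; exact: mf.
apply/funext => w; rewrite indicE; congr (_%:R); congr nat_of_bool.
by apply/idP/idP; rewrite inE/= in_itv/= andbT.
Qed.

Lemma L1_ge_indicator d (T : measurableType d) (R : realType) (P : probability T R)
    (f : T -> R) (a : R) :
  measurable_fun setT f -> L1 P (fun w => (a <= f w)%R%:R : R).
Proof.
move=> mf; apply: (@L1_bounded _ _ _ _ _ 1); first exact: measurable_ge_indicator.
by move=> w; case: (a <= f w); rewrite ?normr1 ?normr0.
Qed.

(** Probabilities are written as expectations of
    indicators, so that events are compared by inequalities between functions. *)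
Definition cvg_prob0 d (T : measurableType d) (R : realType) (P : probability T R)
    (D : nat -> T -> R) : Prop :=
  forall dl, 0 < dl ->
    Ex P (fun w => (dl <= `|D n w|)%R%:R : R) @[n --> \oo] --> (0 : R).

Lemma slutsky_test d (T : measurableType d) (R : realType) (P : probability T R)
    (Z Z' : nat -> T -> R) (h : R -> R) (l : R) :
  taylor_test h -> (forall n, measurable_fun setT (Z n)) ->
  (forall n, measurable_fun setT (Z' n)) ->
  cvg_prob0 P (fun n w => Z n w - Z' n w) ->
  Ex P (fun w => h (Z' n w)) @[n --> \oo] --> l ->
  Ex P (fun w => h (Z n w)) @[n --> \oo] --> l.
Proof.
move=> th mZ mZ' ZZ' cZ'; have [L L0 hL] := taylor_test_lipschitz th.
have [mh [M hM] _] := th.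
have M0 : 0 <= M by exact: le_trans (hM 0).
apply/cvgrPdist_le => e e0.
pose e1 := e / 3; have e10 : 0 < e1 by rewrite divr_gt0.
pose dl := e1 / (L + 1); have dl0 : 0 < dl by rewrite divr_gt0//; lra.
pose e2 := e1 / (2 * M + 1); have e20 : 0 < e2 by rewrite divr_gt0//; lra.
have /cvgrPdist_le/(_ _ e10) c1 := cZ'.
have /cvgrPdist_le/(_ _ e20) c2 := ZZ' _ dl0.
near=> n.
have A1 : `|l - Ex P (fun w => h (Z' n w))| <= e1 by near: n.
have : `|0 - Ex P (fun w => (dl <= `|Z n w - Z' n w|)%R%:R : R)| <= e2 by near: n.
rewrite sub0r normrN => /(le_trans (ler_norm _)) A2.
have iZ : L1 P (fun w => h (Z n w)).
  by apply: (@L1_bounded _ _ _ _ _ M) => //; exact: measurableT_comp.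
have iZ' : L1 P (fun w => h (Z' n w)).
  by apply: (@L1_bounded _ _ _ _ _ M) => //; exact: measurableT_comp.
have iI : L1 P (fun w => (dl <= `|Z n w - Z' n w|)%R%:R : R).
  apply: L1_ge_indicator; apply: measurableT_comp => //; exact: measurable_funB.
have A3 : `|Ex P (fun w => h (Z n w)) - Ex P (fun w => h (Z' n w))| <=
    L * dl + 2 * M * Ex P (fun w => (dl <= `|Z n w - Z' n w|)%R%:R : R).
  rewrite -RintegralB// -[L * dl](Ex_cst P) -RintegralZl// -RintegralD//; last 2 first.
    exact: L1_cst.
    exact: L1Z.
  apply: Ex_le_norm; first exact: L1B.
    by apply: L1D; [exact: L1_cst|exact: L1Z].
  move=> w; have [h1|h1] := leP dl `|Z n w - Z' n w|.
    rewrite mulr1; have := hM (Z n w); have := hM (Z' n w).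
    have : 0 <= L * dl by rewrite mulr_ge0// ltW.
    by have := ler_normB (h (Z n w)) (h (Z' n w)); lra.
  rewrite mulr0 addr0; have := hL (Z' n w) (Z n w - Z' n w).
  by rewrite (addrC (Z' n w)) subrK => /le_trans; apply; rewrite ler_wpM2l// ltW.
have A4 : L * dl <= e1.
  rewrite /dl mulrA ler_pdivrMr; last lra.
  by rewrite mulrC ler_wpM2l ?(ltW e10)//; lra.
have A5 : 2 * M * Ex P (fun w => (dl <= `|Z n w - Z' n w|)%R%:R : R) <= e1.
  have h3 : 2 * M * e2 <= e1.
    rewrite /e2 mulrA ler_pdivrMr; last lra.
    by rewrite mulrC ler_wpM2l ?(ltW e10)//; lra.
  by apply: le_trans h3; rewrite ler_wpM2l//; lra.
have eE : e = 3 * e1 by rewrite /e1; field.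
move: A1 A3; rewrite !ler_norml => /andP[? ?] /andP[? ?].
by apply/andP; split; lra.
Unshelve. all: by end_near. Qed.

Lemma chebyshev_Ex d (T : measurableType d) (R : realType) (P : probability T R)
    (U : T -> R) (a : R) : 0 < a -> measurable_fun setT U -> L1 P (fun w => U w ^+ 2) ->
  Ex P (fun w => (a <= `|U w|)%R%:R : R) <= a ^- 2 * Ex P (fun w => U w ^+ 2).
Proof.
move=> a0 mU iU; rewrite -RintegralZl//; apply: le_Ex.
- by apply: L1_ge_indicator; exact: measurableT_comp.
- exact: L1Z.
- move=> w; have a2 : 0 < a ^- 2 by rewrite invr_gt0 exprn_gt0.
  have [h|h] := leP a `|U w|; last by rewrite mulr_ge0 ?sqr_ge0 ?(ltW a2).
  rewrite mulrC ler_pdivlMr ?exprn_gt0// mul1r -[leRHS]real_normK ?num_real//.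
  by rewrite lerXn2r ?nnegrE ?(ltW a0).
Qed.

Lemma psum_bound d (T : measurableType d) (R : realType)
    (X : nat -> {mfun T >-> R}) (phi : R -> R) (B : R) n w :
  (forall x, `|phi x| <= B) -> `|psum X phi n w| <= n%:R * B.
Proof.
move=> pB; rewrite /psum; apply: le_trans (ler_norm_sum _ _ _) _.
rewrite mulr_natl -[n in _ *+ n]card_ord -sumr_const.
by apply: ler_sum => i _.
Qed.

(** The square is not bounded, as [Ex_psumS] requires, but it agrees with a truncation
    on the range of the bounded sum. *)
Lemma Ex_psum_sqr d dY (T : measurableType d) (TY : measurableType dY) (R : realType)
    (P : probability T R) (PY : probability TY R)
    (X : nat -> {RV P >-> R}) (Y : {RV PY >-> R}) (phi : R -> R) (B : R) n :
  (forall i r, cdf (X i) r = cdf Y r) -> mutually_independent X ->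
  measurable_fun setT phi -> (forall x, `|phi x| <= B) ->
  Ex PY (fun w => phi (Y w)) = 0 ->
  L1 P (fun w => psum X phi n w ^+ 2) /\
  Ex P (fun w => psum X phi n w ^+ 2) = n%:R * Ex PY (fun w => phi (Y w) ^+ 2).
Proof.
move=> XY indX mphi pB phi0.
have B0 : 0 <= B by exact: le_trans (pB 0).
have mS m : measurable_fun setT (psum X phi m) by exact: (measurable_psum X m mphi).
have i2 m : L1 P (fun w => psum X phi m w ^+ 2).
  apply: (@L1_bounded _ _ _ _ _ ((m%:R * B) ^+ 2)); first exact: measurable_funX.
  by move=> w; rewrite normrX lerXn2r ?nnegrE ?psum_bound// mulr_ge0.
split => //; elim: n => [|n IH].
  rewrite mul0r -[RHS](Ex_cst P); apply: eq_Rintegral => w _.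
  by rewrite /psum big_ord0 expr0n.
(* the truncation level bounds the sum of n + 1 terms *)
pose K := n.+1%:R * B.
pose h (x : R) := Num.min (x ^+ 2) (K ^+ 2).
have mh : measurable_fun setT h by apply: measurable_minr => //; exact: measurable_funX.
have hK x : `|h x| <= K ^+ 2.
  by rewrite ger0_norm /h ?le_min ?sqr_ge0// ge_min lexx orbT.
have hE x : `|x| <= K -> h x = x ^+ 2.
  move=> xK; rewrite /h minEle -(real_normK (num_real x)) lerXn2r ?nnegrE//.
  by rewrite /K mulr_ge0.
have := @Ex_psumS _ _ _ P X phi h n (K ^+ 2) 1 indX mphi mh hK.
rewrite (_ : Ex P (fun w => h (1 * psum X phi n.+1 w)) =
    Ex P (fun w => psum X phi n.+1 w ^+ 2)); last first.
  by apply: eq_Rintegral => w _; rewrite mul1r hE// psum_bound.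
move=> ->; rewrite -natr1 mulrDl mul1r -IH.
have iphi : L1 P (fun w => phi (X n w)).
  by apply: (@L1_bounded _ _ _ _ _ B) => //; exact: measurableT_comp.
have iphi2 : L1 P (fun w => phi (X n w) ^+ 2).
  apply: (@L1_bounded _ _ _ _ _ (B ^+ 2)).
    by apply: measurable_funX; exact: measurableT_comp.
  by move=> w; rewrite normrX lerXn2r ?nnegrE.
have e1 : Ex P (fun w => phi (X n w)) = 0.
  rewrite -phi0; apply: (proj2 (same_cdf_Ex (XY n) mphi _)).
  by apply: (@L1_bounded _ _ _ _ _ B) => //; exact: measurableT_comp.
have e2 : Ex P (fun w => phi (X n w) ^+ 2) = Ex PY (fun w => phi (Y w) ^+ 2).
  apply: (proj2 (same_cdf_Ex (h := fun x => phi x ^+ 2) (XY n) _ _)).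
    exact: measurable_funX.
  apply: (@L1_bounded _ _ _ _ _ (B ^+ 2)).
    by apply: measurable_funX; exact: measurableT_comp.
  by move=> w; rewrite normrX lerXn2r ?nnegrE.
rewrite -e2 -[Ex P (fun w => phi _ ^+ 2)](Ex_cst P) -RintegralD//; last exact: L1_cst.
apply: eq_Rintegral => w _.
transitivity (Ex P (fun w' =>
    psum X phi n w ^+ 2 + 2 * psum X phi n w * phi (X n w') + phi (X n w') ^+ 2)).
  apply: eq_Rintegral => w' _; rewrite !mul1r hE; first by ring.
  apply: le_trans (ler_normD _ _) _; rewrite /K -natr1 mulrDl mul1r.
  by apply: lerD => //; exact: psum_bound.
have i1 := L1Z (2 * psum X phi n w) iphi.
rewrite RintegralD//; last by apply: L1D => //; exact: L1_cst.
rewrite RintegralD//; last exact: L1_cst.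
by rewrite Ex_cst (RintegralZl _ measurableT iphi) e1 mulr0 addr0.
Qed.

(** * Maxima of the empirical shortfall objective *)

(** The empirical counterpart of x - E (x - Y)^+ / a. The latter is concave, is
    maximal at the a-quantile of Y and has the expected shortfall as its maximum. *)
Definition emp_objective (R : realType) n (y : 'I_n -> R) (a x : R) : R :=
  x - a^-1 * (n%:R^-1 * \sum_i ramp (x - y i)).

Definition es_objective d (T : measurableType d) (R : realType)
    (X : nat -> {mfun T >-> R}) (a : R) (n : nat) (w : T) : R -> R :=
  emp_objective (fun i : 'I_n => X i w) a.

Definition emp_cdf d (T : measurableType d) (R : realType)
    (X : nat -> {mfun T >-> R}) (n : nat) (w : T) (z : R) : R :=
  n%:R^-1 * psum X (fun y => (y <= z)%R%:R) n w.

(** Concavity: 1 - F_n(z) / a is a supergradient at z, with F_n the empirical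
    distribution function. *)
Lemma es_objective_le d (T : measurableType d) (R : realType)
    (X : nat -> {mfun T >-> R}) (a : R) (n : nat) (w : T) (x z : R) : 0 < a ->
  es_objective X a n w x - es_objective X a n w z <=
  (x - z) * (1 - a^-1 * emp_cdf X n w z).
Proof.
move=> a0; rewrite /es_objective /emp_objective /emp_cdf /psum.
set A := \sum_(i < n) ramp (x - _); set B := \sum_(i < n) ramp (z - _).
set C := \sum_(i < n) _.
have ABC : C * (x - z) <= A - B.
  rewrite /A /B /C mulr_suml -sumrB; apply: ler_sum => i _.
  exact: ramp_subgradient.
have : a^-1 * n%:R^-1 * (C * (x - z)) <= a^-1 * n%:R^-1 * (A - B).
  by rewrite ler_wpM2l// mulr_ge0// invr_ge0 ltW.
rewrite -subr_ge0 => h; rewrite -subr_ge0; apply: le_trans h _.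
by rewrite le_eqVlt; apply/orP; left; apply/eqP; ring.
Qed.

(** The slopes at q - e and q + e have opposite signs, so the objective is largest
    between them, where the supporting line at q bounds its growth. *)
Lemma es_objective_local d (T : measurableType d) (R : realType)
    (X : nat -> {mfun T >-> R}) (a q e : R) (n : nat) (w : T) (x : R) :
  0 < a -> 0 < e ->
  emp_cdf X n w (q - e) < a -> a < emp_cdf X n w (q + e) ->
  es_objective X a n w x - es_objective X a n w q <=
  e * `|1 - a^-1 * emp_cdf X n w q|.
Proof.
move=> a0 e0 Fl Fr; pose g := es_objective X a n w.
have near_q y : `|y - q| <= e -> g y - g q <= e * `|1 - a^-1 * emp_cdf X n w q|.
  move=> yq; apply: le_trans (es_objective_le _ _ _ _ _ a0) _.
  by apply: le_trans (ler_norm _) _; rewrite normrM ler_wpM2r.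
have sl z : (1 - a^-1 * emp_cdf X n w z) = a^-1 * (a - emp_cdf X n w z).
  by field; rewrite gt_eqF.
have ai : 0 < a^-1 by rewrite invr_gt0.
have [xl|xl] := leP x (q - e).
  have := es_objective_le X n w x (q - e) a0; rewrite sl.
  have s1 : 0 <= a^-1 * (a - emp_cdf X n w (q - e)) by rewrite mulr_ge0 ?(ltW ai)//; lra.
  have : (x - (q - e)) * (a^-1 * (a - emp_cdf X n w (q - e))) <= 0.
    by rewrite mulr_le0_ge0//; lra.
  have : g (q - e) - g q <= e * `|1 - a^-1 * emp_cdf X n w q|.
    by apply: near_q; rewrite addrAC subrr sub0r normrN gtr0_norm.
  by rewrite /g; lra.
have [xr|xr] := leP (q + e) x.
  have := es_objective_le X n w x (q + e) a0; rewrite sl.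
  have s1 : a^-1 * (a - emp_cdf X n w (q + e)) <= 0.
    by rewrite mulr_ge0_le0 ?(ltW ai)//; lra.
  have : (x - (q + e)) * (a^-1 * (a - emp_cdf X n w (q + e))) <= 0.
    by rewrite mulr_ge0_le0//; lra.
  have : g (q + e) - g q <= e * `|1 - a^-1 * emp_cdf X n w q|.
    by apply: near_q; rewrite addrAC subrr add0r gtr0_norm.
  by rewrite /g; lra.
by apply: near_q; rewrite ler_norml; apply/andP; split; lra.
Qed.

Lemma es_objective_lip d (T : measurableType d) (R : realType)
    (X : nat -> {mfun T >-> R}) (a : R) (n : nat) (w : T) (x z : R) :
  0 < a -> (0 < n)%N ->
  `|es_objective X a n w x - es_objective X a n w z| <= (1 + a^-1) * `|x - z|.
Proof.
move=> a0 n0; have nR : (0 : R) < n%:R by rewrite ltr0n.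
rewrite /es_objective /emp_objective.
set A := \sum_(i < n) ramp (x - _); set B := \sum_(i < n) ramp (z - _).
have AB : `|A - B| <= n%:R * `|x - z|.
  rewrite /A /B -sumrB; apply: le_trans (ler_norm_sum _ _ _) _.
  rewrite mulr_natl -[n in _ *+ n]card_ord -sumr_const.
  apply: ler_sum => i _; apply: le_trans (ramp_lip _ _) _.
  by rewrite (_ : _ - _ - _ = x - z)//; ring.
rewrite (_ : _ - _ = (x - z) - a^-1 * (n%:R^-1 * (A - B))); last by ring.
apply: le_trans (ler_normB _ _) _; rewrite mulrDl mul1r lerD2l.
have ai : 0 < a^-1 by rewrite invr_gt0.
have ni : 0 < n%:R^-1 :> R by rewrite invr_gt0.
by rewrite !normrM (gtr0_norm ai) (gtr0_norm ni) (ler_pM2l ai) ler_pdivrMl.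
Qed.

Lemma measurable_es_objective d (T : measurableType d) (R : realType)
    (X : nat -> {mfun T >-> R}) (a : R) (n : nat) (x : R) :
  measurable_fun setT (fun w => es_objective X a n w x).
Proof.
apply: measurable_funB => //; do 2 apply: measurable_funM => //.
apply: measurable_sum => i; apply: measurableT_comp; first exact: measurable_ramp.
exact: measurable_funB.
Qed.

(** A maximizer qh need not be measurable in w, but the maximum is: by continuity in x
    it is a supremum over rational points. *)
Lemma measurable_es_max d (T : measurableType d) (R : realType)
    (X : nat -> {mfun T >-> R}) (a : R) (n : nat) (qh : T -> R) :
  0 < a -> (0 < n)%N ->
  (forall w x, es_objective X a n w x <= es_objective X a n w (qh w)) ->
  measurable_fun setT (fun w => es_objective X a n w (qh w)).
Proof.
move=> a0 n0 qmax.
apply: (measurability _ (RGenOInfty.measurableE R)) => _ [_ [c ->] <-].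
rewrite setTI (_ : _ @^-1` _ = \bigcup_(r : rat)
    (fun w => es_objective X a n w (ratr r)) @^-1` `]c, +oo[%classic); last first.
  apply/seteqP; split => w /=; rewrite in_itv/= andbT; last first.
    by move=> [r _ /=]; rewrite in_itv/= andbT => /lt_le_trans; apply.
  move=> cw; set dl := es_objective X a n w (qh w) - c.
  have dl0 : 0 < dl by rewrite subr_gt0.
  have a1 : 0 < 1 + a^-1 by rewrite ltr_wpDr// invr_ge0 ltW.
  have e0 : 0 < dl / (1 + a^-1) by rewrite divr_gt0.
  have qe : qh w < qh w + dl / (1 + a^-1) by rewrite ltrDl.
  have [r] := rat_in_itvoo qe.
  rewrite in_itv/= => /andP[r1 r2]; exists r => //=; rewrite in_itv/= andbT.
  have := es_objective_lip X w (qh w) (ratr r) a0 n0.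
  move=> /(le_trans (ler_norm _)).
  have : (1 + a^-1) * `|qh w - ratr r| < dl.
    rewrite distrC gtr0_norm ?subr_gt0// mulrC -ltr_pdivlMr//.
    by rewrite ltrBlDl.
  by rewrite /dl; lra.
apply: bigcupT_measurable_rat => r.
by rewrite -[X in measurable X]setTI; exact: (measurable_es_objective X a n (ratr r)).
Qed.

Lemma Ex_le_indicator d (T : measurableType d) (R : realType) (P : probability T R)
    (Y : {RV P >-> R}) (F : R -> R) (z : R) :
  (forall r, cdf Y r = (F r)%:E) ->
  L1 P (fun w => (Y w <= z)%R%:R : R) /\ Ex P (fun w => (Y w <= z)%R%:R : R) = F z.
Proof.
move=> hF.
have E : (fun w => (Y w <= z)%R%:R : R) = \1_(Y @^-1` `]-oo, z]%classic).
  apply/funext => w; rewrite indicE; congr (_%:R); congr nat_of_bool.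
  by apply/idP/idP; rewrite inE/= in_itv.
have mA : measurable (Y @^-1` `]-oo, z]%classic) by exact: measurable_mfun_preimage.
split.
  rewrite E; apply: (@L1_bounded _ _ _ _ _ 1); first exact: measurable_indic.
  by move=> w; rewrite indicE; case: (_ \in _); rewrite ?normr1 ?normr0.
rewrite E /Rintegral integral_indic// setIT.
by transitivity (fine (cdf Y z)); [|rewrite hF].
Qed.

Lemma measurable_le_indicator (R : realType) (z : R) :
  measurable_fun setT (fun y : R => (y <= z)%R%:R : R).
Proof.
rewrite (_ : (fun w => _) = \1_(`]-oo, z]%classic)); first exact: measurable_indic.
apply/funext => w; rewrite indicE; congr (_%:R); congr nat_of_bool.
by apply/idP/idP; rewrite inE/= in_itv.
Qed.

Lemma emp_cdf_chebyshev d dY (T : measurableType d) (TY : measurableType dY) (R : realType)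
    (P : probability T R) (PY : probability TY R)
    (X : nat -> {RV P >-> R}) (Y : {RV PY >-> R}) (F : R -> R) (z t : R) (n : nat) :
  (forall r, cdf Y r = (F r)%:E) -> (forall i r, cdf (X i) r = cdf Y r) ->
  mutually_independent X -> 0 < t ->
  Ex P (fun w => (t <= `|psum X (fun y => (y <= z)%R%:R - F z) n w|)%R%:R : R) <= n%:R / t ^+ 2.
Proof.
move=> hF XY indX t0.
have [iI eI] := Ex_le_indicator z hF.
have F01 : 0 <= F z <= 1.
  have := cdf_ge0 Y z; have := cdf_le1 Y z.
  by rewrite hF !lee_fin => -> ->.
have mphi : measurable_fun setT (fun y : R => (y <= z)%R%:R - F z).
  by apply: measurable_funB => //; exact: measurable_le_indicator.
have pB y : `|(y <= z)%R%:R - F z| <= 1.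
  by case/andP: F01 => ? ?; case: (y <= z) => /=; rewrite ler_norml; apply/andP; split; lra.
have phi0 : Ex PY (fun w => (Y w <= z)%R%:R - F z) = 0.
  by rewrite RintegralB//; [rewrite eI Ex_cst subrr|exact: L1_cst].
have [i2 e2] := Ex_psum_sqr n XY indX mphi pB phi0.
apply: le_trans (chebyshev_Ex t0 (measurable_psum X n mphi) i2) _.
rewrite e2 mulrC -mulrA ler_wpM2l// ler_piMl ?invr_ge0 ?exprn_ge0 ?(ltW t0)//.
apply: le_trans (ler_norm _) _; apply: Ex_bounded.
  apply: measurable_funX.
  exact: (measurableT_comp mphi).
by move=> w; rewrite normrX exprn_ile1.
Qed.

(** An excess of at least dl / sqrt n forces F_n to deviate from F: at q - eta or
    q + eta by a fixed amount, or at q by at least t3 / n, by [es_objective_local].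
    Chebyshev's inequality bounds the first two probabilities by O(1/n) and the last
    one by m^2; eta was chosen so that m is as small as desired. *)
Lemma es_remainder d dY (T : measurableType d) (TY : measurableType dY) (R : realType)
    (P : probability T R) (PY : probability TY R)
    (X : nat -> {RV P >-> R}) (Y : {RV PY >-> R}) (F : R -> R) (a q : R)
    (qh : nat -> T -> R) :
  (forall r, cdf Y r = (F r)%:E) -> (forall i r, cdf (X i) r = cdf Y r) ->
  mutually_independent X -> 0 < a -> F q = a -> strictly_increasing_at F q ->
  (forall n w x, (0 < n)%N ->
     es_objective X a n w x <= es_objective X a n w (qh n w)) ->
  cvg_prob0 P (fun n w => Num.sqrt n%:R *
    (es_objective X a n w (qh n w) - es_objective X a n w q)).
Proof.
move=> hF XY indX a0 Fq [Fl Fr] qmax dl dl0.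
apply/cvgrPdist_le => e e0.
pose m := Num.min 1 (e / 2).
have e2 : 0 < e / 2 by rewrite divr_gt0.
have m0 : 0 < m by rewrite lt_min ltr01.
have m1 : m <= 1 by rewrite ge_min lexx.
have me : m <= e / 2 by rewrite ge_min lexx orbT.
(* with this eta, the deviation of F_n at q that forces an excess dl / sqrt n has
   Chebyshev bound m^2 <= m <= e / 2, and m <= 1 gives m^2 <= m *)
pose eta := dl * a * m.
have eta0 : 0 < eta by rewrite !mulr_gt0.
pose g1 := a - F (q - eta); pose g2 := F (q + eta) - a.
have g10 : 0 < g1 by rewrite subr_gt0 -Fq; apply: Fl; rewrite gtrDl oppr_lt0.
have g20 : 0 < g2 by rewrite subr_gt0 -Fq; apply: Fr; rewrite ltrDl.
pose I z (y : R) : R := (y <= z)%R%:R - F z.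
have psumE z n w : (0 < n)%N -> psum X (I z) n w = n%:R * (emp_cdf X n w z - F z).
  move=> n0; rewrite /emp_cdf mulrBr mulrA divff ?pnatr_eq0 -?lt0n// mul1r.
  rewrite /psum /I sumrB; congr (_ - _).
  by rewrite sumr_const card_ord mulr_natl.
near=> n.
have n0 : (0 < n)%N by near: n; exact: nbhs_infty_gt.
have nR : (0 : R) < n%:R by rewrite ltr0n.
have sn : 0 < Num.sqrt (n%:R : R) by rewrite sqrtr_gt0.
have nbig : (g1 ^- 2 + g2 ^- 2) / n%:R <= e / 2.
  rewrite ler_pdivrMr// -ler_pdivrMl//; near: n; exact: nbhs_infty_ger.
have mI z : measurable_fun setT (I z).
  by apply: measurable_funB => //; exact: measurable_le_indicator.
have iI z t : L1 P (fun w => (t <= `|psum X (I z) n w|)%R%:R : R).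
  apply: L1_ge_indicator; apply: measurableT_comp => //.
  exact: (measurable_psum X n (mI z)).
pose D w := Num.sqrt n%:R * (es_objective X a n w (qh n w) - es_objective X a n w q).
have mD : measurable_fun setT D.
  apply: measurable_funM => //; apply: measurable_funB.
    by apply: measurable_es_max => // w x; exact: qmax.
  exact: measurable_es_objective.
have iD : L1 P (fun w => (dl <= `|D w|)%R%:R : R).
  by apply: L1_ge_indicator; exact: measurableT_comp.
have D0 w : 0 <= D w by rewrite mulr_ge0 ?subr_ge0 ?qmax ?sqrtr_ge0.
pose t3 := dl * a * Num.sqrt n%:R / eta.
have t30 : 0 < t3 by rewrite divr_gt0// !mulr_gt0.
have t10 : 0 < n%:R * g1 by rewrite mulr_gt0.
have t20 : 0 < n%:R * g2 by rewrite mulr_gt0.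
have key w : (dl <= `|D w|)%R%:R <= (n%:R * g1 <= `|psum X (I (q - eta)) n w|)%R%:R +
    (n%:R * g2 <= `|psum X (I (q + eta)) n w|)%R%:R +
    (t3 <= `|psum X (I q) n w|)%R%:R :> R.
  have b01 (b : bool) : 0 <= (b%:R : R) by [].
  have [h1|h1] := leP (n%:R * g1) `|psum X (I (q - eta)) n w|.
    have := b01 (n%:R * g2 <= `|psum X (I (q + eta)) n w|).
    have := b01 (t3 <= `|psum X (I q) n w|).
    by case: (dl <= `|D w|) => /=; lra.
  have [h2|h2] := leP (n%:R * g2) `|psum X (I (q + eta)) n w|.
    have := b01 (t3 <= `|psum X (I q) n w|).
    by case: (dl <= `|D w|) => /=; lra.
  have [h3|h3] := leP t3 `|psum X (I q) n w|; first by case: (dl <= `|D w|) => /=; lra.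
  suff -> : (dl <= `|D w|) = false by rewrite /= !addr0.
  apply/negbTE; rewrite -ltNge ger0_norm ?D0//.
  have Fl1 : emp_cdf X n w (q - eta) < a.
    move: h1; rewrite psumE// normrM (gtr0_norm nR) ltr_pM2l// ltr_norml /g1.
    by move=> /andP[? ?]; lra.
  have Fr1 : a < emp_cdf X n w (q + eta).
    move: h2; rewrite psumE// normrM (gtr0_norm nR) ltr_pM2l// ltr_norml /g2.
    by move=> /andP[? ?]; lra.
  have := es_objective_local (qh n w) a0 eta0 Fl1 Fr1.
  rewrite -(ler_pM2l sn) -/(D w) => /le_lt_trans; apply.
  have -> : 1 - a^-1 * emp_cdf X n w q = - (a^-1 * (emp_cdf X n w q - a)).
    by field; rewrite gt_eqF.
  move: h3; rewrite psumE// Fq normrN !normrM (gtr0_norm nR).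
  rewrite (@gtr0_norm _ a^-1) ?invr_gt0//.
  set u := `|_ - a|; rewrite /t3 ltr_pdivlMr// => h3.
  rewrite -(ltr_pM2l a0) -(ltr_pM2l sn).
  rewrite (_ : _ * _ = n%:R * u * eta); first (apply: lt_le_trans h3 _;
    by rewrite le_eqVlt; apply/orP; left; apply/eqP; ring).
  rewrite -[in RHS](sqr_sqrtr (ltW nR)) expr2.
  by field; rewrite gt_eqF.
have c1 := emp_cdf_chebyshev (q - eta) n hF XY indX t10.
have c2 := emp_cdf_chebyshev (q + eta) n hF XY indX t20.
have c3 := emp_cdf_chebyshev q n hF XY indX t30.
have EP0 : 0 <= Ex P (fun w => (dl <= `|D w|)%R%:R : R) by apply: Rintegral_ge0.
rewrite sub0r normrN ger0_norm//.
apply: le_trans (le_Ex iD _ key) _; first by apply: L1D => //; apply: L1D.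
rewrite RintegralD//; last by apply: L1D.
rewrite RintegralD//.
have f1 : n%:R / (n%:R * g1) ^+ 2 + n%:R / (n%:R * g2) ^+ 2 = (g1 ^- 2 + g2 ^- 2) / n%:R.
  by field; rewrite !gt_eqF.
have f3 : n%:R / t3 ^+ 2 = m ^+ 2.
  rewrite /t3 /eta; have := sqr_sqrtr (ltW nR); move: sn.
  move: (Num.sqrt _) => s s0 <-.
  by field; rewrite !gt_eqF.
have mm : m ^+ 2 <= m by rewrite expr2 ler_piMr// ltW.
rewrite f3 in c3.
by rewrite /I; lra.
Unshelve. all: by end_near. Qed.

(** * Quantile transform and expected shortfall *)

Section distribution_function.
Context d (T : measurableType d) (R : realType) (P : probability T R).
Variables (Y : {RV P >-> R}) (F : R -> R).
Hypothesis hF : forall r, cdf Y r = (F r)%:E.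

Lemma cdfFE : F = fine \o cdf Y.
Proof. by apply/funext => r; rewrite /= hF. Qed.

Lemma cdfF_nd x y : x <= y -> F x <= F y.
Proof. by move=> xy; rewrite -lee_fin -!hF; exact: cdf_nondecreasing. Qed.

Lemma cdfF_itv x : 0 <= F x <= 1.
Proof. by rewrite -!lee_fin -hF cdf_ge0 cdf_le1. Qed.

Lemma cdfF_low u : 0 < u -> exists b, forall y, u <= F y -> b <= y.
Proof.
move=> u0; have h : F r @[r --> -oo] --> (0 : R).
  by rewrite cdfFE; apply: fine_cvg; exact: cvg_cdfNy0.
have /cvgrPdist_lt/(_ _ u0) [M [_ hM]] := h.
exists (M - 1) => y uy; rewrite leNgt; apply/negP => yM.
have yM' : y < M by lra.
have := hM y yM'; rewrite sub0r normrN ger0_norm; last by case/andP: (cdfF_itv y).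
by move=> /(le_lt_trans uy); rewrite ltxx.
Qed.

Lemma cdfF_high u : u < 1 -> exists y, u <= F y.
Proof.
move=> u1; have h : F r @[r --> +oo] --> (1 : R).
  by rewrite cdfFE; apply: fine_cvg; exact: cvg_cdfy1.
have e0 : 0 < 1 - u by rewrite subr_gt0.
have /cvgrPdist_lt/(_ _ e0) [M [_ hM]] := h.
exists (M + 1); have := hM (M + 1) _; rewrite ltrDl ltr01 => /(_ isT).
by rewrite ltr_norml => /andP[? ?]; lra.
Qed.

Lemma cdfF_right q u : F q < u -> exists2 y, q < y & F y < u.
Proof.
move=> Fu; have h : F r @[r --> q^'+] --> F q.
  rewrite {1}cdfFE; apply: fine_cvg; rewrite -hF.
  exact: cdf_right_continuous.
have e0 : 0 < u - F q by rewrite subr_gt0.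
have /cvgrPdist_lt/(_ _ e0) h1 := h.
have : \forall y \near q^'+, q < y /\ `|F q - F y| < u - F q.
  by near=> y; split; near: y => //; exact: nbhs_right_gt.
move=> /filter_ex [y [qy Fy]]; exists y => //.
by move: Fy; rewrite ltr_norml => /andP[? ?]; lra.
Unshelve. all: by end_near. Qed.

(** The infimum defining the quantile is attained, by right-continuity of F. *)
Lemma quantile_le u y : 0 < u < 1 -> (quantile F u <= y) = (u <= F y).
Proof.
move=> /andP[u0 u1]; set A := [set y | u <= F y].
have hA : has_inf A.
  split; first by have [z hz] := cdfF_high u1; exists z.
  by have [b hb] := cdfF_low u0; exists b.
apply/idP/idP => [qy|uy]; last by apply: ge_inf => //; case: hA.
apply: le_trans (cdfF_nd qy); rewrite leNgt; apply/negP => /cdfF_right[z qz Fz].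
have zq : 0 < z - quantile F u by rewrite subr_gt0.
have [t At] := inf_adherent zq hA.
rewrite -/(quantile F u) addrC subrK => tz.
by have := cdfF_nd (ltW tz); rewrite leNgt (lt_le_trans Fz).
Qed.

Lemma cdf_quantile u : 0 < u < 1 -> {for quantile F u, continuous F} ->
  F (quantile F u) = u.
Proof.
move=> u01 cF; apply/eqP; rewrite eq_le -quantile_le// lexx andbT leNgt.
apply/negP => Fu; have e0 : 0 < F (quantile F u) - u by rewrite subr_gt0.
have /cvgrPdist_lt/(_ _ e0) /nbhs_ballP[eta /= eta0 h] := cF.
have := h (quantile F u - eta / 2).
have e2 : 0 < eta / 2 by rewrite divr_gt0.
have qe : quantile F u - (quantile F u - eta / 2) = eta / 2 by ring.
rewrite /ball/= qe gtr0_norm// => /(_ (ltac:(lra))).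
rewrite ltr_norml => /andP[_ h1].
have : quantile F u <= quantile F u - eta / 2 by rewrite quantile_le//; lra.
by lra.
Qed.

(** Extending the quantile function by 0 outside ]0, 1[ makes it a random variable
    under the uniform law. *)
Definition quantile0 : R -> R := quantile F \_ (`]0, 1[%classic : set R).

Lemma measurable_quantile0 : measurable_fun setT (quantile0 : measurableTypeR R -> R).
Proof.
have mD : measurable (`]0, 1[%classic : set R) by [].
have mq : measurable_fun (`]0, 1[%classic : set R) (quantile F).
  apply: (measurability _ (RGenOInfty.measurableE R)) => _ [_ [c ->] <-].
  rewrite (_ : _ `&` _ = `]0, 1[%classic `&` `]F c, +oo[%classic); first exact: measurableI.
  apply/seteqP; split => u /=; rewrite !in_itv/= !andbT => -[u01 h];
    split => //; move: h; by rewrite !ltNge quantile_le.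
exact/(measurable_restrictT _ mD).
Qed.

(** For a uniform variable U, the event F^-1(U) <= r is U <= F r. *)
Lemma uniform_quantile r :
  uniform_prob (ltr01 : (0 : R) < 1) (quantile0 @^-1` `]-oo, r]) = (F r)%:E.
Proof.
set A := quantile0 @^-1` _.
have mA : measurable (A : set (measurableTypeR R)).
  by rewrite -[X in measurable X]setTI; exact: measurable_quantile0.
have m1 : measurable_fun setT (EFin \o \1_A : measurableTypeR R -> \bar R).
  by apply/measurable_EFinP; exact: measurable_indic.
have := integral_uniform (ltr01 : (0 : R) < 1) m1.
rewrite integral_indic// setIT => -> //; last by move=> x; rewrite lee_fin.
rewrite subr0 invr1 mul1e -integral_itv_obnd_cbnd; last first.
  by apply/measurable_EFinP/measurable_indic.
rewrite -integral_itv_bndo_bndc; last first.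
  by apply/measurable_EFinP/measurable_indic.
rewrite integral_indic//.
have [F0 F1] : 0 <= F r /\ F r <= 1 by case/andP: (cdfF_itv r).
have AE u : 0 < u < 1 -> A u = (u <= F r).
  move=> u01; rewrite /A/= in_itv/= /quantile0 patchE mem_set; last by rewrite /= in_itv.
  by rewrite quantile_le.
have [Fr1|Fr1] := eqVneq (F r) 1.
  rewrite (_ : A `&` _ = `]0, 1[%classic).
    by apply: (etrans (lebesgue_measure_itv _)); rewrite /= lte01 Fr1 oppr0 adde0.
  apply/seteqP; split => u /=; first by case.
  by rewrite in_itv/= => u01; split => //; rewrite AE// Fr1 ltW//; case/andP: u01.
rewrite (_ : A `&` _ = `]0, F r]%classic).
  apply: (etrans (lebesgue_measure_itv _)); rewrite /= lte_fin.
  case: ltP => h; first by rewrite oppr0 adde0.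
  by congr EFin; apply/eqP; rewrite eq_le F0 h.
have Flt : F r < 1 by rewrite lt_neqAle Fr1.
apply/seteqP; split => u /=; rewrite !in_itv/=.
  by move=> [Au u01]; move: Au; rewrite AE// => ->; case/andP: u01 => ->.
move=> /andP[u0 uF]; have u01 : 0 < u < 1 by rewrite u0 (le_lt_trans uF).
by rewrite AE// u01.
Qed.

Lemma quantile_transform (h : R -> R) :
  measurable_fun setT h -> (forall x, 0 <= h x) ->
  (\int[P]_w (h (Y w))%:E = \int[lebesgue_measure]_(u in `]0%R, 1%R[) (h (quantile F u))%:E)%E.
Proof.
move=> mh h0.
have mEh : measurable_fun setT (EFin \o h) by exact/measurable_EFinP.
have mq := measurable_quantile0.
pose Q : {mfun measurableTypeR R >-> R} :=
  @mfun_Sub _ _ (measurableTypeR R) R _ (mem_set mq).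
have h0E x : (0 <= (EFin \o h) x)%E by rewrite lee_fin.
have := ge0_integral_distribution (P := P) Y mEh h0E; rewrite /= => <-.
rewrite (eq_measure_integral (distribution (uniform_prob (ltr01 : (0 : R) < 1)) Q)); last first.
  move=> A mA _; apply: (@prob_eq_cdf R (distribution P Y) (distribution _ Q)) => //.
  - exact: probability_setT.
  - exact: probability_setT.
  - by move=> r; rewrite -[LHS]/(cdf Y r) hF -uniform_quantile.
have := ge0_integral_distribution (P := uniform_prob (ltr01 : (0 : R) < 1)) Q mEh h0E.
rewrite /= => ->.
have mhq : measurable_fun setT (fun u : R => (h (quantile0 u))%:E).
  by apply/measurable_EFinP; exact: (measurableT_comp mh measurable_quantile0).
rewrite integral_uniform//; last by move=> x; rewrite lee_fin.
rewrite subr0 invr1 mul1e -integral_itv_obnd_cbnd; last exact: measurable_funTS.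
rewrite -integral_itv_bndo_bndc; last exact: measurable_funTS.
by apply: eq_integral => u u01; rewrite /quantile0 patchE u01.
Qed.

Lemma L1_ramp q : L1 P Y -> L1 P (fun w => ramp (q - Y w)).
Proof.
move=> iY; apply: (@L1_dom _ _ _ _ _ (fun w => `|q| + `|Y w|)).
- apply: (measurableT_comp (@measurable_ramp R)); exact: measurable_funB.
- apply: L1D; first exact: L1_cst.
  exact: (integrable_norm iY).
- by move=> w; have := ramp_lip (q - Y w) 0; have := ler_normB q (Y w);
    rewrite {2}/ramp maxxx !subr0; exact: (fun a b => le_trans b a).
Qed.

(** For 0 < u < 1 the quantile at u is at most q = quantile F a exactly when u <= a, so
    the quantile transform turns E (q - Y)^+ into the integral of q - F^-1 over
    ]0, a], which is a q - a es. *)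
Lemma es_ramp a : L1 P Y -> 0 < a < 1 -> {for quantile F a, continuous F} ->
  expected_shortfall F a = quantile F a - a^-1 * Ex P (fun w => ramp (quantile F a - Y w)).
Proof.
move=> iY a01 cF; have [a0 a1] := andP a01.
set q := quantile F a.
have mA : measurable (`]0, a]%classic : set (measurableTypeR R)) by [].
have mq : @measurable_fun _ _ (measurableTypeR R) R `]0, a]%classic (quantile F).
  have : @measurable_fun _ _ (measurableTypeR R) R `]0, a]%classic quantile0.
    exact: measurable_funTS measurable_quantile0.
  apply: eq_measurable_fun => u; rewrite inE/= in_itv/= => /andP[u0 ua].
  by rewrite /quantile0 patchE mem_set//= in_itv/= u0 (le_lt_trans ua).
have E : (\int[P]_w (ramp (q - Y w))%:E =
    \int[lebesgue_measure]_(u in `]0%R, a]) (q - quantile F u)%:E)%E.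
  rewrite (quantile_transform (h := fun y => ramp (q - y))); first last.
  - by move=> x; exact: ramp_ge0.
  - by apply: (measurableT_comp (@measurable_ramp R)); exact: measurable_funB.
  rewrite (_ : `]0, a]%classic = `]0, 1[ `&` `]0, a]); last first.
    apply/seteqP; split => u /=; rewrite !in_itv/=; last by case.
    by move=> /andP[u0 ua]; rewrite u0 ua (le_lt_trans ua).
  rewrite integral_mkcondr; apply: eq_integral => u; rewrite inE/= in_itv/= => u01.
  rewrite patchE; case: ifPn; rewrite ?inE ?notin_setE/= in_itv/=.
    move=> /andP[_ ua]; congr EFin; rewrite /ramp max_l// subr_ge0.
    by rewrite quantile_le// cdf_quantile.
  have [u0 _] := andP u01; rewrite u0/= => /negP; rewrite -ltNge => au.
  congr EFin; rewrite /ramp max_r// subr_le0 leNgt; apply/negP => /ltW.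
  by rewrite quantile_le// cdf_quantile// leNgt au.
have iq : lebesgue_measure.-integrable (`]0, a]%classic : set (measurableTypeR R))
    (fun u => (q - quantile F u)%:E).
  apply/integrableP; split; first by apply/measurable_EFinP; exact: measurable_funB.
  have -> : (\int[lebesgue_measure]_(x in `]0%R, a]) `|(q - quantile F x)%:E| =
      \int[lebesgue_measure]_(x in `]0%R, a]) (q - quantile F x)%:E)%E.
    apply: eq_integral => u; rewrite inE/= in_itv/= => /andP[u0 ua].
    rewrite ger0_norm// subr_ge0 quantile_le ?u0 ?(le_lt_trans ua)//.
    by rewrite cdf_quantile.
  by rewrite -E -EFin_Ex ?ltry//; exact: L1_ramp.
have la : lebesgue_measure (`]0, a]%classic : set (measurableTypeR R)) = a%:E.
  by apply: (etrans (lebesgue_measure_itv _)); rewrite /= lte_fin a0 oppr0 adde0.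
have ic : lebesgue_measure.-integrable (`]0, a]%classic : set (measurableTypeR R))
    (fun=> q%:E).
  apply/integrableP; split; first exact: measurable_cst.
  by rewrite integral_cst// [X in (_ * X)%E](_ : _ = a%:E) ?ltry//; exact: la.
rewrite /expected_shortfall.
have -> : Ex P (fun w => ramp (q - Y w)) =
    \int[lebesgue_measure]_(u in `]0, a]) (q - quantile F u).
  by rewrite /Rintegral E.
have -> : \int[lebesgue_measure]_(u in `]0, a]) quantile F u =
    \int[lebesgue_measure]_(u in `]0, a]) (q - (q - quantile F u)).
  by apply: eq_Rintegral => u _; rewrite opprB addrC subrK.
rewrite RintegralB// Rintegral_cst//.
rewrite (_ : fine _ = a); last exact: (congr1 fine la).
by rewrite mulrBr mulrCA mulVf ?gt_eqF// mulr1.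
Qed.

Lemma L1_lower_sqr q : assumption_B Y -> L1 P (fun w => (Y w <= q)%R%:R * Y w ^+ 2).
Proof.
rewrite /assumption_B /lower_moment2 unlock => B.
have mI z : measurable_fun setT (fun w => (Y w <= z)%R%:R * Y w ^+ 2).
  apply: measurable_funM; last exact: measurable_funX.
  exact: (measurableT_comp (measurable_le_indicator z)).
have i0 : L1 P (fun w => (Y w <= 0)%R%:R * Y w ^+ 2).
  apply/integrableP; split; first exact/measurable_EFinP.
  apply: le_lt_trans B; rewrite le_eqVlt; apply/orP; left; apply/eqP.
  apply: eq_integral => w _ /=.
  by rewrite ger0_norm// mulr_ge0// ?ler0n// sqr_ge0.
apply: (@L1_dom _ _ _ _ _ (fun w => (Y w <= 0)%R%:R * Y w ^+ 2 + q ^+ 2)) => //.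
  by apply: L1D => //; exact: L1_cst.
move=> w; rewrite ger0_norm; last by rewrite mulr_ge0// ?ler0n// sqr_ge0.
have [h1|h1] := leP (Y w) q; have [h2|h2] := leP (Y w) 0; rewrite /= ?mul0r ?mul1r ?add0r;
  rewrite ?lerDl ?addr_ge0 ?sqr_ge0//.
by rewrite ler_sqr ?nnegrE; lra.
Qed.

Lemma L1_ramp_prod q q' : assumption_B Y -> L1 P Y ->
  L1 P (fun w => ramp (q - Y w) * ramp (q' - Y w)).
Proof.
move=> B iY; set z := Num.max q q'.
have i2 := L1_lower_sqr z B; have ir := L1_ramp z iY.
have [iI _] := Ex_le_indicator z hF.
apply: (@L1_dom _ _ _ _ _ (fun w => 2 * z ^+ 2 + 2 * ((Y w <= z)%R%:R * Y w ^+ 2))).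
- by apply: measurable_funM; apply: (measurableT_comp (@measurable_ramp R));
    exact: measurable_funB.
- by apply: L1D; [exact: L1_cst|exact: L1Z].
move=> w; rewrite ger0_norm ?mulr_ge0 ?ramp_ge0//.
have rz x : x <= z -> ramp (x - Y w) <= ramp (z - Y w).
  by move=> xz; rewrite /ramp; case: (leP (x - Y w)); case: (leP (z - Y w)) => //; lra.
apply: (@le_trans _ _ (ramp (z - Y w) * ramp (z - Y w))).
  by apply: ler_pM; rewrite ?ramp_ge0// rz// /z le_max lexx ?orbT.
have := sqr_ge0 (z + Y w); have := sqr_ge0 z; rewrite !expr2.
move: (Y w) (z : R) => y c.
have [h|h] := leP y c; have [[? ->]|[? ->]] := rampP (c - y);
  rewrite /= ?mul1r ?mul0r; nra.
Qed.

(** On Y <= q both factors are affine in Y, elsewhere the product vanishes; and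
    1_(Y <= q) Y = 1_(Y <= q) q - (q - Y)^+. *)
Lemma Ex_ramp_prod q q' : assumption_B Y -> L1 P Y -> q <= q' ->
  Ex P (fun w => ramp (q - Y w) * ramp (q' - Y w)) =
  F q * (q * q') - (q + q') * (F q * q - Ex P (fun w => ramp (q - Y w))) +
  fine (lower_moment2 Y q).
Proof.
move=> B iY qq'.
have [iI EI] := Ex_le_indicator q hF.
have i2 := L1_lower_sqr q B.
have ir := L1_ramp q iY.
pose g w := (q * q' - (q + q') * q) * (Y w <= q)%R%:R + (q + q') * ramp (q - Y w)
   + (Y w <= q)%R%:R * Y w ^+ 2.
have -> : (fun w => ramp (q - Y w) * ramp (q' - Y w)) = g.
  apply/funext => w; rewrite /g.
  have [h1|h1] := leP (Y w) q.
    by rewrite /ramp !max_l ?subr_ge0// ?(le_trans h1)//=; ring.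
  by rewrite {1 3}/ramp max_r ?subr_le0 ?(ltW h1)//=; ring.
rewrite /lower_moment2 unlock -/(Rintegral P setT _) /g RintegralD//; last first.
  exact: L1D (L1Z _ iI) (L1Z _ ir).
rewrite RintegralD ?(RintegralZl _ measurableT) ?EI//; try exact: L1Z.
by ring.
Qed.

End distribution_function.

(** * Asymptotic covariance *)

(** The influence function of the expected shortfall: its average over the sample is
    the centred value at the quantile of the empirical objective. *)
Definition es_influence (R : realType) (F : R -> R) (a y : R) : R :=
  quantile F a - a^-1 * ramp (quantile F a - y) - expected_shortfall F a.

Lemma measurable_es_influence (R : realType) (F : R -> R) (a : R) :
  measurable_fun setT (es_influence F a).
Proof.
apply: measurable_funB => //; apply: measurable_funB => //; apply: measurable_funM => //.
by apply: (measurableT_comp (@measurable_ramp R)); exact: measurable_funB.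
Qed.

Section asymptotic_covariance.
Context d (T : measurableType d) (R : realType) (P : probability T R).
Variables (Y : {RV P >-> R}) (F : R -> R).
Hypothesis hF : forall r, cdf Y r = (F r)%:E.
Hypotheses (iY : L1 P Y) (B : assumption_B Y).

Let reg a := 0 < a < 1 /\ {for quantile F a, continuous F}.

Lemma es_influenceE a y : reg a -> es_influence F a y =
  a^-1 * (Ex P (fun w => ramp (quantile F a - Y w)) - ramp (quantile F a - y)).
Proof. by move=> [a01 cF]; rewrite /es_influence (es_ramp hF iY a01 cF); ring. Qed.

Lemma Ex_es_influence a : reg a -> Ex P (fun w => es_influence F a (Y w)) = 0.
Proof.
move=> ra; under eq_Rintegral do rewrite es_influenceE//.
have ir := L1_ramp (quantile F a) iY.
have ic : L1 P (fun=> Ex P (fun w => ramp (quantile F a - Y w))) by exact: L1_cst.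
rewrite (RintegralZl _ measurableT); last exact: L1B.
by rewrite RintegralB// Ex_cst subrr mulr0.
Qed.

Lemma L1_es_influence_prod a b : reg a -> reg b ->
  L1 P (fun w => es_influence F a (Y w) * es_influence F b (Y w)).
Proof.
move=> ra rb; set qa := quantile F a; set qb := quantile F b.
have ia := L1_ramp qa iY; have ib := L1_ramp qb iY.
have iab := L1_ramp_prod hF qa qb B iY.
pose A := Ex P (fun w => ramp (qa - Y w)); pose A' := Ex P (fun w => ramp (qb - Y w)).
rewrite (_ : (fun w => _) = fun w => (a^-1 * b^-1) *
   (A * A' - A' * ramp (qa - Y w) - A * ramp (qb - Y w) + ramp (qa - Y w) * ramp (qb - Y w))).
  apply: L1Z; apply: L1D => //; apply: L1B; last exact: L1Z.
  by apply: L1B; [exact: L1_cst|exact: L1Z].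
by apply/funext => w; rewrite !es_influenceE// /A /A' -/qa -/qb; ring.
Qed.

Lemma Ex_es_influence_prod a b : reg a -> reg b ->
  Ex P (fun w => es_influence F a (Y w) * es_influence F b (Y w)) = es_cov Y F a b.
Proof.
wlog ab : a b / a <= b.
  move=> H ra rb; have [ab|/ltW ba] := leP a b; first exact: H.
  under eq_Rintegral do rewrite mulrC.
  rewrite H// /es_cov [Num.min b a]minC [b * a]mulrC.
  ring.
move=> ra rb; set qa := quantile F a; set qb := quantile F b.
have [/andP[a0 a1] cFa] := ra; have [/andP[b0 b1] cFb] := rb.
have Fa : F qa = a by exact: (cdf_quantile hF ra.1 cFa).
have Fb : F qb = b by exact: (cdf_quantile hF rb.1 cFb).
have qab : qa <= qb by rewrite (quantile_le hF _ ra.1) Fb.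
have ia := L1_ramp qa iY; have ib := L1_ramp qb iY.
have iab := L1_ramp_prod hF qa qb B iY.
have ea := es_ramp hF iY ra.1 cFa; have eb := es_ramp hF iY rb.1 cFb.
have eab := Ex_ramp_prod hF B iY qab.
rewrite -/qa in ea; rewrite -/qb in eb.
pose A := Ex P (fun w => ramp (qa - Y w)); pose A' := Ex P (fun w => ramp (qb - Y w)).
rewrite -/A in ea; rewrite -/A' in eb; rewrite -/A Fa in eab.
rewrite (_ : (fun w => _) = fun w => (a^-1 * b^-1) *
   ((A * A' - A' * ramp (qa - Y w) - A * ramp (qb - Y w)) + ramp (qa - Y w) * ramp (qb - Y w))).
  have ic : L1 P (fun=> A * A') by exact: L1_cst.
  have i1 := L1Z A' ia; have i2 := L1Z A ib.
  have i3 := L1B ic i1; have i4 := L1B i3 i2.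
  rewrite (RintegralZl _ measurableT); last exact: L1D.
  rewrite (RintegralD measurableT i4 iab) (RintegralB measurableT i3 i2).
  rewrite (RintegralB measurableT ic i1) (RintegralZl _ measurableT ia).
  rewrite (RintegralZl _ measurableT ib) Ex_cst eab -/A -/A'.
  rewrite /es_cov -/qa -/qb (min_l ab) ea eb.
  have an0 : a != 0 by rewrite gt_eqF.
  have bn0 : b != 0 by rewrite gt_eqF.
  by rewrite -/qa; field; rewrite an0 bn0.
by apply/funext => w; rewrite !es_influenceE// -/qa -/qb -/A -/A'; ring.
Qed.

(** [es_cov] is the Gram matrix of the influence functions in L2. *)
Lemma qform_es_cov k (alpha : 'I_k -> R) (c : 'I_k -> R) : (forall m, reg (alpha m)) ->
  L1 P (fun w => (\sum_m c m * es_influence F (alpha m) (Y w)) ^+ 2) /\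
  Ex P (fun w => (\sum_m c m * es_influence F (alpha m) (Y w)) ^+ 2) =
  qform (fun s t => es_cov Y F (alpha s) (alpha t)) c.
Proof.
move=> ra.
have ip s t : L1 P (fun w => (c s * c t) *
    (es_influence F (alpha s) (Y w) * es_influence F (alpha t) (Y w))).
  by apply: L1Z; exact: L1_es_influence_prod.
have -> : (fun w => (\sum_m c m * es_influence F (alpha m) (Y w)) ^+ 2) =
  fun w => \sum_s \sum_t (c s * c t) *
    (es_influence F (alpha s) (Y w) * es_influence F (alpha t) (Y w)).
  apply/funext => w; rewrite expr2 mulr_suml; apply: eq_bigr => s _.
  by rewrite mulr_sumr; apply: eq_bigr => t _; ring.
split; first by apply: L1_sum => s; exact: L1_sum.
rewrite Ex_sum; last by move=> s; exact: L1_sum.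
apply: eq_bigr => s _; rewrite Ex_sum//; apply: eq_bigr => t _.
rewrite (RintegralZl _ measurableT) ?Ex_es_influence_prod//.
exact: L1_es_influence_prod.
Qed.

Lemma psd_es_cov k (alpha : 'I_k -> R) : (forall m, reg (alpha m)) ->
  psd (fun s t => es_cov Y F (alpha s) (alpha t)).
Proof.
move=> ra; split=> [s t|c].
  rewrite -(Ex_es_influence_prod (ra s) (ra t)) -(Ex_es_influence_prod (ra t) (ra s)).
  by apply: eq_Rintegral => w _; exact: mulrC.
have [_ <-] := qform_es_cov c ra.
by apply: Rintegral_ge0 => w _; exact: sqr_ge0.
Qed.

End asymptotic_covariance.

(** * Minimizers of the empirical scores *)

Lemma check_lossE (R : realType) (a x y : R) :
  ((y <= x)%R%:R - a) * (x - y) = ramp (x - y) - a * (x - y).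
Proof. by have [[h ->]|[h ->]] := rampP (x - y); case: (leP y x) => h1 /=; nra. Qed.

Lemma sum_check_loss (R : realType) n (y : 'I_n -> R) (a x : R) : 0 < a -> (0 < n)%N ->
  \sum_i ((y i <= x)%R%:R - a) * (x - y i) =
  a * (\sum_i y i - n%:R * emp_objective y a x).
Proof.
move=> a0 n0; under eq_bigr do rewrite check_lossE.
rewrite sumrB -mulr_sumr sumrB sumr_const card_ord -[x *+ n]mulr_natl /emp_objective.
have an0 : a != 0 by rewrite gt_eqF.
have nn0 : n%:R != 0 :> R by rewrite pnatr_eq0 -lt0n.
by field; rewrite an0 nn0.
Qed.

(** The empirical score after removing a constant and the factor -n; it is to be
    maximized. *)
Definition profile (R : realType) (calG : R -> R) n (y : 'I_n -> R) k (alpha p : 'I_k -> R)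
    (x : 'I_k -> R) (v : R) : R :=
  \sum_m (alpha m + p m * derive1 calG v) * emp_objective y (alpha m) (x m)
  - derive1 calG v * v + calG v.

Lemma sum_score_sp (R : realType) (calG : R -> R) n (y : 'I_n -> R) k
    (alpha p x : 'I_k -> R) (v : R) : (0 < n)%N -> (forall m, 0 < alpha m) ->
  \sum_m p m = 1 ->
  \sum_i score_sp calG alpha p x v (y i) =
  (\sum_m alpha m) * (\sum_i y i) - n%:R * profile calG y alpha p x v.
Proof.
move=> n0 a0 p1; rewrite /score_sp /profile exchange_big/=.
set G := derive1 calG v; set s := \sum_i y i.
have E m : \sum_i ((1 + p m / alpha m * G) * ((y i <= x m)%R%:R - alpha m) * (x m - y i)
     + p m * (G * (v - y i) - calG v)) =
   (alpha m + p m * G) * (s - n%:R * emp_objective y (alpha m) (x m)) +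
   p m * (G * (n%:R * v - s) - n%:R * calG v).
  rewrite big_split/=; congr (_ + _).
    under eq_bigr do rewrite -mulrA.
    rewrite -mulr_sumr sum_check_loss// -/s.
    have an0 : alpha m != 0 by rewrite gt_eqF.
    by field.
  rewrite -mulr_sumr sumrB -mulr_sumr sumrB !sumr_const card_ord -[v *+ n]mulr_natl.
  by rewrite -[calG v *+ n]mulr_natl.
under eq_bigr do rewrite E.
rewrite big_split/= -mulr_suml p1 mul1r.
under eq_bigr do rewrite mulrBr.
rewrite sumrB -mulr_suml big_split/= -mulr_suml p1.
under [X in _ - X + _]eq_bigr do rewrite mulrCA.
rewrite -mulr_sumr; ring.
Qed.

Section weight_function.
Context (R : realType) (calG : R -> R).
Hypothesis hcalG : continuously_differentiable3 calG.
Hypothesis hG' : forall x : R, 0 < (calG^`())^`() x.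
Hypothesis hG0 : derive1 calG x @[x --> -oo] --> (0 : R).

Lemma weight_nd x y : x <= y -> derive1 calG x <= derive1 calG y.
Proof.
move=> xy; have [dG _] := hcalG.
have dG1 z : derivable (calG^`()) z 1 by have := dG 1%N z isT; rewrite derive1n1.
apply: (@ger0_derive1_le_oo _ _ (x - 1) (y + 1)) => //.
- by move=> z _; exact: ltW.
- by move=> z _; apply/differentiable_continuous/derivable1_diffP.
- by rewrite in_itv/=; lra.
- by rewrite in_itv/=; lra.
Qed.

(** A negative value would bound G away from 0 near -oo, by monotonicity. *)
Lemma weight_ge0 x : 0 <= derive1 calG x.
Proof.
rewrite leNgt; apply/negP => x0.
have e0 : 0 < - derive1 calG x by rewrite oppr_gt0.
have /cvgrPdist_lt/(_ _ e0) [M [_ hM]] := hG0.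
pose z := Num.min (M - 1) x.
have zM : z < M by rewrite /z gt_min; apply/orP; left; lra.
have zx : derive1 calG z <= derive1 calG x by apply: weight_nd; rewrite /z ge_min lexx orbT.
have := hM z zM; rewrite sub0r normrN ltr_norml => /andP[h1 h2]; lra.
Qed.

(** In the profile, x m is multiplied by alpha m + p m * G(v) > 0, and the derivative in
    v is G'(v) (c - v), where c is the weighted sum of the objectives. *)
Lemma argmin_score_sp n (y : 'I_n -> R) k (alpha p q : 'I_k -> R) (v : R) :
  (0 < n)%N -> (forall m, 0 < alpha m) -> (forall m, 0 < p m) -> \sum_m p m = 1 ->
  argmin (fun x : ('I_k -> R) * R => \sum_(i < n) score_sp calG alpha p x.1 x.2 (y i)) (q, v) ->
  (forall m x, emp_objective y (alpha m) x <= emp_objective y (alpha m) (q m)) /\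
  v = \sum_m p m * emp_objective y (alpha m) (q m).
Proof.
move=> n0 a0 p0 p1 qmin.
have nR : (0 : R) < n%:R by rewrite ltr0n.
have prof x u : profile calG y alpha p x u <= profile calG y alpha p q v.
  have := qmin (x, u); rewrite /= !sum_score_sp// lerD2l lerN2 ler_pM2l//.
split=> [m x|].
  have := prof (fun j => if j == m then x else q j) v.
  rewrite /profile lerD2r lerD2r (bigD1 m)//= [leRHS](bigD1 m)//= eqxx.
  rewrite (eq_bigr (fun j => (alpha j + p j * derive1 calG v) * emp_objective y (alpha j) (q j))).
    rewrite lerD2r ler_pM2l//; apply: ltr_pwDl => //.
    by apply: mulr_ge0; [exact: ltW|exact: weight_ge0].
  by move=> j /negbTE ->.
set c := \sum_m _.
have [dG _] := hcalG.
have dG0 z : derivable calG z 1 by have := dG 0%N z isT; rewrite derive1n0.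
have dG1 z : derivable (calG^`()) z 1 by have := dG 1%N z isT; rewrite derive1n1.
pose D (u : R) : R := derive1 calG u * (c - u) + calG u.
have Dmax u : D u <= D v.
  have := prof q u; rewrite /profile /D /c.
  have E z : \sum_m (alpha m + p m * derive1 calG z) * emp_objective y (alpha m) (q m) =
     \sum_m alpha m * emp_objective y (alpha m) (q m) + derive1 calG z * c.
    under eq_bigr do rewrite mulrDl.
    rewrite big_split/= /c mulr_sumr; congr (_ + _); apply: eq_bigr => m _; ring.
  rewrite !E /c; lra.
have dD (u : R) : is_derive u 1 D (derive1 (calG^`()) u * (c - u)).
  have h0 : is_derive u 1 calG (derive1 calG u) by rewrite derive1E; exact/derivableP.
  have h1 : is_derive u 1 (calG^`()) (derive1 (calG^`()) u).
    by rewrite derive1E; exact/derivableP.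
  apply: is_derive_eq; rewrite /GRing.scale/=; ring.
have : is_derive v 1 D 0.
  apply: (@derive1_at_max _ _ (v - 1) (v + 1)).
  - by lra.
  - by move=> t _; exact: ex_derive.
  - by rewrite in_itv/=; lra.
  - by move=> t _; exact: Dmax.
move=> h; have := @derive_val _ _ _ _ _ _ _ h; rewrite (@derive_val _ _ _ _ _ _ _ (dD v)).
by move/eqP; rewrite mulf_eq0 gt_eqF//= subr_eq0 => /eqP.
Qed.

Lemma score_es_sp (a x1 x2 z : R) :
  score_es calG a x1 x2 z =
  score_sp calG (fun _ : 'I_1 => a) (fun=> 1) (fun=> x1) x2 z.
Proof. by rewrite /score_es /score_sp big_ord1; ring. Qed.

Lemma argmin_score_es n (y : 'I_n -> R) (a q e : R) : (0 < n)%N -> 0 < a ->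
  argmin (fun x : R * R => \sum_(i < n) score_es calG a x.1 x.2 (y i)) (q, e) ->
  (forall x, emp_objective y a x <= emp_objective y a q) /\ e = emp_objective y a q.
Proof.
move=> n0 a0 qmin.
have := @argmin_score_sp n y 1 (fun=> a) (fun=> 1) (fun=> q) e n0.
case=> //.
- by rewrite big_ord1.
- move=> [x u]; have := qmin (x ord0, u); rewrite /=.
  under eq_bigr do rewrite score_es_sp.
  under [leRHS]eq_bigr do rewrite score_es_sp.
  rewrite (_ : x = fun=> x ord0)//.
  by apply/funext => j; rewrite ord1.
- by move=> h1; rewrite big_ord1 mul1r => ->; split=> // x; exact: (h1 ord0).
Qed.

End weight_function.

(** * Limit law of the spectral risk estimator *)

(** If a convex combination is at least dl in absolute value, then so is one of its
    terms. *)
Lemma cvg_prob0_convex d (T : measurableType d) (R : realType) (P : probability T R)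
    k (p : 'I_k -> R) (D : 'I_k -> nat -> T -> R) :
  (forall m, 0 <= p m) -> \sum_m p m = 1 ->
  (forall m n, measurable_fun setT (D m n)) -> (forall m, cvg_prob0 P (D m)) ->
  cvg_prob0 P (fun n w => \sum_m p m * D m n w).
Proof.
move=> p0 p1 mD cD dl dl0.
have mS n : measurable_fun setT (fun w => \sum_m p m * D m n w).
  by apply: measurable_sum => m; exact: measurable_funM.
have iD m n : L1 P (fun w => (dl <= `|D m n w|)%R%:R : R).
  by apply: L1_ge_indicator; exact: measurableT_comp.
have h : \sum_m Ex P (fun w => (dl <= `|D m n w|)%R%:R : R) @[n --> \oo] --> (0 : R).
  have E : \sum_(m < k) (0 : R) = 0 by rewrite big1.
  by rewrite -[X in _ --> X]E; apply: cvg_big => [|m _]; [exact: add_continuous|exact: cD].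
apply: (squeeze_cvgr _ (cvg_cst 0) h).
apply: nearW => n; apply/andP; split; first by apply: Rintegral_ge0 => w _; exact: ler0n.
rewrite -Ex_sum//; apply: le_Ex.
- by apply: L1_ge_indicator; exact: measurableT_comp.
- exact: L1_sum.
move=> w; have [hd|_] := leP dl; last by apply: sumr_ge0 => m _; exact: ler0n.
have [/existsP[m hm]|] := boolP [exists m, dl <= `|D m n w|].
  by rewrite (bigD1 m)//= hm lerDl; apply: sumr_ge0 => j _; exact: ler0n.
move=> /existsPn hn; exfalso; move: hd; apply/negP; rewrite -ltNge.
apply: le_lt_trans (ler_norm_sum _ _ _) _.
have [m pm] : exists m, 0 < p m.
  apply/existsP; apply: contraT => /existsPn hp; move: (@ltr01 R); rewrite -p1 big1 ?ltxx// => m _.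
  by apply/eqP; rewrite eq_le p0 andbT leNgt.
rewrite -[ltRHS]mul1r -p1 mulr_suml (bigD1 m)//= [ltRHS](bigD1 m)//=.
apply: ltr_leD.
  by rewrite normrM (ger0_norm (p0 m)) ltr_pM2l// ltNge; exact: hn.
apply: ler_sum => j _; rewrite normrM (ger0_norm (p0 j)) ler_wpM2l//.
by apply: ltW; rewrite ltNge; exact: hn.
Qed.

Lemma sum_es_influence d (T : measurableType d) (R : realType) (X : nat -> {mfun T >-> R})
    (F : R -> R) k (alpha p : 'I_k -> R) n w : (0 < n)%N ->
  n%:R^-1 * psum X (fun y => \sum_m p m * es_influence F (alpha m) y) n w =
  \sum_m p m * es_objective X (alpha m) n w (quantile F (alpha m)) - spectral_risk F alpha p.
Proof.
move=> n0; have nn0 : n%:R != 0 :> R by rewrite pnatr_eq0 -lt0n.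
rewrite /psum exchange_big/= mulr_sumr /spectral_risk -sumrB; apply: eq_bigr => m _.
rewrite -mulr_sumr mulrCA -mulrBr; congr (_ * _).
rewrite /es_objective /emp_objective /psum /es_influence !sumrB !sumr_const card_ord -mulr_sumr.
rewrite -[quantile _ _ *+ n]mulr_natl -[expected_shortfall _ _ *+ n]mulr_natl !mulrBr.
by rewrite !mulKf// mulrCA.
Qed.

Section spectral_clt.
Context d dY (T : measurableType d) (TY : measurableType dY) (R : realType)
  (P : probability T R) (PY : probability TY R).
Variables (X : nat -> {RV P >-> R}) (Y : {RV PY >-> R}) (F : R -> R).
Hypotheses (hF : forall r, cdf Y r = (F r)%:E)
  (hXF : forall i r, cdf (X i) r = (F r)%:E) (indX : mutually_independent X)
  (iY : L1 PY Y) (B : assumption_B Y).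
Variables (k : nat) (alpha p : 'I_k -> R).
Hypotheses (a01 : forall m, 0 < alpha m < 1) (p0 : forall m, 0 < p m)
  (p1 : \sum_m p m = 1)
  (hq : forall m, {for quantile F (alpha m), continuous F} /\
     strictly_increasing_at F (quantile F (alpha m))).
Variables (qhat : nat -> T -> 'I_k -> R) (nuhat : nat -> T -> R).
Hypotheses
  (qmax : forall m n w x, (0 < n)%N ->
     es_objective X (alpha m) n w x <= es_objective X (alpha m) n w (qhat n w m))
  (nuE : forall n w, (0 < n)%N ->
     nuhat n w = \sum_m p m * es_objective X (alpha m) n w (qhat n w m)).

Let phi y := \sum_m p m * es_influence F (alpha m) y.
Let Z n w := Num.sqrt n%:R * (nuhat n w - spectral_risk F alpha p).
Let Z' n w := (Num.sqrt n%:R)^-1 * psum X phi n w.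

Let mphi : measurable_fun setT phi.
Proof.
apply: measurable_sum => m; apply: measurable_funM => //; exact: measurable_es_influence.
Qed.

Let mqhat m n : (0 < n)%N ->
  measurable_fun setT (fun w => es_objective X (alpha m) n w (qhat n w m)).
Proof.
move=> n0; apply: (@measurable_es_max _ _ _ _ _ _ (fun w => qhat n w m)) => //.
- by case/andP: (a01 m).
- by move=> w x; exact: qmax.
Qed.

Lemma measurable_spectral_error n : measurable_fun setT (Z n).
Proof.
have [->|n0] := posnP n.
  rewrite (_ : Z 0%N = fun=> 0)//.
  by apply/funext => w; rewrite /Z sqrtr0 mul0r.
apply: measurable_funM => //; apply: measurable_funB => //.
rewrite (_ : nuhat n = fun w => \sum_m p m * es_objective X (alpha m) n w (qhat n w m)).
  by apply: measurable_sum => m; apply: measurable_funM => //; exact: mqhat.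
by apply/funext => w; exact: nuE.
Qed.

(** The estimation error is a normalized sum of i.i.d. centred variables, up to a
    convex combination of the negligible terms of [es_remainder]. *)
Lemma cvg_spectral_error (h : R -> R) : taylor_test h ->
  Ex P (fun w => h (Z n w)) @[n --> \oo] -->
  Ex (@normal_prob R 0 1) (fun z : R => h (Num.sqrt
    (qform (fun s t => es_cov Y F (alpha s) (alpha t)) p) * z)).
Proof.
move=> th.
have reg m : 0 < alpha m < 1 /\ {for quantile F (alpha m), continuous F}.
  by split; [exact: a01|exact: (hq m).1].
have XY i r : cdf (X i) r = cdf Y r by rewrite hXF hF.
have [i2 <-] := qform_es_cov hF iY B p reg.
have iinf m : L1 PY (fun w => es_influence F (alpha m) (Y w)).
  apply: L1B; last exact: L1_cst.
  by apply: L1B; [exact: L1_cst|apply: L1Z; exact: L1_ramp].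
have phi0 : Ex PY (fun w => phi (Y w)) = 0.
  rewrite /phi Ex_sum; last by move=> m; exact: L1Z.
  rewrite big1// => m _.
  by rewrite (RintegralZl _ measurableT (iinf m)) (Ex_es_influence hF iY (reg m)) mulr0.
have clt := clt_taylor XY indX mphi i2 phi0 th.
apply: (slutsky_test (Z' := Z')) => //.
- exact: measurable_spectral_error.
- by move=> n; apply: measurable_funM => //; exact: measurable_psum.
(* for n = 0 both errors are 0, since the square root of 0 and its inverse are 0 *)
rewrite (_ : (fun n w => Z n w - Z' n w) = fun n w => \sum_m p m * (Num.sqrt n%:R *
    (es_objective X (alpha m) n w (qhat n w m) -
     es_objective X (alpha m) n w (quantile F (alpha m))))).
  apply: cvg_prob0_convex => // m => [|n|].
  - exact: ltW.
  - have [->|n0] := posnP n.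
      rewrite (_ : (fun w => _) = fun=> 0)//.
      by apply/funext => w; rewrite sqrtr0 mul0r.
    apply: measurable_funM => //; apply: measurable_funB; first exact: mqhat.
    exact: measurable_es_objective.
  - have [a0 a1] := andP (a01 m).
    apply: (es_remainder (qh := fun n w => qhat n w m) hF XY indX a0 _ (hq m).2).
      exact: (cdf_quantile hF (a01 m) (reg m).2).
    by move=> n w x n0; exact: qmax.
apply/funext => n; apply/funext => w; rewrite /Z /Z'.
have [->|n0] := posnP n.
  by rewrite sqrtr0 invr0 !mul0r subrr big1// => m _; rewrite mul0r mulr0.
have nR : (0 : R) < n%:R by rewrite ltr0n.
have sn : (Num.sqrt n%:R)^-1 = Num.sqrt n%:R * n%:R^-1 :> R.
  have sn0 : Num.sqrt n%:R != 0 :> R by rewrite sqrtr_eq0 -ltNge.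
  by rewrite -{3}[n%:R](sqr_sqrtr (ltW nR)) expr2 invfM mulrA divff// mul1r.
rewrite sn -mulrA sum_es_influence// nuE// -mulrBr.
rewrite opprB addrA subrK.
under [RHS]eq_bigr do rewrite mulrCA.
rewrite -mulr_sumr; congr (_ * _); under [RHS]eq_bigr do rewrite mulrBr.
by rewrite sumrB.
Qed.

Lemma spectral_clt : exists (dW : measure_display) (TW : measurableType dW)
     (PW : probability TW R) (W : 'I_k -> {RV PW >-> R}),
     [/\ jointly_normal W,
         forall m : 'I_k, ('E_PW[W m] = 0)%E,
         forall s t : 'I_k,
           covariance PW (W s) (W t) = (es_cov Y F (alpha s) (alpha t))%:E &
         cvg_in_distribution P Z PW (fun w => \sum_(m < k) p m * W m w)].
Proof.
have reg m : 0 < alpha m < 1 /\ {for quantile F (alpha m), continuous F}.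
  by split; [exact: a01|exact: (hq m).1].
have pS := psd_es_cov hF iY B reg.
have [dW [TW [PW [W GW]]]] := gaussian_family_exists pS.
have [W1 W2 W3] := gaussian_family_cov pS GW.
exists dW, TW, PW, W; split => //.
have mU : measurable_fun setT (fun w => \sum_(m < k) p m * W m w).
  by apply: measurable_sum => m; exact: measurable_funM.
apply: cvg_law_of_steps => //; first exact: measurable_spectral_error.
move=> c a c0; have th := taylor_test_affine a c (@smooth_step_taylor R).
have [mh [M hM] _] := th.
pose v := qform (fun s t => es_cov Y F (alpha s) (alpha t)) p.
have iN : L1 (@normal_prob R 0 1) (fun z : R => smooth_step (c * (Num.sqrt v * z) + a)).
  apply: (@L1_bounded _ _ _ _ _ M) => //.
  by apply: (measurableT_comp mh); exact: measurable_funM.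
have [_ ->] := @centred_normal_Ex _ _ _ _ (mfun_Sub (mem_set mU)) _
  (fun x => smooth_step (c * x + a)) (GW p) mh iN.
exact: (cvg_spectral_error th).
Qed.

End spectral_clt.

Unset Implicit Arguments.
Set Strict Implicit.

Theorem theorem6 (R : realType)
  (dY : measure_display) (TY : measurableType dY) (PY : probability TY R)
  (Y : {RV PY >-> R}) (F : R -> R)
  (hF : forall r : R, cdf Y r = (F r)%:E)
  (hY : ('E_PY[fun w => `|Y w|%R] < +oo)%E)
  (d : measure_display) (T : measurableType d) (P : probability T R)
  (X : nat -> {RV P >-> R})
  (hXF : forall (i : nat) (r : R), cdf (X i) r = (F r)%:E)
  (hXind : mutually_independent X)
  (calG : R -> R)
  (hcalG : continuously_differentiable3 calG)
  (hG' : forall x : R, 0 < (calG^`())^`() x)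
  (hG0 : calG^`() x @[x --> -oo] --> (0 : R))
  (k : nat) (alpha p : 'I_k -> R)
  (halpha_inj : injective alpha)
  (halpha : forall m : 'I_k, 0 < alpha m < 1)
  (hp : forall m : 'I_k, 0 < p m)
  (hp1 : \sum_(m < k) p m = 1)
  (hquant : forall m : 'I_k,
     {for quantile F (alpha m), continuous F} /\
     strictly_increasing_at F (quantile F (alpha m)))
  (qhat : nat -> T -> 'I_k -> R) (nuhat : nat -> T -> R)
  (hmin : forall (n : nat) (w : T), (0 < n)%N ->
     argmin (fun x : ('I_k -> R) * R =>
               \sum_(i < n) score_sp calG alpha p x.1 x.2 (X i w))
            (qhat n w, nuhat n w)) :
  (forall (n : nat) (w : T) (qt eshat : 'I_k -> R), (0 < n)%N ->
     (forall m : 'I_k,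
        argmin (fun x : R * R =>
                  \sum_(i < n) score_es calG (alpha m) x.1 x.2 (X i w))
               (qt m, eshat m)) ->
     nuhat n w = \sum_(m < k) p m * eshat m) /\
  ((forall m : 'I_k, assumption_A F (alpha m)) ->
   assumption_B Y ->
   exists (dW : measure_display) (TW : measurableType dW)
     (PW : probability TW R) (W : 'I_k -> {RV PW >-> R}),
     [/\ jointly_normal W,
         forall m : 'I_k, ('E_PW[W m] = 0)%E,
         forall s t : 'I_k,
           covariance PW (W s) (W t) = (es_cov Y F (alpha s) (alpha t))%:E &
         cvg_in_distribution P
           (fun n w => Num.sqrt n%:R * (nuhat n w - spectral_risk F alpha p))
           PW (fun w => \sum_(m < k) p m * W m w)]).
Proof.
have a0 m : 0 < alpha m by case/andP: (halpha m).
have key n w : (0 < n)%N ->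
    (forall m x, es_objective X (alpha m) n w x <=
       es_objective X (alpha m) n w (qhat n w m)) /\
    nuhat n w = \sum_m p m * es_objective X (alpha m) n w (qhat n w m).
  move=> n0.
  exact: (argmin_score_sp (y := fun i => X i w) hcalG hG' hG0 n0 a0 hp hp1 (hmin n w n0)).
split=> [n w qt eshat n0 h|_ B].
  have [k1 ->] := key n w n0; apply: eq_bigr => m _; congr (_ * _).
  have [h1 ->] := argmin_score_es (y := fun i => X i w) hcalG hG' hG0 n0 (a0 m) (h m).
  by apply/eqP; rewrite eq_le; apply/andP; split; [exact: h1|exact: k1].
have iY : L1 PY Y.
  by apply/integrableP; split; [exact/measurable_EFinP|move: hY; rewrite unlock].
apply: (spectral_clt hF hXF hXind iY B halpha hp hp1 hquant (qhat := qhat)) => n.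
- by move=> w' w x n0; apply: (key _ _ n0).1.
- by move=> w n0; exact: (key _ _ n0).2.
Qed.
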